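(* Let $F$ be a field of characteristic $p>0$, and let $n\in\mathbb{N}$. Let further $r\in\{0,1,\ldots,p-1\}$ be such that $(n-r,1^r)$ is a $p$-regular partition of $n$, and let $Q$ be a vertex of the simple $F\mathfrak{S}_n$-module $D^{(n-r,1^r)}$. (a) If $p\nmid n$, then $Q$ is $\mathfrak{S}_n$-conjugate to a Sylow $p$-subgroup of $\mathfrak{S}_{n-r-1}\times\mathfrak{S}_r$. (b) If $p=2$, $p\mid n$ and $(n,r)\neq(4,1)$, then $Q$ is a Sylow $2$-subgroup of $\mathfrak{S}_n$. (c) If $p=2$, $n=4$ and $r=1$, then $Q$ is the unique Sylow $2$-subgroup of the alternating group $\mathfrak{A}_4$. (d) If $p>2$ and $p\mid n$, then $Q$ is a Sylow $p$-subgroup of $\mathfrak{S}_n$.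
   Context: $\mathfrak{S}_m$ denotes the symmetric group of degree $m$ (with $\mathfrak{S}_0$ trivial), and $\mathfrak{S}_{n-r-1}\times\mathfrak{S}_r$ is regarded as a subgroup of $\mathfrak{S}_n$ in the usual way (acting on disjoint subsets of $\{1,\ldots,n\}$ of sizes $n-r-1$ and $r$, and fixing the remaining point). Modules are finite-dimensional left modules. For a partition $\lambda$ of $n$, $S^\lambda$ denotes the Specht $F\mathfrak{S}_n$-module labelled by $\lambda$ (James' convention). A partition is $p$-regular if no non-zero part is repeated $p$ or more times; for a $p$-regular partition $\lambda$, $D^\lambda:=S^\lambda/\mathrm{Rad}(S^\lambda)$ is the simple $F\mathfrak{S}_n$-module labelled by $\lambda$. For a finite group $G$ and an indecomposable $FG$-module $M$, a vertex of $M$ is a subgroup $Q$ of $G$ that is minimal with respect to the property that $M$ is isomorphic to a direct summand of $\mathrm{Ind}_Q^G(\mathrm{Res}_Q^G(M))$. The vertices of $M$ form a single $G$-conjugacy class of $p$-subgroups of $G$. *)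

(* Defs.v *)
From mathcomp Require Import all_boot all_order all_algebra.
From mathcomp Require Import all_fingroup all_solvable all_character.
From mathcomp Require Import boolp.

Set Implicit Arguments.
Unset Strict Implicit.
Unset Printing Implicit Defensive.

Import GroupScope GRing.Theory.
Local Open Scope ring_scope.

(* Modules are row-vector representations, with the group acting on the       *)
(* right.  Since (s * t) i = t (s i) in 'S_n, these are the left modules over *)
(* the group of permutations composed from right to left.                     *)

Section Radical.

Variables (F : fieldType) (gT : finGroupType) (G : {group gT}) (m : nat).
Variable rG : mx_representation F G m.

Definition is_radical (R : 'M[F]_m) : Prop :=
  forall v : 'rV[F]_m,
    (v <= R)%MS <->
    (forall V : 'M[F]_m,
       mxmodule rG V -> max_submod rG V 1%:M -> (v <= V)%MS).

Lemma radical_exists : {R : 'M[F]_m | is_radical R /\ mxmodule rG R}.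
Proof.
apply: cid.
suff H : forall k (R : 'M[F]_m), (\rank R < k)%N -> mxmodule rG R ->
    (forall v : 'rV[F]_m, (forall V : 'M[F]_m,
       mxmodule rG V -> max_submod rG V 1%:M -> (v <= V)%MS) -> (v <= R)%MS) ->
    exists R, is_radical R /\ mxmodule rG R.
  apply: (H (\rank (1%:M : 'M[F]_m)).+1 1%:M) => // [|v _].
    exact: mxmodule1.
  exact: submx1.
elim=> [//|k IHk] R ltRk modR maxR.
have [[V [modV maxV nRV]]|nex] := pselect (exists V : 'M[F]_m,
    [/\ mxmodule rG V, max_submod rG V 1%:M & ~~ (R <= V)%MS]).
  apply: (IHk (R :&: V)%MS) => [||v Hv]; first 2 last.
  - by rewrite sub_capmx maxR //= Hv.
  - apply: (@leq_trans (\rank R)); last by [].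
    rewrite ltnNge; apply/negP => le.
    move/negP: nRV; apply.
    have sRV : (R :&: V <= R)%MS by exact: capmxSl.
    have := geq_leqif (mxrank_leqif_sup sRV).
    rewrite le => /esym sRRV.
    exact: submx_trans sRRV (capmxSr _ _).
  - exact: capmx_module.
exists R; split=> // v; split=> [vR V modV maxV|]; last exact: maxR.
apply: submx_trans vR _; apply/negPn/negP => nRV.
by apply: nex; exists V.
Qed.

Definition radical_mx : 'M[F]_m := projT1 radical_exists.

Lemma radical_mxP : is_radical radical_mx.
Proof. by rewrite /radical_mx; case: radical_exists => R []. Qed.

Lemma radical_module : mxmodule rG radical_mx.
Proof. by rewrite /radical_mx; case: radical_exists => R []. Qed.

End Radical.

Section Induction.

Variables (F : fieldType) (gT : finGroupType) (G H : {group gT}) (m : nat).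
Hypothesis sHG : H \subset G.
Variable rH : mx_representation F H m.

Definition coset_rep (i : 'I_#|rcosets H G|) : gT := repr (enum_val i).

Definition ind_block (x : gT) (i j : 'I_#|rcosets H G|) : 'M[F]_m :=
  let y := (coset_rep i * x * (coset_rep j)^-1)%g in
  if y \in H then rH y else 0.

(* The induced module is the direct sum over i of the spaces M (x) t_i, where *)
(* t_i = coset_rep i runs over a right transversal of H in G.  If             *)
(* t_i x = y t_j with y in H, then (v (x) t_i) x = (v y) (x) t_j.             *)
Definition ind_mx (x : gT) : 'M[F]_(\sum_(i < #|rcosets H G|) m) :=
  \mxblock_(i, j) ind_block x i j.

Lemma coset_repP i : coset_rep i \in G /\ enum_val i = H :* coset_rep i.
Proof.
rewrite /coset_rep; have /rcosetsP[x Gx ->] := enum_valP i.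
have xr : repr (H :* x) \in H :* x by apply: mem_repr (rcoset_refl _ _).
split; last by rewrite (rcoset_eqP xr).
case/rcosetP: xr => h Hh ->; rewrite groupM //; exact: (subsetP sHG).
Qed.

Lemma mem_coset_rep x i j :
  ((coset_rep i * x * (coset_rep j)^-1)%g \in H) =
  (H :* (coset_rep i * x)%g == enum_val j).
Proof.
have [_ ->] := coset_repP j.
by rewrite -mem_rcoset; apply/idP/eqP => [/rcoset_eqP|<-] //; rewrite rcoset_refl.
Qed.

Lemma ind_mx_repr : mx_repr G ind_mx.
Proof.
split=> [|x y Gx Gy].
  rewrite /ind_mx -mxdiagZ; apply: eq_mxblock => i j.
  rewrite /ind_block mem_coset_rep mulg1.
  have [_ <-] := coset_repP i.
  rewrite (inj_eq enum_val_inj); case: eqP => [<-|_] //.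
  by rewrite mulgV repr_mx1 conform_mx_id.
rewrite /ind_mx mul_mxblock; apply: eq_mxblock => i l.
have [Gti _] := coset_repP i.
have cos_in : H :* (coset_rep i * x)%g \in rcosets H G.
  by rewrite mem_rcosets mulSGid // groupM.
pose j := enum_rank_in cos_in (H :* (coset_rep i * x)%g).
have ej : enum_val j = H :* (coset_rep i * x)%g by rewrite enum_rankK_in.
have Hij : (coset_rep i * x * (coset_rep j)^-1)%g \in H.
  by rewrite mem_coset_rep ej.
rewrite (bigD1 j) //= big1 ?addr0 => [|j' nj'].
  rewrite /ind_block Hij.
  have -> : (coset_rep i * (x * y) * (coset_rep l)^-1 =
    (coset_rep i * x * (coset_rep j)^-1) *
    (coset_rep j * y * (coset_rep l)^-1))%g by rewrite !mulgA !mulgKV.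
  rewrite groupMl //; case: ifP => Hjl; last by rewrite mulmx0.
  by rewrite repr_mxM.
rewrite /ind_block mem_coset_rep -ej (inj_eq enum_val_inj) eq_sym (negPf nj').
by rewrite mul0mx.
Qed.

Definition ind_repr := MxRepresentation ind_mx_repr.

End Induction.

Section Vertices.

Variables (F : fieldType) (gT : finGroupType) (G : {group gT}).

Definition is_direct_summand (m1 m2 : nat) (M : mx_representation F G m1)
    (N : mx_representation F G m2) : Prop :=
  exists (U W : 'M[F]_m2) (modU : mxmodule N U),
    [/\ mxmodule N W, (U + W :=: 1%:M)%MS, mxdirect (U + W)
      & mx_rsim M (submod_repr modU)].

Definition relatively_projective (m : nat) (M : mx_representation F G m)
    (Q : {group gT}) : Prop :=
  exists sQG : Q \subset G,
    is_direct_summand M (ind_repr sQG (subg_repr M sQG)).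

Definition is_vertex (m : nat) (M : mx_representation F G m)
    (Q : {group gT}) : Prop :=
  relatively_projective M Q /\
  (forall P : {group gT},
     relatively_projective M P -> P \subset Q -> P :=: Q).

End Vertices.

Definition is_partition_of (n : nat) (la : seq nat) : bool :=
  [&& sorted geq la, 0%N \notin la & sumn la == n].

Definition p_regular (p : nat) (la : seq nat) : Prop :=
  forall k : nat, (0 < k)%N -> (count_mem k la < p)%N.

Section Specht.

Variables (F : fieldType) (n : nat) (la : seq nat).

(* A la-tableau is encoded by t : 'S_n: the boxes of the diagram of la are    *)
(* numbered 0, ..., n - 1 row by row, and t k is the entry of box k.          *)
Definition row_of (t : 'S_n) (i : 'I_n) : nat :=
  reshape_index la ((t^-1)%g i).
Definition col_of (t : 'S_n) (i : 'I_n) : nat :=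
  reshape_offset la ((t^-1)%g i).

Definition tabloid (t : 'S_n) : {set 'S_n} :=
  [set u : 'S_n | [forall i, row_of u i == row_of t i]].

Definition tabloids : {set {set 'S_n}} := [set tabloid t | t : 'S_n].

Definition tabloid_vec (T : {set 'S_n}) : 'rV[F]_#|tabloids| :=
  \row_j (enum_val j == T)%:R.

(* s replaces each entry a by s a, so it maps the tabloid of t to the tabloid *)
(* of t * s.                                                                  *)
Definition perm_module_mx (s : 'S_n) : 'M[F]_#|tabloids| :=
  \matrix_i tabloid_vec (enum_val i :* s).

Lemma tabloidM t s : tabloid t :* s = tabloid (t * s)%g.
Proof.
have rowM u v i : row_of (u * v)%g i = row_of u ((v^-1)%g i).
  by rewrite /row_of invMg permM.
apply/setP=> u; rewrite mem_rcoset !inE; apply/forallP/forallP => H i.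
  by have := H ((s^-1)%g i); rewrite !rowM invgK permKV.
by have := H (s i); rewrite !rowM invgK permK.
Qed.

Lemma tabloid_vecM (T : {set 'S_n}) s : T \in tabloids ->
  tabloid_vec T *m perm_module_mx s = tabloid_vec (T :* s).
Proof.
move=> Tt; pose i := enum_rank_in Tt T.
have ei : enum_val i = T by rewrite enum_rankK_in.
have -> : tabloid_vec T = delta_mx 0 i.
  by apply/rowP=> j; rewrite !mxE -ei (inj_eq enum_val_inj).
by rewrite -rowE rowK ei.
Qed.

Lemma tabloidsM T s : T \in tabloids -> T :* s \in tabloids.
Proof. by case/imsetP=> t _ ->; rewrite tabloidM imset_f. Qed.

Lemma perm_module_mx_repr : mx_repr [set: 'S_n] perm_module_mx.
Proof.
split=> [|s t _ _].
  apply/row_matrixP=> i; rewrite rowK rcoset1; apply/rowP=> j.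
  by rewrite !mxE (inj_eq enum_val_inj) eq_sym.
apply/row_matrixP=> i; rewrite row_mul !rowK rcosetM tabloid_vecM //.
exact: tabloidsM (enum_valP i).
Qed.

Definition perm_module : mx_representation F [set: 'S_n] #|tabloids| :=
  MxRepresentation perm_module_mx_repr.

Definition col_stab (t : 'S_n) : {set 'S_n} :=
  [set c : 'S_n | [forall i, col_of t (c i) == col_of t i]].

Definition polytabloid (t : 'S_n) : 'rV[F]_#|tabloids| :=
  \sum_(c in col_stab t) (-1) ^+ c *: tabloid_vec (tabloid t :* c).

Definition specht_mx : 'M[F]_#|tabloids| :=
  (\sum_(t : 'S_n) <<polytabloid t>>)%MS.

Lemma polytabloidM t s :
  polytabloid t *m perm_module_mx s = polytabloid (t * s)%g.
Proof.
have colM i : col_of (t * s)%g i = col_of t ((s^-1)%g i).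
  by rewrite /col_of invMg permM.
rewrite /polytabloid mulmx_suml.
rewrite [RHS](reindex (fun c => (c ^ s)%g)) /=; last first.
  by exists (fun c => (c ^ s^-1)%g) => c _; rewrite ?conjgK ?conjgKV.
apply: eq_big => [c|c _].
  rewrite !inE; apply/forallP/forallP => H i.
    by rewrite !colM // conjgE !permM permK; exact: H.
  by have := H (s i); rewrite !colM // conjgE !permM !permK.
rewrite -scalemxAl tabloid_vecM; last by rewrite tabloidsM // imset_f.
by rewrite -tabloidM -!rcosetM -conjgC odd_permJ.
Qed.

Lemma specht_module : mxmodule perm_module specht_mx.
Proof.
apply/mxmoduleP=> s _; rewrite sumsmxMr; apply/sumsmx_subP=> t _.
rewrite (eqmxMr _ (genmxE _)) polytabloidM.
by apply: (sumsmx_sup (t * s)%g) => //; rewrite genmxE.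
Qed.

Definition specht : mx_representation F [set: 'S_n] (\rank specht_mx) :=
  submod_repr specht_module.

(* This is D^la when la is p-regular. *)
Definition specht_head := factmod_repr (radical_module specht).

End Specht.

Definition hook_young (n r : nat) : {group 'S_n} :=
  (perm.Sym_group [set i : 'I_n | (i < n - r - 1)%N] <*>
   perm.Sym_group [set i : 'I_n | (n - r - 1 <= i < n - 1)%N])%G.

Definition hook (n r : nat) : seq nat := (n - r)%N :: nseq r 1%N.

(* Main.v *)
From HB Require Import structures.
Require Import Defs.
From mathcomp Require Import all_boot all_order all_algebra.
From mathcomp Require Import all_fingroup all_solvable all_field all_character.
From mathcomp Require boolp.

Set Implicit Arguments.
Unset Strict Implicit.
Unset Printing Implicit Defensive.

Import GroupScope GRing.Theory.
Local Open Scope ring_scope.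

(** The simple module M labelled by (n-r, 1^r) has a concrete model, the r-th
exterior power of the heart of the natural permutation module: row vectors of
sum zero, modulo the constant ones among them.  Since r < p, the number r! is
invertible, and the pairing of two polytabloids is r! times a determinant of
size r.  James' submodule argument then identifies the radical of the Specht
module with the kernel of the map to the exterior power [specht_head_rsim].
The heart has dimension n-1 if p does not divide n, and n-2 otherwise.

By Higman's criterion [relatively_projective_higman], M is projective relative
to Q exactly when there are endomorphisms X l of M, indexed by the cosets l of
Q, which are permuted by conjugation under G and add up to 1.  A p-subgroup P is
a vertex as soon as M is projective relative to P and every such Q contains a
conjugate of P, that is, P fixes a coset of Q [vertex_conj].

Upper bounds.  A subgroup of index prime to p will do.  If p does not divide n,
then the restriction of M to the stabiliser of a point is the r-th exterior
power of a permutation module, whose basis of r-subsets is permuted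
transitively up to signs; so M is projective relative to the Young subgroup,
and to its Sylow subgroup.  For n = 4 and p = 2 the Klein four-group acts
trivially on M, and a transposition swaps two basis vectors.

Lower bounds.  If P fixes no coset of Q, then for every D that commutes with P
the terms of tr D, the sum of the tr (X l D), fall into P-orbits of length
divisible by p, so tr D = 0 [higman_fixed].  If p does not divide n, take for D
the projection to one basis vector fixed by the Young subgroup.  If p divides n
and r <= p-2, take D = 1: the dimension is prime to p.

There remains the case that p divides n and r = p-1, where the dimension
'C(n-2, p-1) is divisible by p and the argument has to be carried out modulo
p^2.  All modules involved are defined over the prime field [higman_descent].
Lift the X l to integer matrices and expand the trace of the p-th power of their
sum into words of length p; rotations of words and the group P act on these.
Orbits contribute multiples of p^2, except for words that are fixed by a
subgroup H of index p in P; these commute with H [mxtrace_sq_dvd].  Unless p = 2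
and n = 4, every H of index p in a suitable Sylow subgroup P contains an element s
such that all endomorphisms which commute with s have trace 0: a p-element with at least 2
and at most p fixed points, or, if p^2 does not divide n, an element of order p
without fixed points.  So if P fixes no coset of Q, then p^2 divides the
dimension, which is false when n/p is not 1 modulo p [sq_ndvd_bin].  If n/p is
1 modulo p, choose P such that a p-cycle a is central in P, and
compress everything to the span of the basis subsets that avoid the support of
a; the terms which are lost are traces from 1 to <a>, hence vanish
[higman_traceless].  The trace is then 'C(n-p-2, p-1), which p^2 does not
divide. *)

(** * Higman's criterion *)

Lemma mx_rsim_inverse (F : fieldType) (gT : finGroupType) (G : {group gT})
    m1 m2 (r1 : mx_representation F G m1) (r2 : mx_representation F G m2) :
  mx_rsim r1 r2 -> exists (B : 'M_(m1, m2)) (C : 'M_(m2, m1)),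
    [/\ B *m C = 1%:M, C *m B = 1%:M & {in G, forall x, r1 x *m B = B *m r2 x}].
Proof.
case=> B def_m1; rewrite def_m1 in r1 B *; rewrite row_free_unit => injB homB.
by exists B, (invmx B); split=> //; rewrite ?mulmxV ?mulVmx.
Qed.

Section Higman.

Variables (F : fieldType) (gT : finGroupType) (G : {group gT}) (m : nat).
Variable rG : mx_representation F G m.
Implicit Types (H K Q : {group gT}) (X : {set gT} -> 'M[F]_m).

(** The member at the coset H g is the conjugate by g of the member at H; a family
indexed by cosets expresses the relative trace from H to K without a choice of
representatives. *)
Definition higman_family H K X : Prop :=
  (forall l x, l \in rcosets H K -> x \in K ->
     X (l :* x)%g = rG x^-1%g *m X l *m rG x) /\
  \sum_(l in rcosets H K) X l = 1%:M.

Definition higman H K : Prop := exists X, higman_family H K X.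

(** Two intertwining matrices can be cut into blocks along the cosets, which a pair
of complementary submodules cannot. *)
Lemma summand_splitting m2 (rN : mx_representation F G m2) :
  is_direct_summand rG rN <->
  exists (A : 'M_(m, m2)) (B : 'M_(m2, m)),
    [/\ A *m B = 1%:M, {in G, forall x, rG x *m A = A *m rN x}
      & {in G, forall x, rN x *m B = B *m rG x}].
Proof.
split=> [[U [W [modU [modW UW1 dxUW /mx_rsim_inverse[B [C [BK KB homB]]]]]]] | [A [B [AB1 homA homB]]]].
  have dx0 : (U :&: W = 0)%MS by exact/mxdirect_addsP.
  exists (val_submod B), (proj_mx U W *m in_submod U 1%:M *m C).
  have inP V : (V <= U)%MS -> V *m proj_mx U W *m in_submod U 1%:M = in_submod U V.
    by move=> sVU; rewrite proj_mx_id // -in_submodE.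
  split.
  - by rewrite mulmxA (mulmxA (val_submod B)) inP ?val_submodP // val_submodK BK.
  - by move=> x Gx; rewrite -val_submodJ // -homB // [RHS]val_submodE -mulmxA -val_submodE.
  - move=> x Gx.
    have /hom_mxP hP : (1%:M <= dom_hom_mx rN (proj_mx U W))%MS.
      by apply: submx_trans (proj_mx_hom dx0 modU modW); rewrite UW1.
    have := hP x Gx; rewrite !mul1mx => hP'.
    have hB : rG x *m B = B *m submod_mx modU x by apply: homB.
    have hI : proj_mx U W *m rN x *m in_submod U 1%:M =
              proj_mx U W *m in_submod U 1%:M *m submod_mx modU x.
      rewrite -!in_submodE in_submodJ //.
      by rewrite -[proj_mx U W]mul1mx proj_mx_sub.
    have hC : submod_mx modU x *m C = C *m rG x.
      suff -> : submod_mx modU x = C *m (rG x *m B) by rewrite -2!mulmxA BK mulmx1.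
      by rewrite hB mulmxA KB mul1mx.
    move: hP' hI hC; move: (proj_mx U W) (submod_mx modU x) (in_submod U 1%:M).
    move=> P' R I hP' hI hC.
    by rewrite -[RHS]mulmxA -hC !mulmxA -hI hP'.
have modA : mxmodule rN <<A>>%MS.
  rewrite (eqmx_module _ (genmxE _)); apply/mxmoduleP=> x Gx.
  by rewrite -homA // submxMl.
have rA : \rank A = m.
  apply/eqP; rewrite eqn_leq rank_leq_row -{1}(mxrank1 F m) -AB1.
  by rewrite mxrankM_maxl.
have rU : \rank <<A>>%MS = m by rewrite genmxE.
have modB : mxmodule rN (kermx B).
  apply/mxmoduleP=> x Gx; apply/sub_kermxP.
  by rewrite -mulmxA homB // mulmxA mulmx_ker mul0mx.
have dec v : (v *m B *m A <= <<A>>)%MS && ((v - v *m B *m A : 'rV_m2) <= kermx B)%MS.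
  rewrite genmxE submxMl /=; apply/sub_kermxP.
  by rewrite mulmxBl -!mulmxA AB1 mulmx1 subrr.
exists <<A>>%MS, (kermx B), modA; split=> //.
- apply/eqmxP; rewrite submx1; apply/row_subP=> i.
  have /andP[h1 h2] := dec (row i 1%:M).
  rewrite -[row i _](subrK (row i 1%:M *m B *m A)) addrC.
  exact: addmx_sub_adds.
- apply/mxdirect_addsP/eqP; rewrite -submx0; apply/rV_subP=> v.
  rewrite sub_capmx genmxE => /andP[/submxP[u ->] /sub_kermxP].
  by rewrite -mulmxA AB1 mulmx1 => ->; rewrite mul0mx sub0mx.
have sA : (A <= <<A>>)%MS by rewrite genmxE.
exists (in_submod _ A) => // [|x Gx]; last first.
  by rewrite -in_submodJ // -homA // [RHS]in_submodE -mulmxA -in_submodE.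
apply/eqP; apply: etrans rA.
rewrite -(mxrankMfree (in_submod _ A) (row_base_free <<A>>%MS)).
by congr (\rank _); apply: in_submodK.
Qed.

(** In a splitting A B = 1 of M through the induced module, the products of the
blocks of A and B that belong to the same coset form a family as in Higman's
criterion; conversely A and B are rebuilt from the family by translating its
members with the coset representatives. *)
Lemma relatively_projective_higman Q (sQG : Q \subset G) :
  is_direct_summand rG (ind_repr sQG (subg_repr rG sQG)) <-> higman Q G.
Proof.
pose N := #|rcosets Q G|.
pose t (i : 'I_N) := coset_rep i.
have Gt i : t i \in G by have [] := coset_repP sQG i.
have et i : enum_val i = (Q :* t i)%g by have [] := coset_repP sQG i.
have idx l : l \in rcosets Q G -> exists i : 'I_N, enum_val i = l.
  by move=> Ll; exists (enum_rank_in Ll l); rewrite enum_rankK_in.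
have blockP x (i j : 'I_N) : x \in G -> enum_val j = (enum_val i :* x)%g ->
    (t i * x * (t j)^-1)%g \in Q.
  by move=> Gx e; rewrite mem_coset_rep // e et rcosetM.
have blockN x (i j k : 'I_N) : enum_val j = (enum_val i :* x)%g ->
    (t i * x * (t k)^-1)%g \in Q -> k = j.
  move=> e; rewrite mem_coset_rep // => /eqP e'; apply: enum_val_inj.
  by rewrite -e' e et rcosetM.
have shift x (i : 'I_N) : x \in G ->
    exists j : 'I_N, enum_val j = (enum_val i :* x)%g.
  move=> Gx; apply: idx; rewrite et -rcosetM.
  by apply/rcosetsP; exists (t i * x)%g; rewrite ?groupM.
have sumE (f : {set gT} -> 'M[F]_m) :
    \sum_(l in rcosets Q G) f l = \sum_(i < N) f (enum_val i).
  have L0 : (Q : {set gT}) \in rcosets Q G by rewrite -{1}(rcoset1 Q) mem_rcosets mulSGid ?group1.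
  by rewrite (reindex _ (enum_val_bij_in L0)); apply: eq_bigl => i; apply: (enum_valP i).
rewrite summand_splitting; split=> [[A [B [AB1 homA homB]]] | [X [homX X1]]].
  pose A' i := submxrow A i; pose B' i := submxcol B i.
  have EA : \mxrow_i A' i = A by rewrite submxrowK.
  have EB : \mxcol_i B' i = B by rewrite submxcolK.
  have hA x i j : x \in G -> enum_val j = (enum_val i :* x)%g ->
      rG x *m A' j = A' i *m rG (t i * x * (t j)^-1)%g.
    move=> Gx e; have := homA x Gx; rewrite -EA mul_mxrow mul_mxrow_mxblock.
    move/eq_mxrowP/(_ j) => ->; rewrite (bigD1 i) //= big1 ?addr0 => [|k nki].
      by rewrite /ind_block -!/(t _) blockP.
    rewrite /ind_block -!/(t _); case: ifP => [h|_]; last by rewrite mulmx0.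
    have [|] := eqVneq k i; first by move=> ek; rewrite ek eqxx in nki.
    case/eqP; apply: (blockN x^-1%g j); first by rewrite e -rcosetM mulgV rcoset1.
    by have := groupVr h; rewrite !invMg !invgK !mulgA.
  have hB x i j : x \in G -> enum_val j = (enum_val i :* x)%g ->
      rG (t i * x * (t j)^-1)%g *m B' j = B' i *m rG x.
    move=> Gx e; have := homB x Gx; rewrite -EB mul_mxblock_mxrow mxcol_mul.
    move/eq_mxcolP/(_ i) => <-; rewrite (bigD1 j) //= big1 ?addr0 => [|k nkj].
      by rewrite /ind_block -!/(t _) blockP.
    rewrite /ind_block -!/(t _); case: ifP => [h|_]; last by rewrite mul0mx.
    by rewrite (blockN x i j k) ?eqxx in nkj.
  pose X (l : {set gT}) := if [pick i : 'I_N | enum_val i == l] is Some i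
    then A' i *m B' i else 0.
  have XE i : X (enum_val i) = A' i *m B' i.
    rewrite /X; case: pickP => [k /eqP/enum_val_inj -> //|/(_ i)].
    by rewrite eqxx.
  exists X; split=> [l x /idx[i <-] Gx|].
    have [j ej] := shift x i Gx; rewrite -ej !XE.
    rewrite -!mulmxA -(hB x i j) // (mulmxA (A' i)) -(hA x i j) // !mulmxA.
    by rewrite -repr_mxM ?groupV // mulVg repr_mx1 mul1mx.
  rewrite sumE -AB1 -EA -EB mul_mxrow_mxcol.
  by apply: eq_bigr => i _; rewrite XE.
exists (\mxrow_i rG (t i)^-1%g), (\mxcol_i (rG (t i) *m X (enum_val i))); split.
- rewrite mul_mxrow_mxcol -X1 sumE; apply: eq_bigr => i _.
  by rewrite mulmxA -repr_mxM ?groupV // mulVg repr_mx1 mul1mx.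
- move=> x Gx; rewrite mul_mxrow mul_mxrow_mxblock; apply: eq_mxrow => j.
  have [i ei] := shift x^-1%g j (groupVr Gx).
  have e : enum_val j = (enum_val i :* x)%g by rewrite ei -rcosetM mulVg rcoset1.
  rewrite (bigD1 i) //= big1 ?addr0 => [|k nki].
    rewrite /ind_block -!/(t _) blockP //= -!repr_mxM ?groupM ?groupV //.
    by rewrite !mulgA mulVg mul1g.
  rewrite /ind_block -!/(t _); case: ifP => [h|_]; last by rewrite mulmx0.
  case/eqP: nki; apply: (blockN x^-1%g j) => //.
  by have := groupVr h; rewrite !invMg !invgK !mulgA.
move=> x Gx; rewrite mul_mxblock_mxrow mxcol_mul; apply: eq_mxcol => i.
have [j e] := shift x i Gx.
rewrite (bigD1 j) //= big1 ?addr0 => [|k nkj].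
  rewrite /ind_block -!/(t _) blockP //= e homX ?enum_valP // !mulmxA.
  by rewrite -!repr_mxM ?groupM ?groupV // mulgKV mulgK.
rewrite /ind_block -!/(t _); case: ifP => [h|_]; last by rewrite mul0mx.
by rewrite (blockN x i j k) ?eqxx in nkj.
Qed.


End Higman.

Section PgroupSums.

Variables (gT : finGroupType) (T : finType) (to : {action gT &-> T}).
Variables (p : nat) (P : {group gT}) (V : zmodType).
Hypotheses (pP : p.-group P) (Vp : forall v : V, v *+ p = 0).

(** Orbits other than fixed points have length divisible by p, and f is constant on
them. *)
Lemma sum_pgroup_fix (L : {set T}) (f : T -> V) :
    [acts P, on L | to] ->
    {in L & P, forall x g, f (to x g) = f x} ->
  \sum_(x in L) f x = \sum_(x in 'Fix_(L | to)(P)) f x.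
Proof.
move=> actL fP; rewrite (big_setID 'Fix_to(P)) /= -[RHS]addr0; congr (_ + _).
pose D := L :\: 'Fix_to(P).
have actD : [acts P, on D | to].
  rewrite actsD //; apply/actsP=> g Pg x; apply/afixP/afixP=> fx h Ph.
    apply: (act_inj to g); rewrite -[in RHS](fx _ (groupJ Ph Pg)) -!actM.
    by rewrite conjgE !mulgA mulgV mul1g.
  by rewrite -actM (fx _ (groupM Pg Ph)) (fx _ Pg).
rewrite (set_partition_big _ (orbit_partition actD)) /= big1 // => O /imsetP[x Dx ->].
have [Lx nfx] := setDP Dx.
rewrite (eq_bigr (fun=> f x)) => [|y /orbitP[g Pg <-]]; last exact: fP.
rewrite sumr_const.
have /p_natP[[|k]] : p.-nat #|orbit to P x|.
- by apply: pnat_dvd pP; apply: dvdn_orbit.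
- by rewrite expn0 => /card_orbit1/orbit1P; rewrite (negPf nfx).
- by move=> ->; rewrite expnSr mulrnA Vp.
Qed.

End PgroupSums.

Section HigmanTheory.

Variables (F : fieldType) (gT : finGroupType) (G : {group gT}) (m : nat).
Variable rG : mx_representation F G m.
Implicit Types (H K P Q : {group gT}) (X : {set gT} -> 'M[F]_m).

Definition rconj x (A : 'M[F]_m) := rG x^-1%g *m A *m rG x.

Lemma rconj1 A : rconj 1 A = A.
Proof. by rewrite /rconj invg1 repr_mx1 mulmx1 mul1mx. Qed.

Lemma rconjM x y A : x \in G -> y \in G -> rconj (x * y) A = rconj y (rconj x A).
Proof. by move=> Gx Gy; rewrite /rconj invMg !repr_mxM ?groupV // !mulmxA. Qed.

Lemma rconj_id x A : x \in G -> A *m rG x = rG x *m A -> rconj x A = A.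
Proof.
by move=> Gx cA; rewrite /rconj -mulmxA cA mulmxA -repr_mxM ?groupV // mulVg
  repr_mx1 mul1mx.
Qed.

Lemma rconj_comm x A : x \in G -> rconj x A = A -> A *m rG x = rG x *m A.
Proof.
by move=> Gx {2}<-; rewrite /rconj !mulmxA -repr_mxM ?groupV // mulgV repr_mx1 mul1mx.
Qed.

Lemma rconj_mul x A B : x \in G -> rconj x (A *m B) = rconj x A *m rconj x B.
Proof.
move=> Gx; rewrite /rconj !mulmxA; congr (_ *m _ *m _).
by rewrite -[_ *m A *m _ *m _]mulmxA -repr_mxM ?groupV // mulgV repr_mx1 mulmx1.
Qed.

Lemma rconj_sum I (r : seq I) (C : pred I) x (A : I -> 'M[F]_m) :
  rconj x (\sum_(i <- r | C i) A i) = \sum_(i <- r | C i) rconj x (A i).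
Proof. by rewrite /rconj mulmx_sumr mulmx_suml. Qed.

Lemma rconj_scalar x a : x \in G -> rconj x a%:M = a%:M.
Proof. by move=> Gx; rewrite rconj_id // scalar_mxC. Qed.

Lemma mxtrace_rconj x A : x \in G -> \tr (rconj x A) = \tr A.
Proof.
by move=> Gx; rewrite /rconj mxtrace_mulC mulmxA -repr_mxM ?groupV // mulgV
  repr_mx1 mul1mx.
Qed.

Lemma rconj_repr H A x : H \subset G -> {in H, forall h, rconj h A = A} ->
  x \in G -> rconj (repr (H :* x)) A = rconj x A.
Proof.
move=> sHG cA Gx; have /rcosetP[h Hh ->] := mem_repr_rcoset H x.
by rewrite (rconjM _ (subsetP sHG h Hh) Gx) cA.
Qed.

(** As A commutes with H, its conjugate by a coset representative depends only on
the coset. *)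
Lemma rconj_family H K A : H \subset K -> K \subset G ->
    {in H, forall h, rconj h A = A} ->
    \sum_(l in rcosets H K) rconj (repr l) A = 1%:M ->
  higman rG H K.
Proof.
move=> sHK sKG cA sumA; exists (fun l => rconj (repr l) A); split=> // l x.
case/rcosetsP=> y Ky -> Kx; rewrite -rcosetM.
have [Gx Gy] := (subsetP sKG x Kx, subsetP sKG y Ky).
by rewrite !rconj_repr ?groupM ?(subset_trans sHK) //; apply: rconjM.
Qed.

(** The scalar matrix with entry 1 / #|K : H| has relative trace 1. *)
Lemma higman_index H K : H \subset K -> K \subset G ->
  #|K : H|%:R != 0 :> F -> higman rG H K.
Proof.
move=> sHK sKG nzi; apply: (@rconj_family H K (#|K : H|%:R^-1)%:M) => //.
  by move=> h Hh; rewrite rconj_scalar // (subsetP sKG) // (subsetP sHK).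
rewrite (eq_bigr (fun=> (#|K : H|%:R^-1)%:M)) => [|_ /rcosetsP[x Kx ->]].
  by rewrite sumr_const -scaler_nat scale_scalar_mx mulfV.
rewrite rconj_scalar //; apply: (subsetP sKG).
by have /rcosetP[h Hh ->] := mem_repr_rcoset H x; rewrite groupM // (subsetP sHK).
Qed.

(** If A commutes with H and has relative trace 1 in K, and B commutes with K and has
relative trace 1 in G, then A B has relative trace B in K, hence 1 in G. *)
Lemma higman_trans H K : H \subset K -> K \subset G ->
  higman rG H K -> higman rG K G -> higman rG H G.
Proof.
move=> sHK sKG [X [homX sumX]] [Y [homY sumY]].
have sHG := subset_trans sHK sKG.
have XE x : x \in K -> X (H :* x)%g = rconj x (X H).
  by move=> Kx; rewrite homX // -{1}(rcoset1 H) mem_rcosets mulSGid // group1.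
have YE x : x \in G -> Y (K :* x)%g = rconj x (Y K).
  by move=> Gx; rewrite homY // -{1}(rcoset1 K) mem_rcosets mulSGid // group1.
have cX : {in H, forall h, rconj h (X H) = X H}.
  by move=> h Hh; rewrite -XE ?(subsetP sHK) // rcoset_id.
have cY : {in K, forall h, rconj h (Y K) = Y K}.
  by move=> h Hh; rewrite -YE ?(subsetP sKG) // rcoset_id.
have cXY : {in H, forall h, rconj h (X H *m Y K) = X H *m Y K}.
  move=> h Hh; rewrite rconj_mul ?(subsetP sHG) // cX //.
  by rewrite cY ?(subsetP sHK).
apply: (@rconj_family H G (X H *m Y K)) => //.
rewrite (partition_big (fun l => K * l)%g (mem (rcosets K G))) /=; last first.
  move=> _ /rcosetsP[x Gx ->]; apply/rcosetsP; exists x => //.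
  by rewrite mulgA mulGSid.
rewrite -sumY; apply: eq_bigr => _ /rcosetsP[g Gg ->].
rewrite (reindex_onto (fun l : {set gT} => l :* g)%g (fun l => l :* g^-1)%g) /=; last first.
  by move=> l _; rewrite -rcosetM mulVg rcoset1.
rewrite (eq_bigl (mem (rcosets H K))) => [|l]; last first.
  rewrite -rcosetM mulgV rcoset1 eqxx andbT /=.
  apply/andP/rcosetsP=> [[/rcosetsP[y Gy e] /eqP]|[k Kk ->]].
    have el : l = (H :* (y * g^-1))%g by rewrite rcosetM -e -rcosetM mulgV rcoset1.
    rewrite e mulgA mulGSid // => /rcoset_eqP; rewrite mem_rcoset => Kyg.
    by exists (y * g^-1)%g.
  have Gk := subsetP sKG k Kk.
  split; first by rewrite -rcosetM mem_rcosets mulSGid // groupM.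
  by rewrite -rcosetM mulgA mulGSid // rcosetM rcoset_id.
rewrite YE // -[Y K in RHS]mul1mx -sumX mulmx_suml rconj_sum.
apply: eq_bigr => _ /rcosetsP[k Kk ->].
have Gk := subsetP sKG k Kk.
by rewrite -rcosetM rconj_repr ?groupM // rconjM // rconj_mul // cY // XE.
Qed.

Lemma higman_conj H x : x \in G -> higman rG H G -> higman rG (H :^ x)%G G.
Proof.
move=> Gx [X [homX sumX]]; exists (fun l => X (x *: l)%g).
have xK : cancel (fun l : {set gT} => x^-1 *: l)%g (fun l => x *: l)%g.
  by move=> l; rewrite -lcosetM mulgV mul1g.
have Kx : cancel (fun l : {set gT} => x *: l)%g (fun l => x^-1 *: l)%g.
  by move=> l; rewrite -lcosetM mulVg mul1g.
have shiftE y : (x *: ((H :^ x) :* y) = H :* (x * y))%g.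
  by rewrite conjsgE -(mulgA [set _]) xK rcosetM.
have shift l : ((x *: l)%g \in rcosets H G) = (l \in rcosets (H :^ x) G).
  apply/rcosetsP/rcosetsP=> [[y Gy e]|[y Gy ->]]; last first.
    by exists (x * y)%g; rewrite ?groupM ?shiftE.
  exists (x^-1 * y)%g; first by rewrite groupM ?groupV.
  by apply: (can_inj Kx); rewrite e shiftE mulKVg.
split=> [l y Ll Gy|]; first by rewrite mulgA homX ?shift.
rewrite -sumX [RHS](reindex_onto _ _ (in1W xK)) /=.
by apply: eq_bigl => l; rewrite shift Kx eqxx andbT.
Qed.

(** If P fixed no coset of Q, then tr D, the sum of the tr (X l *m D), would vanish, as
the terms are constant along P-orbits.  A fixed coset Q g means that P is
contained in the conjugate of Q by g. *)
Lemma higman_fixed Q P p D :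
    p \in [pchar F] -> p.-group P -> P \subset G -> Q \subset G ->
    higman rG Q G -> {in P, forall x, rconj x D = D} -> \tr D != 0 ->
  exists2 g, g \in G & P \subset (Q :^ g)%g.
Proof.
move=> charFp pP sPG sQG [X [homX sumX]] cD nzD.
have actP : [acts P, on rcosets Q G | 'Rs].
  by apply: subset_trans sPG (actsRs_rcosets _ _).
have : \sum_(l in 'Fix_(rcosets Q G | 'Rs)(P)) \tr (X l *m D) != 0.
  rewrite -(sum_pgroup_fix pP _ actP) => [|v|l x Ll Px].
  - by rewrite -raddf_sum -mulmx_suml sumX mul1mx.
  - by rewrite -mulr_natr (pcharf0 charFp) mulr0.
  - have Gx := subsetP sPG x Px; rewrite /= rcosetE homX // -[in LHS](cD x) //.
    by rewrite -/(rconj x _) -rconj_mul // mxtrace_rconj.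
have [->|[l Fl] _] := set_0Vmem 'Fix_(rcosets Q G | 'Rs)(P).
  by rewrite big_set0 eqxx.
have [/rcosetsP[g Gg ->]] := setIP Fl.
by rewrite sub_afixRs_norms; exists g.
Qed.

Lemma vertex_conj Q P : P \subset G -> is_vertex rG Q -> higman rG P G ->
    (forall K, K \subset G -> higman rG K G ->
       exists2 g, g \in G & P \subset (K :^ g)%g) ->
  exists2 g, g \in G & Q :=: (P :^ g)%g.
Proof.
move=> sPG [[sQG /relatively_projective_higman hQ] minQ] hP lowP.
have [g Gg sPQ] := lowP Q sQG hQ; exists g^-1%g; first by rewrite groupV.
apply/esym/(minQ (P :^ g^-1)%G); last by rewrite /= sub_conjgV.
have sPgG : (P :^ g^-1)%G \subset G by rewrite /= conj_subG // groupV.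
by exists sPgG; apply/relatively_projective_higman/higman_conj; rewrite ?groupV.
Qed.

End HigmanTheory.

Lemma higman_rsim (F : fieldType) (gT : finGroupType) (G : {group gT}) m1 m2
    (r1 : mx_representation F G m1) (r2 : mx_representation F G m2)
    (H K : {group gT}) :
  K \subset G -> mx_rsim r1 r2 -> higman r1 H K -> higman r2 H K.
Proof.
move=> sKG /mx_rsim_inverse[B [C [BC CB homB]]] [X [homX sumX]].
have rE x : x \in G -> r2 x = C *m r1 x *m B.
  by move=> Gx; rewrite -mulmxA homB // mulmxA CB mul1mx.
exists (fun l => C *m X l *m B); split=> [l x Ll Kx|].
  have Gx := subsetP sKG x Kx.
  rewrite homX // !rE ?groupV // -!mulmxA (mulmxA B C) BC mul1mx.
  by rewrite (mulmxA B C (r1 x *m B)) BC mul1mx.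
by rewrite -mulmx_suml -mulmx_sumr sumX mulmx1 CB.
Qed.

(** That the relative trace maps the endomorphisms of the restriction to H onto
something containing 1 is the solvability of a linear system with coefficients
in K, which does not depend on the field. *)
Lemma higman_descent (K F : fieldType) (f : {rmorphism K -> F})
    (gT : finGroupType) (G : {group gT}) m (r : mx_representation K G m)
    (H : {group gT}) :
  H \subset G -> higman (map_repr f r) H G -> higman r H G.
Proof.
move=> sHG [X [homX sumX]].
pose S A := \sum_(l in rcosets H G) rconj r (repr l) A.
have linS : linear S.
  move=> a A B; rewrite /S scaler_sumr -big_split; apply: eq_bigr => l _ /=.
  by rewrite /rconj mulmxDr mulmxDl -scalemxAr -scalemxAl.
pose SL : {linear _ -> _} := HB.pack S (GRing.isLinear.Build _ _ _ _ S linS).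
pose E := enveloping_algebra_mx (subg_repr r sHG).
have XE x : x \in G -> X (H :* x)%g = rconj (map_repr f r) x (X H).
  by move=> Gx; rewrite homX // -{1}(rcoset1 H) mem_rcosets mulSGid // group1.
(* The row space on the right is the image of the relative trace. *)
have : (mxvec 1%:M <= 'C(E) *m lin_mx SL)%MS.
  rewrite -(map_submx f) map_mxM map_cent_mx map_mxvec map_mx1.
  have -> : map_mx f E = enveloping_algebra_mx (subg_repr (map_repr f r) sHG).
    by rewrite map_enveloping_algebra_mx.
  have /submxP[v defX] : (X H \in 'C(enveloping_algebra_mx
      (subg_repr (map_repr f r) sHG)))%MS.
    rewrite memmx_cent_envelop; apply/centgmxP=> h Hh.
    have Gh := subsetP sHG h Hh.
    by apply: (@rconj_comm _ _ _ _ (map_repr f r)) => //; rewrite -XE // rcoset_id.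
  apply/submxP; exists v; rewrite mulmxA -defX -sumX.
  pose SF A := \sum_(l in rcosets H G) rconj (map_repr f r) (repr l) A.
  have linSF : linear SF.
    move=> a A B; rewrite /SF scaler_sumr -big_split; apply: eq_bigr => l _ /=.
    by rewrite /rconj mulmxDr mulmxDl -scalemxAr -scalemxAl.
  pose SFL : {linear _ -> _} := HB.pack SF (GRing.isLinear.Build _ _ _ _ SF linSF).
  rewrite (@map_lin_mx _ _ f _ _ _ _ SL SFL) => [|B]; last first.
    rewrite /= /S /SF raddf_sum; apply: eq_bigr => l _.
    by rewrite /= /rconj !map_mxM.
  rewrite mul_vec_lin; congr mxvec; apply: eq_bigr => l /rcosetsP[x Gx ->].
  rewrite rconj_repr // => [|h Hh]; first by rewrite XE.
  by rewrite -XE ?(subsetP sHG) // rcoset_id.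
case/submxP=> v; rewrite mulmxA -[v *m 'C(E)%MS]vec_mxK mul_vec_lin => /(can_inj mxvecK).
set A := vec_mx _ => SA1.
have cA : {in H, forall h, rconj r h A = A}.
  have : (A \in 'C(E))%MS by rewrite vec_mxK submxMl.
  rewrite memmx_cent_envelop => /centgmxP cA h Hh.
  by rewrite rconj_id ?(subsetP sHG) //; apply: cA.
exact: (@rconj_family _ _ _ _ r H G A).
Qed.

(** * Traces modulo the square of p *)

Section TraceMod.

Variables (q d : nat).
Local Notation p := q.+2.
Hypothesis p_pr : prime p.
Local Notation red := (map_mx (intr : int -> 'F_p) : 'M[int]_d -> 'M['F_p]_d).

Lemma dvdz_red (z : int) : (p %| z)%Z = (z%:~R == 0 :> 'F_p).
Proof. by rewrite (dvdz_pcharf (pchar_Fp p_pr)). Qed.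

Definition lift_mx (A : 'M['F_p]_d) : 'M[int]_d := map_mx (fun x : 'F_p => (x : nat)%:Z) A.

Lemma lift_mxK A : red (lift_mx A) = A.
Proof. by apply/matrixP=> i j; rewrite !mxE -[RHS]natr_Zp. Qed.

Lemma red_tr A : \tr (red A) = (\tr A)%:~R.
Proof. by rewrite trace_map_mx. Qed.

Lemma red_mul A B : red (A * B) = red A * red B.
Proof. exact: map_mxM. Qed.

Lemma red_exp A n : red (A ^+ n) = red A ^+ n.
Proof.
by elim: n => [|n IHn]; rewrite ?expr0 ?map_mx1 // !exprS red_mul IHn.
Qed.

Lemma mxtrace_exp_mulC n (A B : 'M[int]_d) : (0 < n)%N ->
  \tr ((A * B) ^+ n) = \tr ((B * A) ^+ n).
Proof.
have E k : (A * B) ^+ k * A = A * (B * A) ^+ k.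
  elim: k => [|k IHk]; first by rewrite !expr0 mul1r mulr1.
  by rewrite exprSr -mulrA -(mulrA A) mulrA IHk -mulrA -exprSr.
case: n => // n _; rewrite exprSr mulrA E -mulrA mxtrace_mulC.
by rewrite -[_ *m _]mulrA -exprSr.
Qed.

(** Write U = V + p B.  The difference of the p-th powers telescopes into p terms
U^(p-1-i) (p B) V^i, and the traces of U^(p-1-i) B V^i all agree modulo p, so that
their sum contributes another factor p. *)
Lemma mxtrace_exp_cong (U V : 'M[int]_d) :
  red U = red V -> ((p ^ 2)%N %| \tr (U ^+ p) - \tr (V ^+ p))%Z.
Proof.
move=> eUV; pose B : 'M[int]_d := map_mx (fun z : int => divz z p) (U - V).
have eB : U - V = (Posz p) *: B.
  apply/matrixP=> i j; rewrite !mxE mulrC divzK // dvdz_red rmorphB /= subr_eq0.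
  by move/matrixP/(_ i j): eUV; rewrite !mxE => ->.
have tele n : U ^+ n - V ^+ n = \sum_(i < n) U ^+ (n - i.+1) * (U - V) * V ^+ i.
  elim: n => [|n IHn]; first by rewrite big_ord0 !expr0 subrr.
  rewrite big_ord_recr /= subnn mul1r.
  have -> : U ^+ n.+1 - V ^+ n.+1 = U * (U ^+ n - V ^+ n) + (U - V) * V ^+ n.
    by rewrite mulrBr mulrBl !exprS addrA subrK.
  congr (_ + _); rewrite IHn mulr_sumr; apply: eq_bigr => i _.
  by rewrite subSn // exprS !mulrA.
rewrite -raddfB tele raddf_sum /=.
rewrite (eq_bigr (fun i : 'I_p => (Posz p) * \tr (U ^+ (p - i.+1) * B * V ^+ i))) => [|i _].
  rewrite -mulr_sumr (_ : Posz (p ^ 2)%N = (Posz p) * (Posz p)); last by rewrite expnS expn1 PoszM.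
  rewrite dvdz_mul2l // dvdz_red rmorph_sum /=.
  rewrite (eq_bigr (fun=> \tr (red B * red V ^+ q.+1))) => [|i _].
    by rewrite sumr_const card_ord -mulr_natr pchar_Fp_0 ?mulr0.
  rewrite -red_tr !red_mul !red_exp eUV mxtrace_mulC mulmxE mulrA -exprD.
  by rewrite subSS (subnKC (leq_ord i)) -mulmxE; apply: mxtrace_mulC.
rewrite eB -mxtraceZ; congr (\tr _).
by rewrite -!mulmxE -scalemxAr -scalemxAl.
Qed.

End TraceMod.

Section WordTraces.

Variables (q d : nat).
Local Notation p := q.+2.
Hypothesis p_pr : prime p.
Local Notation red := (map_mx (intr : int -> 'F_p) : 'M[int]_d -> 'M['F_p]_d).

Variables (gT : finGroupType) (P : {group gT}) (T : finType) (to : {action gT &-> T}).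
Variables (L : {set T}) (X : T -> 'M['F_p]_d).
Hypotheses (pP : p.-group P) (actL : [acts P, on L | to]).
Hypothesis noFix : 'Fix_(L | to)(P) = set0.
Hypothesis XJ : forall g, g \in P ->
  exists U V, {in L, forall l, X (to l g) = U *m X l *m V /\ V *m U *m X l = X l}.
Hypothesis tr0 : forall (H : {group gT}) (w : 'I_p -> T), H \subset P ->
  #|P : H| = p -> (forall i, w i \in 'Fix_(L | to)(H)) ->
  \tr (\prod_i X (w i)) = 0.

Local Notation word := {ffun 'I_p -> T}.

(** A word of length p stands for a monomial in the expansion of the p-th power of
the sum of the matrices X l; it can be rotated, and P acts on its letters. *)
Definition word_act (w : word) (rg : 'I_p * gT) : word :=
  [ffun i => to (w (i + rg.1)) rg.2].

Lemma word_act_is_action : is_action [set: 'I_p * gT] word_act.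
Proof.
apply: is_total_action => [w | w [r g] [s h]] /=; apply/ffunP=> i; rewrite !ffunE /=.
  by rewrite addr0 act1.
by rewrite actM -addrA (addrC s).
Qed.
Canonical word_action := Action word_act_is_action.

Lemma letter_act_is_action : is_action [set: gT] (fun (w : word) g => [ffun i => to (w i) g]).
Proof.
apply: is_total_action => [w | w g h] /=; apply/ffunP=> i; rewrite !ffunE ?act1 //.
by rewrite actM.
Qed.
Definition letter_action := Action letter_act_is_action.

Definition word_trace (w : word) : int := \tr (\prod_i lift_mx (X (w i))).

Lemma word_trace_red w : (word_trace w)%:~R = \tr (\prod_i X (w i)) :> 'F_p.
Proof.
rewrite /word_trace -red_tr (big_morph red (@red_mul q d) (map_mx1 _ d)).
by under eq_bigr do rewrite lift_mxK.
Qed.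

Definition wordL : {set word} := [set w : word | [forall i, w i \in L]].

Lemma wordLP (w : word) : reflect (forall i, w i \in L) (w \in wordL).
Proof. by rewrite inE; apply: forallP. Qed.

Lemma sum_words : \tr ((\sum_(l in L) lift_mx (X l)) ^+ p) = \sum_(w in wordL) word_trace w.
Proof.
have -> S : S ^+ p = \prod_(i < p) S :> 'M[int]_d by rewrite prodr_const card_ord.
rewrite bigA_distr_big raddf_sum /=.
by apply: eq_bigl => w; apply/ffun_onP/wordLP.
Qed.

Definition rotations := setX [set: 'I_p] P.
Canonical rotations_group := Eval hnf in [group of rotations].

Lemma acts_word : [acts rotations, on wordL | word_action].
Proof.
apply/actsP=> -[r g] /setXP[/= _ Pg] w; apply/wordLP/wordLP => h i.
  have := h (i - r); rewrite /= /word_act ffunE /= subrK.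
  by rewrite (acts_act actL).
by rewrite /= /word_act ffunE /= (acts_act actL) ?h.
Qed.

Lemma word_trace_rot w r : word_trace (word_act w (r, 1%g)) = word_trace w.
Proof.
have rot1 (u : word) : word_trace (word_act u (1, 1%g)) = word_trace u.
  have e0 : (ord_max : 'I_p) + 1 = ord0.
    by apply: val_inj => /=; rewrite -[(1 %% _)%N]/1%N addn1 modnn.
  have e1 (i : 'I_q.+1) : widen_ord (leqnSn q.+1) i + 1 = lift ord0 i.
    apply: val_inj; rewrite /= -[(1 %% _)%N]/1%N addn1 modn_small // ltnS.
    exact: ltn_ord.
  rewrite /word_trace big_ord_recr /= -mulmxE mxtrace_mulC [in RHS]big_ord_recl.
  rewrite ffunE /= act1 e0; congr (\tr (_ *m _)).
  by apply: eq_bigr => i _; rewrite ffunE /= act1 e1.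
have -> : r = r%:R by rewrite natr_Zp.
elim: (r : nat) => [|k IHk].
  by congr (word_trace _); apply/ffunP=> i; rewrite ffunE /= addr0 act1.
rewrite -[RHS]IHk -[RHS]rot1; congr word_trace; apply/ffunP=> i.
by rewrite !ffunE /= !act1 -natr1 (addrC k%:R) addrA.
Qed.

(** The factors V U between consecutive letters cancel, and the outer U and V meet
by the cyclicity of the trace. *)
Lemma prod_conj n (U V : 'M['F_p]_d) (A : 'I_n.+1 -> 'M['F_p]_d) :
  (forall i, V *m U *m A i = A i) ->
  \tr (\prod_i (U *m A i *m V)) = \tr (\prod_i A i).
Proof.
move=> VUA.
have key : \prod_i (U *m A i *m V) = U *m (\prod_i A i) *m V
           /\ V *m U *m (\prod_i A i) = \prod_i A i.
  elim: n A VUA => [|n IHn] A VUA; first by rewrite !big_ord1.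
  have [IH1 IH2] := IHn (fun i => A (lift ord0 i)) (fun i => VUA _).
  rewrite !(big_ord_recl n.+1) IH1 -!mulmxE; split; last by rewrite mulmxA VUA.
  by rewrite -!mulmxA (mulmxA V) (mulmxA (V *m U)) IH2.
by case: key => -> key; rewrite mxtrace_mulC mulmxA key.
Qed.

Lemma word_trace_act w r g : g \in P -> w \in wordL -> (p %| word_trace (word_act w (r, g)) - word_trace w)%Z.
Proof.
move=> Pg /wordLP Lw.
have -> : word_act w (r, g) = word_act (word_act w (0, g)) (r, 1%g).
  by apply/ffunP=> i; rewrite !ffunE /= act1 addr0.
rewrite word_trace_rot dvdz_red // rmorphB /= !word_trace_red subr_eq0; apply/eqP.
have [U [V XE]] := XJ Pg.
rewrite (eq_bigr (fun i => U *m X (w i) *m V)) => [|i _].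
  by apply: prod_conj => i; case: (XE _ (Lw i)).
by rewrite ffunE /= addr0; case: (XE _ (Lw i)).
Qed.

(** Here the trace is that of a p-th power, so a congruence of the bases modulo p
gives a congruence of the traces modulo p^2; and (U A V)^p has the same trace as
(V U A)^p. *)
Lemma word_trace_const w r g : g \in P -> w \in wordL -> (forall i, w i = w 0) ->
  ((p ^ 2)%N %| word_trace (word_act w (r, g)) - word_trace w)%Z.
Proof.
move=> Pg /wordLP Lw cw; have [U [V XE]] := XJ Pg.
have [X1 X2] := XE _ (Lw 0).
have wtrE (u : word) l : (forall i, u i = l) -> word_trace u = \tr (lift_mx (X l) ^+ p).
  move=> ul; rewrite /word_trace (eq_bigr (fun=> lift_mx (X l))) => [|i _]; last by rewrite ul.
  by rewrite prodr_const card_ord.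
rewrite (wtrE _ (to (w 0) g)); last by move=> i; rewrite ffunE /= cw.
rewrite (wtrE w (w 0)) //.
pose A := lift_mx (X (w 0)).
have e1 : red (lift_mx (X (to (w 0) g))) = red (lift_mx U * A * lift_mx V).
  by rewrite !red_mul !lift_mxK X1.
have e2 : red (lift_mx V * (lift_mx U * A)) = red A.
  by rewrite !red_mul !lift_mxK -!mulmxE mulmxA X2.
have := rpredD (mxtrace_exp_cong p_pr e1) (mxtrace_exp_cong p_pr e2).
by rewrite addrA (mxtrace_exp_mulC (lift_mx U * A)) // subrK.
Qed.

(** For a word that is not constant, the rotation group acts without fixed points on
the orbit and preserves the quotient of each difference by p; so the sum of these
quotients vanishes modulo p. *)
Lemma word_orbit_sum w : w \in wordL ->
  ((p ^ 2)%N %| \sum_(u in orbit word_action rotations w) (word_trace u - word_trace w))%Z.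
Proof.
move=> Lw; set O := orbit _ _ _.
have OL u : u \in O -> u \in wordL.
  by move=> /orbitP[x Gx <-]; rewrite (acts_act acts_word).
have [cw|ncw] := boolP [forall i, w i == w 0].
  apply: rpred_sum => _ /orbitP[[r g] /setXP[/= _ Pg] <-].
  by apply: word_trace_const => // i; apply/eqP/(forallP cw).
pose dl u : 'F_p := ((word_trace u - word_trace w) %/ p)%Z%:~R.
have dlP u : u \in O -> word_trace u - word_trace w = ((word_trace u - word_trace w) %/ p)%Z * Posz p.
  case/orbitP=> [[r g] /setXP[/= _ Pg] <-].
  by rewrite divzK // word_trace_act.
rewrite (eq_bigr _ dlP) -mulr_suml (_ : Posz (p ^ 2)%N = Posz p * Posz p); last first.
  by rewrite expnS expn1 PoszM.
rewrite dvdz_mul2r // dvdz_red // rmorph_sum /=.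
(* Z is the group of rotations. *)
pose Z := setX_group [set: 'I_p] (1%G : {group gT}).
have ZE x : x \in Z -> x = (x.1, 1%g).
  by case: x => r g /setXP[/= _ /set1gP->].
have pZ : p.-group Z.
  by rewrite /pgroup /= cardsX cards1 muln1 cardsT card_ord pnat_id.
have sZG : Z \subset rotations by rewrite setXS ?sub1G.
have actO : [acts Z, on O | word_action].
  by apply: subset_trans sZG _; apply: acts_orbit; apply: subsetT.
rewrite (sum_pgroup_fix pZ _ actO) => [|v|u x Ou Zx].
- rewrite big_pred0 // => u; apply/negP=> /setIP[/orbitP[[r g] /setXP[/= _ Pg] <-]].
  move/afixP=> fx; case/negP: ncw; apply/forallP=> i; apply/eqP.
  have Zi : (i, 1%g) \in Z by rewrite in_setX in_setT group1.
  move: (fx _ Zi) => /ffunP/(_ (- r)).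
  by rewrite !ffunE /= act1 addrAC !addNr add0r => /act_inj.
- by rewrite -mulr_natr pchar_Fp_0 ?mulr0.
- by rewrite (ZE x) //= word_trace_rot.
Qed.

(** The length of the orbit is a power of p, and is not 1 because P fixes no letter.
If it is p, the stabiliser in P of the word has index p, and the trace is itself
divisible by p. *)
Lemma word_orbit_card w : w \in wordL ->
  ((p ^ 2)%N %| word_trace w *+ #|orbit word_action rotations w|)%Z.
Proof.
move=> Lw; have LwP := wordLP _ Lw.
have nofix u : u \in wordL -> ~ (forall g, g \in P -> to (u 0) g = u 0).
  move=> /wordLP Lu fx; have : u 0 \in 'Fix_(L | to)(P).
    by rewrite inE Lu; apply/afixP.
  by rewrite noFix inE.
have pG : p.-group rotations.
  by rewrite /pgroup /= cardsX cardsT card_ord pnatM pnat_id.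
have /p_natP[k ek] : p.-nat #|orbit word_action rotations w|.
  by apply: pnat_dvd pG; apply: (@dvdn_orbit _ _ _ rotations_group).
rewrite ek -mulr_natr natz; case: k ek => [|[|k]] ek.
- case: (nofix w Lw) => g Pg; move/card_orbit1: ek => ek.
  have : word_act w (0, g) \in orbit word_action rotations w.
    by apply: mem_orbit; rewrite inE /= inE.
  by rewrite ek inE => /eqP/ffunP/(_ 0); rewrite ffunE /= addr0.
- rewrite expn1 (_ : Posz (p ^ 2)%N = Posz p * Posz p); last first.
    by rewrite expnS expn1 PoszM.
  rewrite dvdz_mul2r // dvdz_red // word_trace_red.
  pose H := ('C_P[w | letter_action])%G.
  have sHP : H \subset P by apply: subsetIl.
  have /p_natP[j ej] : p.-nat #|P : H| by apply: pnat_dvd pP; apply: dvdn_indexg.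
  have eo : #|orbit letter_action P w| = #|P : H| by apply: card_orbit.
  have le : (#|P : H| <= p)%N.
    rewrite -[p]expn1 -ek -eo; apply: subset_leq_card; apply/subsetP=> u.
    case/orbitP=> g Pg <-; rewrite (_ : letter_action w g = word_act w (0, g)).
      by apply: mem_orbit; rewrite inE /= inE.
    by apply/ffunP=> i; rewrite !ffunE addr0.
  have fixH h : h \in H -> forall i, to (w i) h = w i.
    by case/setIP=> _ /astab1P/= /ffunP fx i; have := fx i; rewrite ffunE.
  rewrite (tr0 (H := H)) //; last first.
    by move=> i; rewrite inE LwP; apply/afixP=> h Hh; apply: fixH.
  case: j ej => [|[|j]] ej //.
    have eHP : H :=: P by apply: index1g sHP _; rewrite ej.
    by case: (nofix w Lw) => g Pg; apply: fixH; rewrite eHP.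
  move: le; rewrite ej -{2}[p]expn1 leq_exp2l //.
- by apply: dvdz_mull; rewrite dvdzE !absz_nat dvdn_exp2l.
Qed.

(** E is its own p-th power, so modulo p^2 its trace is that of the p-th power of
the sum of the lifts, which is a sum over words and can be grouped by orbits. *)
Lemma mxtrace_sq_dvd (E : 'M[int]_d) : E *m E = E -> red E = \sum_(l in L) X l ->
  ((p ^ 2)%N %| \tr E)%Z.
Proof.
move=> EE rE; have Ep : E ^+ p = E.
  by elim: {1}q.+1 => [|k IHk]; rewrite ?expr1 // exprS IHk.
have e : red (\sum_(l in L) lift_mx (X l)) = red E.
  by rewrite rE raddf_sum; apply: eq_bigr => l _; apply: lift_mxK.
have := mxtrace_exp_cong p_pr e; rewrite Ep sum_words => dE.
suff dS : ((p ^ 2)%N %| \sum_(w in wordL) word_trace w)%Z.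
  by have := rpredB dS dE; rewrite opprB addrC subrK.
rewrite (set_partition_big _ (orbit_partition acts_word)) /=.
apply: rpred_sum => _ /imsetP[w Lw ->].
have := rpredD (word_orbit_sum Lw) (word_orbit_card Lw).
by rewrite sumrB sumr_const subrK.
Qed.

End WordTraces.

(** * Exterior powers of matrices *)

Notation rset k r := {A : {set 'I_k} | #|A| == r}.

Section RSets.

Variables (k r : nat).
Implicit Types A B : rset k r.

Definition rs A (i : 'I_r) : 'I_k := enum_val (cast_ord (esym (eqP (valP A))) i).

Lemma rs_inj A : injective (rs A).
Proof. by move=> i j /enum_val_inj/cast_ord_inj. Qed.

Lemma mem_rs A i : rs A i \in val A.
Proof. exact: enum_valP. Qed.

Lemma rs_surj A x : x \in val A -> exists i, rs A i = x.
Proof.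
move=> Ax; exists (cast_ord (eqP (valP A)) (enum_rank_in Ax x)).
by rewrite /rs cast_ordK enum_rankK_in.
Qed.

Lemma rs_factor A (f : 'I_r -> 'I_k) : injective f -> (forall i, f i \in val A) ->
  exists s : 'S_r, forall i, f i = rs A (s i).
Proof.
move=> inj_f fA; have /fin_all_exists[s sE] i := rs_surj (fA i).
have inj_s : injective s by move=> i j e; apply: inj_f; rewrite -!sE e.
by exists (perm inj_s) => i; rewrite permE sE.
Qed.

Lemma card_rset : #|{: rset k r}| = 'C(k, r).
Proof. by rewrite card_sig -(card_ord k) -card_draws card_ord; apply: eq_card => A; rewrite !inE. Qed.

End RSets.

Section ExteriorPower.

Variable R : comNzRingType.

Lemma det_mulmx_expand r k (A : 'M[R]_(r, k)) (B : 'M_(k, r)) :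
  \det (A *m B) =
    \sum_(f : {ffun 'I_r -> 'I_k}) (\prod_i A i (f i)) * \det (rowsub f B).
Proof.
rewrite /determinant.
under eq_bigr => s _.
  under eq_bigr do rewrite mxE.
  rewrite bigA_distr_bigA mulr_sumr.
  under eq_bigr do rewrite big_split mulrCA.
  over.
rewrite exchange_big; apply: eq_bigr => f _; rewrite -mulr_sumr.
by congr (_ * _); apply: eq_bigr => s _; under [in RHS]eq_bigr do rewrite mxE.
Qed.

Lemma det_rowsub_noninj r k (f : 'I_r -> 'I_k) (B : 'M[R]_(k, r)) :
  ~ injective f -> \det (rowsub f B) = 0.
Proof.
move=> /injectiveP/injectivePn[i [j nij eij]].
by apply: (determinant_alternate nij) => l; rewrite !mxE eij.
Qed.

(** A variant of the Cauchy-Binet formula over all r-tuples instead of r-subsets,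
hence the factor r!; sums over tabloids arise in this form. *)
Lemma sum_det_det r k (A : 'M[R]_(r, k)) (B : 'M_(k, r)) :
  \sum_(f : {ffun 'I_r -> 'I_k}) \det (colsub f A) * \det (rowsub f B)
    = \det (A *m B) *+ r`!.
Proof.
under eq_bigr do rewrite [\det (colsub _ _)]/determinant mulr_suml.
rewrite exchange_big /= -card_Sn -sumr_const; apply: eq_bigr => s _.
rewrite det_mulmx_expand.
rewrite (reindex (fun f : {ffun 'I_r -> 'I_k} => [ffun i => f (s^-1%g i)])) /=; last first.
  exists (fun f : {ffun 'I_r -> 'I_k} => [ffun i => f (s i)]) => f _;
    by apply/ffunP=> i; rewrite !ffunE ?permK ?permKV.
apply: eq_bigr => f _; rewrite mulrAC mulrC; congr (_ * _).
  by apply: eq_bigr => i _; rewrite mxE ffunE permK.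
have -> : rowsub [ffun i => f (s^-1%g i)] B = row_perm s^-1 (rowsub f B).
  by apply/matrixP=> i j; rewrite !mxE ffunE.
by rewrite row_permE det_mulmx det_perm odd_permV mulrA -expr2 sqrr_sign mul1r.
Qed.

Lemma cauchy_binet r k (A : 'M[R]_(r, k)) (B : 'M_(k, r)) :
  \det (A *m B) = \sum_(J : rset k r) \det (colsub (rs J) A) * \det (rowsub (rs J) B).
Proof.
rewrite det_mulmx_expand (bigID (fun f : {ffun _} => injectiveb f)) /= addrC big1 ?add0r.
  2: by move=> f /injectiveP nf; rewrite det_rowsub_noninj ?mulr0.
pose h (x : rset k r * 'S_r) : {ffun 'I_r -> 'I_k} := [ffun i => rs x.1 (x.2 i)].
have inj_h : injective h.
  move=> [J s] [K t] /ffunP e; have {}e i : rs J (s i) = rs K (t i).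
    by have := e i; rewrite !ffunE.
  have eJK : J = K.
    apply: val_inj; apply/setP=> x; apply/idP/idP=> /rs_surj[i <-].
      by rewrite -(permKV s i) e mem_rs.
    by rewrite -(permKV t i) -e mem_rs.
  rewrite -eJK in e *; congr (_, _); apply/permP=> i.
  by apply: (rs_inj (e i)).
rewrite (eq_bigl (mem (h @: [set: _]))) /= => [|f]; last first.
  apply/idP/imsetP=> [/injectiveP inj_f|[[J s] _ ->]].
    have cJ : #|f @: [set: 'I_r]| == r by rewrite card_imset // cardsT card_ord.
    pose J : rset k r := exist _ (f @: [set: 'I_r]) cJ.
    have [i|s sE] := @rs_factor _ _ J f inj_f; first by rewrite imset_f ?inE.
    by exists (J, s) => //; apply/ffunP=> i; rewrite ffunE sE.
  by apply/injectiveP=> i j; rewrite !ffunE => /rs_inj/perm_inj.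
rewrite big_imset /=; last by move=> x y _ _; apply: inj_h.
rewrite (eq_bigl predT) => [|x]; last by rewrite inE.
rewrite -(pair_bigA _ (fun J s => (\prod_i A i (h (J, s) i)) * \det (rowsub (h (J, s)) B))) /=.
apply: eq_bigr => J _; rewrite [\det (colsub _ _)]/determinant mulr_suml.
apply: eq_bigr => s _.
have -> : rowsub (h (J, s)) B = row_perm s (rowsub (rs J) B).
  by apply/matrixP=> i j; rewrite !mxE ffunE.
rewrite row_permE det_mulmx det_perm mulrCA mulrA; congr (_ * _ * _).
by apply: eq_bigr => i _; rewrite mxE ffunE.
Qed.

Section Functor.

Variable r : nat.

(** The exterior product of the rows of A, in coordinates indexed by r-subsets. *)
Definition wedge k (A : 'M[R]_(r, k)) : 'rV[R]_#|{: rset k r}| :=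
  \row_b \det (colsub (rs (enum_val b)) A).

(** The compound matrix, which is the r-th exterior power of M. *)
Definition ext k l (M : 'M[R]_(k, l)) : 'M[R]_(#|{: rset k r}|, #|{: rset l r}|) :=
  \matrix_(a, b) \det (mxsub (rs (enum_val a)) (rs (enum_val b)) M).

Lemma row_ext k l (M : 'M[R]_(k, l)) a : row a (ext M) = wedge (rowsub (rs (enum_val a)) M).
Proof. by apply/rowP=> b; rewrite !mxE; congr (\det _); apply/matrixP=> i j; rewrite !mxE. Qed.

Lemma wedge_mul k l (A : 'M[R]_(r, k)) (M : 'M[R]_(k, l)) :
  wedge (A *m M) = wedge A *m ext M.
Proof.
apply/rowP=> b; rewrite !mxE.
have -> : colsub (rs (enum_val b)) (A *m M) = A *m colsub (rs (enum_val b)) M.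
  by apply/matrixP=> i j; rewrite !mxE; apply: eq_bigr => x _; rewrite !mxE.
rewrite cauchy_binet.
rewrite (reindex (fun j : 'I_#|{: rset k r}| => enum_val j)) /=; last first.
  by apply: onW_bij; apply: enum_val_bij.
apply: eq_bigr => j _; rewrite !mxE; congr (_ * \det _).
by apply/matrixP=> i i'; rewrite !mxE.
Qed.

Lemma ext_mul k l m (M : 'M[R]_(k, l)) (N : 'M[R]_(l, m)) :
  ext (M *m N) = ext M *m ext N.
Proof.
apply/row_matrixP=> a; rewrite row_mul !row_ext -wedge_mul; congr wedge.
by apply/matrixP=> i j; rewrite !mxE; apply: eq_bigr => x _; rewrite !mxE.
Qed.

Lemma ext1 k : ext (1%:M : 'M[R]_k) = 1%:M.
Proof.
apply/matrixP=> a b; rewrite !mxE.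
have [<-|nab] := eqVneq a b.
  rewrite -[RHS](det1 _ r); congr (\det _); apply/matrixP=> i j.
  by rewrite !mxE (inj_eq (@rs_inj _ _ _)).
have [i ni] : exists i, rs (enum_val a) i \notin val (enum_val b).
  apply/existsP; rewrite -negb_forall; apply: contra nab => /forallP sab.
  apply/eqP/enum_val_inj/val_inj/eqP; rewrite eqEcard.
  rewrite (eqP (valP (enum_val a))) (eqP (valP (enum_val b))) leqnn andbT.
  by apply/subsetP=> x /rs_surj[i <-]; have := sab i.
rewrite (expand_det_row _ i) big1 // => j _; rewrite !mxE.
by case: eqP => [e|_]; rewrite ?mul0r //; rewrite e mem_rs in ni.
Qed.

End Functor.

End ExteriorPower.

Lemma map_ext (R S : comNzRingType) (f : {rmorphism R -> S}) r k l (M : 'M[R]_(k, l)) :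
  map_mx f (ext r M) = ext r (map_mx f M).
Proof. by apply/matrixP=> a b; rewrite !mxE -det_map_mx map_mxsub. Qed.

(** * The heart of the natural permutation module *)

Section Heart.

Variables (K : fieldType) (n k : nat) (kn : (k < n)%N) (l : 'I_n).
Hypothesis kl : (k <= l)%N.

(** The heart consists of the row vectors of sum zero modulo constant vectors.  It has
the basis e_i - e_l for i < k, and the coordinates v_i - v_pivot, i < k, are
well defined on it.  Two cases are used: k = n-1, where l and the pivot are the
last point, and k = n-2, where the pivot and l are the last two points. *)
Definition jn (j : 'I_k) : 'I_n := widen_ord (ltnW kn) j.
Definition pivot : 'I_n := Ordinal kn.

Lemma jn_inj : injective jn.
Proof. by move=> i j /(congr1 val) /= e; apply: val_inj. Qed.

Lemma jn_pivot j : (jn j == pivot) = false.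
Proof. by rewrite -val_eqE /= ltn_eqF. Qed.

Lemma jn_l j : (jn j == l) = false.
Proof. by rewrite -val_eqE /= ltn_eqF // (leq_trans (ltn_ord j)). Qed.

Definition coords : 'M[K]_(n, k) := \matrix_(x, j) ((x == jn j)%:R - (x == pivot)%:R).
Definition zero_sum_rows : 'M[K]_(k, n) := \matrix_(i, x) ((x == jn i)%:R - (x == l)%:R).
Definition gram : 'M[K]_k := zero_sum_rows *m coords.
(** The matrix of g in the basis of the rows of [zero_sum_rows]; the inverse of the
Gram matrix passes from the coordinates [coords] to that basis. *)
Definition heart_mx (g : 'S_n) : 'M[K]_k := invmx gram *m zero_sum_rows *m perm_mx g *m coords.
Definition ones : 'cV[K]_n := const_mx 1.

Lemma sum_pick m (v : 'M[K]_(m, n)) i (y : 'I_n) : \sum_x v i x * (x == y)%:R = v i y.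
Proof.
rewrite (bigD1 y) //= eqxx mulr1 big1 ?addr0 // => x /negPf->.
by rewrite mulr0.
Qed.

Lemma mul_coordsE m (v : 'M[K]_(m, n)) i j : (v *m coords) i j = v i (jn j) - v i pivot.
Proof.
rewrite mxE; under eq_bigr do rewrite mxE mulrBr.
by rewrite sumrB !sum_pick.
Qed.

Lemma mul_onesE m (v : 'M[K]_(m, n)) i j : (v *m ones) i j = \sum_x v i x.
Proof. by rewrite mxE; apply: eq_bigr => x _; rewrite mxE mulr1. Qed.

Lemma zero_sum_rows_ones : zero_sum_rows *m ones = 0.
Proof.
apply/matrixP=> i j; rewrite mul_onesE mxE; under eq_bigr do rewrite mxE.
rewrite sumrB -2!natr_sum.
have e y : (\sum_(x < n) (x == y) = 1)%N.
  by rewrite (bigD1 y) //= eqxx big1 // => x /negPf->.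
by rewrite !e subrr.
Qed.

Lemma perm_ones (g : 'S_n) : perm_mx g *m ones = ones.
Proof.
apply/matrixP=> i j; rewrite mul_onesE [RHS]mxE; under eq_bigr do rewrite !mxE.
by rewrite (bigD1 (g i)) //= eqxx big1 ?addr0 // => x /negPf; rewrite eq_sym => ->.
Qed.

Lemma const_perm (g : 'S_n) (c : K) : (const_mx c : 'rV_n) *m perm_mx g = const_mx c.
Proof.
apply/rowP=> x; rewrite !mxE (bigD1 (g^-1%g x)) //= big1 ?addr0 => [|y nyx].
  by rewrite !mxE permKV eqxx mulr1.
by rewrite !mxE -(inj_eq (@perm_inj _ g^-1%g)) permK (negPf nyx) mulr0.
Qed.

Lemma gramE : gram = 1%:M + (l == pivot)%:R *: const_mx 1.
Proof.
apply/matrixP=> i j; rewrite mul_coordsE !mxE (inj_eq jn_inj) jn_l.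
by rewrite (eq_sym pivot (jn i)) jn_pivot subr0 sub0r opprK mulr1 eq_sym (eq_sym pivot).
Qed.

(** The two conditions say that [coords] has full rank on the span of the basis, and
that its kernel on vectors of sum zero consists of constant vectors. *)
Definition heart_ok : Prop := gram \in unitmx /\
  forall v : 'rV[K]_n, v *m ones = 0 -> v *m coords = 0 -> exists c, v = const_mx c.

Hypothesis ok : heart_ok.

(** The rows of A differ from their expansions in the basis by vectors of sum zero with
zero coordinates, hence by constant vectors; these are fixed by permutations and
killed by [coords]. *)
Lemma mul_heart_mx m (A : 'M[K]_(m, n)) g : A *m ones = 0 ->
  A *m coords *m heart_mx g = A *m perm_mx g *m coords.
Proof.
case: ok => uG hC A0.
pose W := A *m coords *m invmx gram *m zero_sum_rows - A.
suff W0 : W *m perm_mx g *m coords = 0.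
  apply/eqP; rewrite -subr_eq0 -W0 /W /heart_mx !mulmxBl !mulmxA; exact/eqP.
apply/row_matrixP=> i; rewrite row0 2!row_mul.
have Wone : row i W *m ones = 0.
  by rewrite -row_mul /W mulmxBl A0 -(mulmxA _ zero_sum_rows) zero_sum_rows_ones mulmx0 subr0 row0.
have Wkap : row i W *m coords = 0.
  by rewrite -row_mul /W mulmxBl -(mulmxA _ zero_sum_rows) -/gram mulmxKV ?subrr ?row0.
have [c ec] := hC _ Wone Wkap.
by rewrite ec const_perm -ec.
Qed.

Lemma heart_mx1 : heart_mx 1 = 1%:M.
Proof.
by case: ok => uG _; rewrite /heart_mx perm_mx1 mulmx1 -mulmxA mulVmx.
Qed.

Lemma heart_mxM g h : heart_mx (g * h) = heart_mx g *m heart_mx h.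
Proof.
rewrite {2}/heart_mx mul_heart_mx; first by rewrite /heart_mx perm_mxM !mulmxA.
by rewrite -!mulmxA perm_ones zero_sum_rows_ones mulmx0.
Qed.

Lemma heart_mx_perm (g : 'S_n) (s : 'S_k) :
  (forall j, g (jn j) = jn (s j)) -> g pivot = pivot -> heart_mx g = perm_mx s.
Proof.
case: ok => uG _ gs gk.
have e : perm_mx g *m coords = coords *m perm_mx s.
  rewrite -[s in RHS]invgK -col_permE; apply/matrixP=> x j.
  rewrite -row_permE !mxE; congr (_%:R - _%:R).
    by rewrite -{1}[j](permKV s) -gs (inj_eq perm_inj).
  by rewrite -{1}gk (inj_eq perm_inj).
by rewrite /heart_mx -mulmxA e mulmxA -(mulmxA _ zero_sum_rows) mulVmx // mul1mx.
Qed.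

Lemma restrict_perm (g : 'S_n) : (forall x : 'I_n, (k <= x)%N -> g x = x) ->
  exists s : 'S_k, forall j, g (jn j) = jn (s j).
Proof.
move=> fx; have lt j : (g (jn j) < k)%N.
  rewrite ltnNge; apply/negP=> le; have := fx _ le.
  by move=> /perm_inj e; rewrite e /= leqNgt ltn_ord in le.
have inj : injective (fun j => Ordinal (lt j)).
  by move=> i j /(congr1 val) /= /val_inj/perm_inj/jn_inj.
by exists (perm inj) => j; apply: val_inj; rewrite /= permE.
Qed.

Lemma ext_heart_repr r : mx_repr [set: 'S_n] (fun g => ext r (heart_mx g)).
Proof.
by split=> [|g h _ _]; rewrite ?heart_mx1 ?ext1 // heart_mxM ext_mul.
Qed.

Definition hook_repr r : mx_representation K [set: 'S_n] #|{: rset k r}| :=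
  MxRepresentation (ext_heart_repr r).

End Heart.

Lemma map_heart_mx (K K' : fieldType) (f : {rmorphism K -> K'}) n k (kn : (k < n)%N) l g :
  map_mx f (heart_mx K kn l g) = heart_mx K' kn l g.
Proof.
have ek : map_mx f (coords K kn) = coords K' kn.
  by apply/matrixP=> i j; rewrite !mxE rmorphB !rmorph_nat.
have ei : map_mx f (zero_sum_rows K kn l) = zero_sum_rows K' kn l.
  by apply/matrixP=> i j; rewrite !mxE rmorphB !rmorph_nat.
by rewrite /heart_mx !map_mxM map_invmx map_perm_mx /gram map_mxM ek ei.
Qed.

Lemma heart_ok_coprime (K : fieldType) n (kn : (n < n.+1)%N) :
  n.+1%:R != 0 :> K -> heart_ok K kn (Ordinal kn).
Proof.
move=> nz; split=> [|v v1 vk].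
  have e : gram K kn (Ordinal kn) *m (1%:M - n.+1%:R^-1 *: const_mx 1) = 1%:M.
    rewrite gramE ?leqnn // eqxx scale1r mulmxDl mul1mx; apply/matrixP=> i j.
    rewrite !mxE (eq_bigr (fun x : 'I_n => (x == j)%:R - n.+1%:R^-1)) => [|x _]; last first.
      by rewrite !mxE mul1r mulr1.
    rewrite sumrB sumr_const card_ord (bigD1 j) //= eqxx big1 ?addr0 => [|x /negPf-> //].
    have -> : n.+1%:R^-1 *+ n = 1 - n.+1%:R^-1 :> K.
      by apply/eqP; rewrite eq_sym subr_eq -mulrSr -[_^-1 *+ _]mulr_natr mulVf.
    by rewrite mulr1 opprB (addrCA 1) subrr addr0 subrK.
  by case: (mulmx1_unit e).
exists (v 0 (pivot kn)); apply/rowP=> x; rewrite mxE.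
have [lt|ge] := ltnP x n.
  have := congr1 (fun A : 'M_(1, n) => A 0 (Ordinal lt)) vk; rewrite mul_coordsE mxE.
  by move/eqP; rewrite subr_eq0 => /eqP <-; congr (v 0 _); apply: val_inj.
by congr (v 0 _); apply: val_inj; apply/eqP; rewrite eqn_leq ge -ltnS ltn_ord.
Qed.

Lemma heart_ok_dvd (K : fieldType) n (kn : (n < n.+2)%N) :
  n.+2%:R = 0 :> K -> heart_ok K kn ord_max.
Proof.
move=> z; split=> [|v v1 vk].
  by rewrite gramE //= -val_eqE /= eqn_leq ltnn scale0r addr0 unitmx1.
have vE (x : 'I_n.+2) : (x < n.+1)%N -> v 0 x = v 0 (pivot kn).
  rewrite ltnS leq_eqVlt => /predU1P[e|lt].
    by congr (v 0 _); apply: val_inj.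
  have := congr1 (fun A : 'M_(1, n) => A 0 (Ordinal lt)) vk; rewrite mul_coordsE mxE.
  by move/eqP; rewrite subr_eq0 => /eqP <-; congr (v 0 _); apply: val_inj.
exists (v 0 (pivot kn)); apply/rowP=> x; rewrite mxE.
have [lt|ge] := ltnP x n.+1; first exact: vE.
have ->: x = ord_max by apply: val_inj; apply/eqP; rewrite eqn_leq ge -ltnS ltn_ord.
have := congr1 (fun A : 'M_1 => A 0 0) v1; rewrite mul_onesE mxE big_ord_recr /=.
rewrite (eq_bigr (fun=> v 0 (pivot kn))) => [|i _]; last by apply: vE; apply: (ltn_ord i).
rewrite sumr_const card_ord addrC => /eqP; rewrite addr_eq0 => /eqP ->.
apply/eqP; rewrite eq_sym -subr_eq0 opprK -mulrS; apply/eqP.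
by rewrite -mulr_natr z mulr0.
Qed.

(** * Tabloids and polytabloids of hook shape *)

Lemma exists_perm_map (T : finType) (s1 s2 : seq T) :
  uniq s1 -> uniq s2 -> size s1 = size s2 -> exists s : {perm T}, map s s1 = s2.
Proof.
elim: s1 s2 => [|x s1 IHs] [|y s2] //=; first by exists 1%g.
case/andP=> nx u1 /andP[ny u2] [/(IHs s2 u1 u2)[s es]].
exists (s * tperm (s x) y)%g; rewrite permM tpermL; congr (_ :: _).
rewrite -es; apply/eq_in_map => a s1a /=; rewrite permM tpermD //.
  by apply: contraNneq nx => /perm_inj->.
by apply: contraNneq ny => ->; rewrite -es map_f.
Qed.

Lemma exists_perm_ffun (T : finType) r (f g : 'I_r -> T) :
  injective f -> injective g -> exists s : {perm T}, forall i, s (f i) = g i.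
Proof.
move=> inj_f inj_g.
have [|||s] := @exists_perm_map T (map f (enum 'I_r)) (map g (enum 'I_r)).
- by rewrite map_inj_uniq ?enum_uniq.
- by rewrite map_inj_uniq ?enum_uniq.
- by rewrite !size_map.
by rewrite -map_comp => /eq_in_map es; exists s => i; apply: es; rewrite mem_enum.
Qed.

Section HookTabloids.

Variables (q r : nat).
Local Notation N := (q.+1 + r)%N.
(** The boxes of the first row are numbered lo b, and the leg below the corner
consists of the boxes hi j. *)
Definition hook_shape := q.+1 :: nseq r 1%N.
Local Notation la := hook_shape.

Lemma hookE : hook N r = la.
Proof. by rewrite /hook addnK. Qed.

Local Notation lo := (@lshift q.+1 r).
Local Notation hi := (@rshift q.+1 r).

Lemma flatten_index_hi (j : 'I_r) : nat_of_ord (hi j) = flatten_index la j.+1 0.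
Proof.
rewrite /flatten_index /= addn0 take_nseq; last exact: ltnW.
by rewrite sumn_nseq mul1n.
Qed.

Lemma nth_hook_shape j : (j < r)%N -> nth 0%N la j.+1 = 1%N.
Proof. by move=> lt; rewrite /= nth_nseq lt. Qed.

Definition row_lo (b : 'I_q.+1) : reshape_index la (lo b) = 0%N :=
  @flatten_indexKl la 0 b (ltn_ord b).
Definition col_lo (b : 'I_q.+1) : reshape_offset la (lo b) = b :=
  @flatten_indexKr la 0 b (ltn_ord b).

Lemma row_hi (j : 'I_r) : reshape_index la (hi j) = j.+1.
Proof. by rewrite flatten_index_hi flatten_indexKl ?nth_hook_shape. Qed.

Lemma col_hi (j : 'I_r) : reshape_offset la (hi j) = 0%N.
Proof. by rewrite flatten_index_hi flatten_indexKr ?nth_hook_shape. Qed.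

Lemma loP (P : 'I_N -> Prop) :
  (forall b, P (lo b)) -> (forall j, P (hi j)) -> forall x, P x.
Proof. by move=> Pl Ph x; rewrite -(splitK x); case: (split x). Qed.

Implicit Types t u c : 'S_N.

(** All rows but the first have a single box, so a tabloid amounts to the list of the
entries of the leg. *)
Lemma tabloidP t u :
  reflect (forall j, u (hi j) = t (hi j)) (u \in tabloid la t).
Proof.
rewrite inE; apply: (iffP forallP) => [h j|h i].
  have := h (t (hi j)); rewrite /row_of permK row_hi => /eqP.
  rewrite -{2}[t (hi j)](permKV u); move: (u^-1%g _).
  elim/loP=> b; rewrite ?row_lo // row_hi => -[/val_inj->] //.
rewrite /row_of -[i](permKV t); move: (t^-1%g i); elim/loP=> b; last first.
  by rewrite permK -h permK.
rewrite permK row_lo -[t (lo b)](permKV u); have := permKV u (t (lo b)).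
move: (u^-1%g (t (lo b))); elim/loP=> b'; rewrite permK ?row_lo //.
by rewrite h => /perm_inj/eqP; rewrite eq_rlshift.
Qed.

Lemma tabloid_eqP t u :
  reflect (forall j, u (hi j) = t (hi j)) (tabloid la u == tabloid la t).
Proof.
apply: (iffP eqP) => [e|h].
  by apply/tabloidP; rewrite -e; apply/tabloidP.
by apply/setP=> v; apply/tabloidP/tabloidP=> h' j; rewrite h' h.
Qed.

(** Only the first column has more than one box; it consists of the corner lo ord0
and the leg. *)
Lemma col_stabP t c :
  reflect (forall b, b != ord0 -> c (t (lo b)) = t (lo b)) (c \in col_stab la t).
Proof.
rewrite inE /col_of; apply: (iffP forallP) => [h b nb0|h i].
  have := h (t (lo b)); rewrite permK col_lo => /eqP.
  rewrite -[c (t (lo b))](permKV t); move: (t^-1%g (c (t (lo b)))); elim/loP=> b'.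
    by rewrite permK col_lo => /val_inj->.
  by rewrite permK col_hi => e; case/eqP: nb0; apply: val_inj; rewrite /= -e.
have col x : reshape_offset la (t^-1%g (c x)) != 0%N -> c x = x.
  move=> nz; have [b [nb0 eb]] : exists b, b != ord0 /\ c x = t (lo b).
    move: nz; rewrite -[c x](permKV t); move: (t^-1%g (c x)); elim/loP=> b.
      by rewrite permK col_lo => nz; exists b.
    by rewrite permK col_hi.
  by apply: (@perm_inj _ c); rewrite eb h.
have [e|/col->//] := eqVneq (reshape_offset la (t^-1%g (c i))) 0%N.
rewrite e eq_sym; move: e; rewrite -[i](permKV t); move: (t^-1%g i); elim/loP=> b.
  rewrite permK col_lo; have [->//|nb0] := eqVneq b ord0.
  by rewrite h // permK col_lo => ->.
by rewrite permK col_hi.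
Qed.

End HookTabloids.

Section Polytabloids.

Variables (K : fieldType) (q r : nat).
Local Notation N := (q.+1 + r)%N.
Local Notation la := (hook_shape q r).
Local Notation lo := (@lshift q.+1 r).
Local Notation hi := (@rshift q.+1 r).
Implicit Types t u c : 'S_N.

Definition leg u (j : 'I_r) : 'I_N := u (hi j).
(** The exterior product of these differences, leg entry minus corner entry, is the
polytabloid of t. *)
Definition column_mx t : 'M[K]_(r, N) :=
  \matrix_(i, x) ((x == t (hi i))%:R - (x == t (lo ord0))%:R).

Lemma leg_inj u : injective (leg u).
Proof. by move=> i j /perm_inj/rshift_inj. Qed.

Lemma prod_bool (I : finType) (P : pred I) :
  \prod_i ((P i)%:R : K) = [forall i, P i]%:R.
Proof.
case: forallP => [h|h]; first by rewrite big1 // => i _; rewrite h.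
have /existsP[i /negPf ni] : [exists i, ~~ P i].
  by rewrite -negb_forall; apply/forallP.
by rewrite (bigD1 i) //= ni mul0r.
Qed.

(** The signed sum over the column stabiliser is the Leibniz expansion of a
determinant of size N in which the first row of M allows every value at the corner
and the other boxes of the arm are forced; eliminating the arm leaves a
determinant of size r. *)
Lemma polytabloid_det t u j : enum_val j = tabloid la u ->
  polytabloid K la t 0 j = \det (colsub (leg u) (column_mx t)).
Proof.
move=> ej; pose y i := (t^-1)%g (u (hi i)).
(* M is the matrix of constraints on the column permutation: for b != ord0, row lo b
forces the box lo b to be fixed; row hi i forces the value y i at the box hi i. *)
pose UL : 'M[K]_q.+1 := \matrix_(b, b') ((b == ord0) || (b' == b))%:R.
pose UR : 'M[K]_(q.+1, r) := \matrix_(b, i) (b == ord0)%:R.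
pose LL : 'M[K]_(r, q.+1) := \matrix_(i, b) (lo b == y i)%:R.
pose LR : 'M[K]_(r, r) := \matrix_(i, i') (hi i' == y i)%:R.
pose M := block_mx UL UR LL LR.
have Mlo b x : M (lo b) x = ((b == ord0) || (x == lo b))%:R.
  by elim/loP: x => x; rewrite ?block_mxEul ?block_mxEur !mxE ?eq_lshift ?eq_rlshift ?orbF.
have Mhi i x : M (hi i) x = (x == y i)%:R.
  by elim/loP: x => x; rewrite ?block_mxEdl ?block_mxEdr !mxE.
transitivity (\det M).
  have stabE c : ((c ^ t)%g \in col_stab la t) = [forall b, (b == ord0) || (c (lo b) == lo b)].
    apply/col_stabP/forallP => [h b|h b nb0].
      have [//|nb0] := eqVneq b ord0; have := h b nb0.
      by rewrite conjgE !permM permK => /perm_inj->; rewrite eqxx.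
    by have := h b; rewrite (negPf nb0) /= => /eqP e; rewrite conjgE !permM permK e.
  rewrite /polytabloid summxE (reindex_inj (conjg_inj t)) /= /determinant.
  rewrite [RHS](bigID (fun c => [forall b, (b == ord0) || (c (lo b) == lo b)])) /=.
  rewrite [X in _ = _ + X]big1 ?addr0 => [|c]; last first.
    rewrite negb_forall => /existsP[b nb].
    by rewrite (bigD1 (lo b)) //= Mlo (negPf nb) mul0r mulr0.
  apply: eq_big => [c|c]; first exact: stabE.
  rewrite stabE => /forallP cs.
  rewrite !mxE odd_permJ ej; congr (_ * _).
  rewrite big_split_ord /= big1 ?mul1r => [|b _]; last first.
    by rewrite Mlo cs.
  under eq_bigr do rewrite Mhi.
  rewrite prod_bool tabloidM; congr (_%:R); apply: congr1.
  apply/tabloid_eqP/forallP=> h i; have := h i.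
    by rewrite conjgE !permM permK /y => ->; rewrite permK.
  by rewrite conjgE !permM permK => /eqP->; rewrite permKV.
have sumE (i : bool) (f : 'I_q.+1 -> K) : \sum_b f b * - (b == ord0)%:R = - f ord0.
  rewrite (bigD1 ord0) //= mulrN1 big1 ?addr0 // => b /negPf->.
  by rewrite oppr0 mulr0.
(* Clear the upper right block. *)
have e1 : M *m block_mx 1%:M (- UR) 0 1%:M = block_mx UL 0 LL (colsub (leg u) (column_mx t))^T.
  rewrite mulmx_block !mulmx1 !mulmx0 !addr0; congr block_mx.
    apply/matrixP=> b i; rewrite !mxE; under eq_bigr do rewrite !mxE.
    by rewrite (sumE true) eq_sym orbb addNr.
  apply/matrixP=> i i'; rewrite !mxE; under eq_bigr do rewrite !mxE.
  rewrite (sumE true) addrC /leg /y.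
  by congr (_%:R - _%:R); rewrite eq_sym (can2_eq (permKV t) (permK t)).
have := congr1 determinant e1.
rewrite det_mulmx det_ublock det_lblock !det1 !mulr1 det_tr => ->.
rewrite -[\det UL]det_tr det_trig; last first.
  apply/is_trig_mxP=> i k lt; rewrite !mxE.
  by rewrite -!val_eqE /= (gtn_eqF (leq_ltn_trans (leq0n _) lt)) (ltn_eqF lt).
by rewrite big1 ?mul1r // => b _; rewrite !mxE eqxx orbT.
Qed.

Local Notation dimT := #|tabloids N la|.

Definition tabloid_rep (j : 'I_dimT) : 'S_N := odflt 1%g [pick u | enum_val j == tabloid la u].

Lemma tabloid_repE j : enum_val j = tabloid la (tabloid_rep j).
Proof.
rewrite /tabloid_rep; case: pickP => [u /eqP//|h].
by have /imsetP[u _ e] := enum_valP j; have := h u; rewrite e eqxx.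
Qed.

Lemma exists_leg (f : 'I_r -> 'I_N) : injective f -> exists u, leg u =1 f.
Proof. by move/(exists_perm_ffun (@rshift_inj q.+1 r)); apply. Qed.

(** Tabloids correspond to injective r-tuples, the entries of the leg. *)
Lemma sum_tabloids (G : {ffun 'I_r -> 'I_N} -> K) :
  (forall f : {ffun 'I_r -> 'I_N}, ~ injective f -> G f = 0) ->
  \sum_j G [ffun i => leg (tabloid_rep j) i] = \sum_f G f.
Proof.
move=> G0; pose h (j : 'I_dimT) : {ffun 'I_r -> 'I_N} := [ffun i => leg (tabloid_rep j) i].
have inj_h : injective h.
  move=> i j /ffunP e; apply: enum_val_inj; rewrite !tabloid_repE; apply/eqP.
  by apply/tabloid_eqP=> b; have := e b; rewrite !ffunE.
rewrite [RHS](bigID [in h @: [set: 'I_dimT]]) /= [X in _ + X]big1 ?addr0 => [|f nf].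
  rewrite big_imset /=; last by move=> x y _ _; apply: inj_h.
  by apply: eq_bigl => j; rewrite inE.
apply: G0 => inj_f; case/negP: nf; have [u uf] := exists_leg inj_f.
have Tu : tabloid la u \in tabloids N la by rewrite imset_f.
apply/imsetP; exists (enum_rank_in Tu (tabloid la u)); first by rewrite inE.
apply/ffunP=> i; rewrite ffunE -uf /leg.
set j := enum_rank_in _ _; have /eqP/tabloid_eqP-> // : tabloid la u = tabloid la (tabloid_rep j).
by rewrite -tabloid_repE enum_rankK_in.
Qed.

(** Summing the products of two determinants over tabloids is summing over all
r-tuples, since those with a repeated entry contribute nothing. *)
Lemma polytabloid_pairing t s :
  (polytabloid K la t *m (polytabloid K la s)^T) 0 0 = \det (column_mx t *m (column_mx s)^T) *+ r`!.
Proof.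
rewrite -sum_det_det mxE -sum_tabloids => [|f nf]; last first.
  by rewrite (det_rowsub_noninj _ nf) mulr0.
apply: eq_bigr => j _; rewrite mxE !(polytabloid_det _ (tabloid_repE j)).
congr (_ * _); first by congr (\det _); apply/matrixP=> a b; rewrite !mxE ffunE.
by rewrite -det_tr; congr (\det _); apply/matrixP=> a b; rewrite !mxE ffunE.
Qed.

Definition kappa t : 'M[K]_dimT :=
  \sum_(c in col_stab la t) (-1) ^+ c *: perm_module_mx K la c.

Lemma kappaE u t : tabloid_vec K la (tabloid la u) *m kappa t =
  \sum_(c in col_stab la t) (-1) ^+ c *: tabloid_vec K la (tabloid la (u * c)%g).
Proof.
rewrite /kappa mulmx_sumr; apply: eq_bigr => c _.
by rewrite -scalemxAr tabloid_vecM ?imset_f // tabloidM.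
Qed.

Lemma col_stabM t c d : c \in col_stab la t -> (c * d)%g \in col_stab la t = (d \in col_stab la t).
Proof.
move/col_stabP=> hc; apply/col_stabP/col_stabP=> h b nb0; have := h b nb0.
  by rewrite permM hc.
by rewrite permM hc.
Qed.

Lemma polytabloid_kappa t : polytabloid K la t = tabloid_vec K la (tabloid la t) *m kappa t.
Proof.
by rewrite kappaE; apply: eq_bigr => c _; rewrite tabloidM.
Qed.

Lemma kappa_reindex c t (f : 'S_N -> 'rV[K]_dimT) : c \in col_stab la t ->
  \sum_(d in col_stab la t) (-1) ^+ d *: f (c * d)%g =
  (-1) ^+ c *: \sum_(d in col_stab la t) (-1) ^+ d *: f d.
Proof.
move=> hc; rewrite [in RHS](reindex_inj (mulgI c)) scaler_sumr /=.
apply: eq_big => [d|d _]; first by rewrite col_stabM.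
by rewrite scalerA odd_permM signr_addb mulrA -signr_addb addbb mul1r.
Qed.

(** If two points of the first column of t lie outside the leg of u, then their
transposition cancels the terms in pairs.  Otherwise the leg of u is contained in
the first column of t, and the tabloid of u is the image of that of t under an
element of the column stabiliser. *)
Lemma kappa_tabloid u t :
  exists a, tabloid_vec K la (tabloid la u) *m kappa t = a *: polytabloid K la t.
Proof.
(* D is the first column of t, and E the leg of u. *)
pose D : {set 'I_N} := t (lo ord0) |: [set t (hi i) | i : 'I_r].
pose E : {set 'I_N} := [set leg u i | i : 'I_r].
have nlo b : b != ord0 -> t (lo b) \notin D.
  move=> nb0; rewrite !inE (inj_eq perm_inj) eq_lshift negb_or nb0.
  by apply/imsetP=> -[i _ /perm_inj/eqP]; rewrite eq_lrshift.
have cD : #|D| = r.+1.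
  rewrite cardsU1 card_imset ?cardsT ?card_ord ?add1n; last first.
    by move=> i j /perm_inj/rshift_inj.
  rewrite (_ : _ \notin _) //; apply/imsetP=> -[i _ /perm_inj/eqP].
  by rewrite eq_lrshift.
have cE : #|E| = r by rewrite card_imset ?card_ord //; apply: leg_inj.
have uE j : leg u j \in E by apply: imset_f.
have [x Dx nEx] : exists2 x, x \in D & x \notin E.
  by apply/subsetPn; apply: contraL (leqnn r) => /subset_leq_card; rewrite cD cE -ltnNge.
have [/existsP[y /and3P[Dy nEy nyx]]|nex] := boolP [exists y, [&& y \in D, y \notin E & y != x]].
  exists 0; rewrite scale0r kappaE (bigID (fun c : 'S_N => odd_perm c)) /=.
  pose s := tperm y x.
  have Cs : s \in col_stab la t.
    apply/col_stabP=> b nb0; apply: tpermD; apply: contraTneq (nlo b nb0) => <-;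
      by rewrite ?Dy ?Dx.
  rewrite (reindex_inj (mulgI s)) /= [X in X + _ = _](_ : _ =
      - \sum_(c in col_stab la t | ~~ odd_perm c) (-1) ^+ c *: tabloid_vec K la (tabloid la (u * c)%g)).
    by rewrite addNr.
  rewrite -sumrN; apply: eq_big => [c|c _].
    by rewrite col_stabM // odd_permM odd_tperm nyx.
  rewrite odd_permM odd_tperm nyx -scaleNr -signrN /=; congr (_ *: tabloid_vec K la _).
  apply/eqP/tabloid_eqP=> j; rewrite !permM tpermD //.
    by apply: contraNneq nEy => ->; apply: uE.
  by apply: contraNneq nEx => ->; apply: uE.
have sED : E \subset D.
  have: (#|D :\: E| <= 1)%N.
    rewrite -(cards1 x); apply/subset_leq_card/subsetP=> y /setDP[Dy nEy].
    by rewrite inE; apply: contraR nex => nyx; apply/existsP; exists y; rewrite Dy nEy.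
  rewrite cardsD cD => le; apply/setIidPr/eqP; rewrite eqEcard subsetIr cE.
  by move: le; rewrite leq_subLR addn1.
pose f1 (i : 'I_(q + r)) := t (match split i with inl b => lo (lift ord0 b) | inr j => hi j end).
pose g1 (i : 'I_(q + r)) := match split i with inl b => t (lo (lift ord0 b)) | inr j => leg u j end.
have [||s es] := @exists_perm_ffun _ _ f1 g1.
- move=> i j /perm_inj; rewrite -{2}(splitK i) -{2}(splitK j).
  case: (split i) => b; case: (split j) => b' /eqP;
    rewrite ?eq_lshift ?eq_rshift ?eq_lrshift ?eq_rlshift //= => /eqP.
    by move/lift_inj->.
  by move->.
- have disj b j : t (lo (lift ord0 b)) != leg u j.
    by apply: contraNneq (nlo (lift ord0 b) isT) => ->; apply: (subsetP sED).
  move=> i j; rewrite /g1 -{2}(splitK i) -{2}(splitK j).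
  case: (split i) => b; case: (split j) => b'.
  + by move=> /perm_inj/eqP; rewrite eq_lshift => /eqP/lift_inj->.
  + by move=> e; have := disj b b'; rewrite e eqxx.
  + by move=> e; have := disj b' b; rewrite e eqxx.
  + by move/leg_inj->.
have eslo b : s (t (lo (lift ord0 b))) = t (lo (lift ord0 b)).
  by have := es (unsplit (inl b)); rewrite /f1 /g1 unsplitK.
have eshi j : s (t (hi j)) = leg u j.
  by have := es (unsplit (inr j)); rewrite /f1 /g1 unsplitK.
have Cs : s \in col_stab la t.
  by apply/col_stabP=> b; case: (unliftP ord0 b) => [b' -> _|-> //]; apply: eslo.
exists ((-1) ^+ s); rewrite kappaE polytabloid_kappa kappaE.
rewrite -(kappa_reindex (fun d => tabloid_vec K la (tabloid la (t * d)%g)) Cs).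
apply: eq_bigr => c _; congr (_ *: tabloid_vec K la _).
by apply/eqP/tabloid_eqP=> j; rewrite !permM eshi.
Qed.

Lemma kappa_multiple (v : 'rV[K]_dimT) t : exists a, v *m kappa t = a *: polytabloid K la t.
Proof.
have: forall j, exists a, row j 1%:M *m kappa t = a *: polytabloid K la t.
  move=> j; have [a ea] := kappa_tabloid (tabloid_rep j) t; exists a; rewrite -ea.
  congr (_ *m _); apply/rowP=> j'; rewrite !mxE -tabloid_repE.
  by rewrite (inj_eq enum_val_inj) eq_sym.
case/fin_all_exists=> a ea; exists (\sum_j v 0 j * a j).
rewrite -{1}[v]mulmx1 (mulmx_sum_row v 1%:M) mulmx_suml scaler_suml.
by apply: eq_bigr => j _; rewrite -scalemxAl ea scalerA.
Qed.

(** The matrix kappa t is symmetric, and it maps the tabloid of t to the polytabloid. *)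
Lemma kappa_pairing (v : 'rV[K]_dimT) t :
  v *m kappa t = 0 -> v *m (polytabloid K la t)^T = 0.
Proof.
move=> v0; have Tt : tabloid la t \in tabloids N la by rewrite imset_f.
pose i0 := enum_rank_in Tt (tabloid la t).
have ei0 : enum_val i0 = tabloid la t by rewrite enum_rankK_in.
apply/matrixP=> i j; rewrite !ord1 {i j} [RHS]mxE.
transitivity ((v *m kappa t) 0 i0); last by rewrite v0 mxE.
rewrite /kappa mulmx_sumr summxE [LHS]mxE.
under eq_bigr => j _.
  rewrite mxE /polytabloid summxE mulr_sumr; over.
rewrite exchange_big /= (reindex_inj invg_inj) /=; apply: eq_big => [c|c _].
  apply/col_stabP/col_stabP=> h b nb0; have := h b nb0.
    by move=> e; rewrite -{1}e permKV.
  by move=> e; rewrite -{1}e permK.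
rewrite -scalemxAr !mxE mulr_sumr; apply: eq_bigr => j _.
rewrite !mxE odd_permV mulrCA; congr (_ * (_ * _%:R)).
rewrite ei0 -(inj_eq (@rcoset_inj _ c)) /=.
by rewrite -rcosetM mulVg rcoset1 eq_sym.
Qed.

End Polytabloids.

(** * The head of a hook Specht module *)

Section SpechtHead.

Variables (K : fieldType) (q r k : nat).
Local Notation N := (q.+1 + r)%N.
Local Notation la := (hook_shape q r).
Local Notation lo := (@lshift q.+1 r).
Local Notation hi := (@rshift q.+1 r).
Local Notation dimT := #|tabloids N la|.
Variables (kn : (k < N)%N) (l : 'I_N).
Hypotheses (kl : (k <= l)%N) (ok : heart_ok K kn l).
Hypotheses (rk : (r <= k)%N) (fact_r : r`!%:R != 0 :> K).
Implicit Types t u g : 'S_N.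
Local Notation coords := (coords K kn).
Local Notation rho := (hook_repr ok r).
Local Notation poly := (polytabloid K la).

Lemma column_mx_ones t : column_mx K t *m ones K N = 0.
Proof.
apply/matrixP=> i j; rewrite mul_onesE mxE; under eq_bigr do rewrite mxE.
rewrite sumrB -2!natr_sum.
have e y : (\sum_(x < N) (x == y) = 1)%N.
  by rewrite (bigD1 y) //= eqxx big1 // => x /negPf->.
by rewrite !e subrr.
Qed.

Lemma column_mx_mul t g : column_mx K (t * g)%g = column_mx K t *m perm_mx g.
Proof.
apply/matrixP=> i x; rewrite [RHS]mxE (bigD1 (g^-1%g x)) //= big1 ?addr0 => [|y nyx].
  rewrite !mxE permKV eqxx mulr1 !permM.
  by rewrite !(can2_eq (permKV g) (permK g)).
by rewrite !mxE (can2_eq (permK g) (permKV g)) (negPf nyx) mulr0.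
Qed.

Lemma exists_tab x (f : 'I_r -> 'I_N) : injective f -> (forall i, f i != x) ->
  exists t, t (lo ord0) = x /\ forall i, t (hi i) = f i.
Proof.
move=> inj_f nfx.
have [|||s []] := @exists_perm_map _ (lo ord0 :: map hi (enum 'I_r)) (x :: map f (enum 'I_r)).
- rewrite /= map_inj_uniq ?enum_uniq ?andbT; last exact: rshift_inj.
  by apply/mapP=> -[i _ /eqP]; rewrite eq_lrshift.
- rewrite /= map_inj_uniq ?enum_uniq ?andbT //.
  by apply/mapP=> -[i _ /eqP]; rewrite eq_sym (negPf (nfx i)).
- by rewrite /= !size_map.
move=> e0; rewrite -map_comp => /eq_in_map es; exists s; split=> // i.
by apply: es; rewrite mem_enum.
Qed.

Lemma exists_pivot_tab (b : 'I_#|{: rset k r}|) : exists t, t (lo ord0) = pivot kn /\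
  forall i, t (hi i) = jn kn (rs (enum_val b) i).
Proof.
apply: exists_tab => [i j /jn_inj/rs_inj //|i]; by rewrite jn_pivot.
Qed.

Definition pivot_tab b := projT1 (boolp.cid (exists_pivot_tab b)).

Lemma pivot_tabE b : pivot_tab b (lo ord0) = pivot kn /\
  forall i, pivot_tab b (hi i) = jn kn (rs (enum_val b) i).
Proof. exact: (projT2 (boolp.cid (exists_pivot_tab b))). Qed.

(** The pairing with the polytabloids of those tableaux that have the pivot in the
corner; in these coordinates it takes polytabloids to exterior products of vectors
of the heart. *)
Definition Phi : 'M[K]_(dimT, #|{: rset k r}|) := \matrix_(j, b) poly (pivot_tab b) 0 j.

Lemma poly_Phi t : poly t *m Phi = r`!%:R *: wedge (column_mx K t *m coords).
Proof.
apply/rowP=> b; rewrite [RHS]mxE mulrC mulr_natr mxE.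
have [e0 ei] := pivot_tabE b.
rewrite [X in X *+ _](_ : _ = \det (column_mx K t *m (column_mx K (pivot_tab b))^T)).
  rewrite -polytabloid_pairing !mxE; apply: eq_bigr => j _.
  by rewrite !mxE.
rewrite mxE; congr (\det _); apply/matrixP=> i j; rewrite !mxE.
by apply: eq_bigr => x _; rewrite !mxE e0 ei.
Qed.

Lemma Phi_hom (v : 'rV[K]_dimT) g : (v <= specht_mx K N la)%MS ->
  v *m perm_module K N la g *m Phi = v *m Phi *m rho g.
Proof.
case/sub_sumsmxP=> w ->; rewrite !mulmx_suml; apply: eq_bigr => t _.
have /submxP[a ->] : (w t *m <<poly t>> <= poly t)%MS.
  by apply: submx_trans (submxMl _ _) _; rewrite genmxE.
rewrite -!mulmxA; congr (_ *m _); rewrite !mulmxA polytabloidM !poly_Phi.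
rewrite column_mx_mul -scalemxAl -wedge_mul; congr (_ *: wedge _).
by rewrite mul_heart_mx // column_mx_ones.
Qed.

(** Polytabloids with l in the corner are mapped to r! times the rows of the exterior
power of the Gram matrix; both factors are invertible. *)
Lemma Phi_full : (1%:M <= specht_mx K N la *m Phi)%MS.
Proof.
have uG : ext r (gram K kn l) \in unitmx.
  case: ok => uG _; have := ext_mul r (gram K kn l) (invmx (gram K kn l)).
  by rewrite mulmxV // ext1 => /esym/mulmx1_unit[].
apply: (@submx_trans _ _ _ _ _ _ (ext r (gram K kn l))).
  by rewrite sub1mx row_full_unit.
apply/row_subP=> a; rewrite row_ext.
have [||t [e0 ei]] := @exists_tab l (fun i => jn kn (rs (enum_val a) i)).
- by move=> i j /jn_inj/rs_inj.
- by move=> i; rewrite jn_l.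
have -> : rowsub (rs (enum_val a)) (gram K kn l) = column_mx K t *m coords.
  apply/matrixP=> i j; rewrite !mxE; apply: eq_bigr => x _.
  by rewrite !mxE e0 ei.
rewrite -[wedge _]scale1r -(mulVf fact_r) -scalerA -poly_Phi scalemx_sub //.
by rewrite submxMr // (sumsmx_sup t) // genmxE.
Qed.

(** James' submodule theorem.  If some kappa t does not kill V, then V contains a
multiple of the polytabloid of t, hence all polytabloids; otherwise V is
orthogonal to all polytabloids. *)
Lemma submod_dichotomy (V : 'M[K]_dimT) : mxmodule (perm_module K N la) V ->
  (specht_mx K N la <= V)%MS \/ V *m Phi = 0.
Proof.
move=> modV.
have [/existsP[t nzt]|all0] := boolP [exists t, V *m kappa K t != 0].
  left; have [i nzi] : exists i, row i V *m kappa K t != 0.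
    apply/existsP; apply: contraNT nzt; rewrite negb_exists => /forallP z.
    by apply/eqP/row_matrixP=> i; rewrite row_mul row0; apply/eqP; have := z i; rewrite negbK.
  have [a ea] := kappa_multiple (row i V) t.
  have nza : a != 0 by apply: contraNneq nzi => a0; rewrite ea a0 scale0r.
  have Vt : (poly t <= V)%MS.
    rewrite -[poly t]scale1r -(mulVf nza) -scalerA -ea scalemx_sub //.
    rewrite /kappa mulmx_sumr summx_sub // => c _; rewrite -scalemxAr scalemx_sub //.
    by apply: submx_trans (submxMr _ (row_sub i V)) (mxmoduleP modV c (in_setT _)).
  apply/sumsmx_subP=> u _; rewrite genmxE -[u](mulKVg t) -polytabloidM.
  by apply: submx_trans (submxMr _ Vt) (mxmoduleP modV _ (in_setT _)).
right; apply/matrixP=> i b; rewrite [RHS]mxE.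
have /(kappa_pairing (v := row i V)) : row i V *m kappa K (pivot_tab b) = 0.
  rewrite -row_mul; have [->|nz] := eqVneq (V *m kappa K (pivot_tab b)) 0; first by rewrite row0.
  by case/existsP: all0; exists (pivot_tab b).
move/matrixP/(_ 0 0); rewrite mxE [RHS]mxE => <-.
by rewrite mxE; apply: eq_bigr => j _; rewrite !mxE.
Qed.

Local Notation sp := (specht K N la).
Local Notation S := (specht_mx K N la).

Definition PhiS := val_submod (1%:M : 'M_(\rank S)) *m Phi.

Lemma PhiS_full : row_full PhiS.
Proof.
rewrite -sub1mx; apply: submx_trans Phi_full _.
by rewrite /PhiS submxMr // val_submod1.
Qed.

Lemma PhiSE m (W : 'M_(m, \rank S)) : W *m PhiS = val_submod W *m Phi.
Proof. by rewrite /PhiS mulmxA -val_submodE. Qed.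

Lemma PhiS_hom g : sp g *m PhiS = PhiS *m rho g.
Proof.
apply/row_matrixP=> i; rewrite (row_mul i (sp g)) (row_mul i PhiS) PhiSE.
have -> : row i (sp g) = row i 1%:M *m sp g by rewrite -(row_mul i 1%:M) mul1mx.
rewrite val_submodJ ?inE // Phi_hom ?val_submodP // -PhiSE.
by rewrite -(row_mul i 1%:M) mul1mx.
Qed.

Lemma kerPhiS_module : mxmodule sp (kermx PhiS).
Proof.
apply/mxmoduleP=> g _; apply/sub_kermxP.
by rewrite -mulmxA PhiS_hom mulmxA mulmx_ker mul0mx.
Qed.

Lemma specht_dichotomy (V : 'M_(\rank S)) : mxmodule sp V ->
  (1%:M <= V)%MS \/ (V <= kermx PhiS)%MS.
Proof.
move=> modV; pose V' : 'M_dimT := <<val_submod V>>%MS.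
have modV' : mxmodule (perm_module K N la) V'.
  rewrite (eqmx_module _ (genmxE _)); apply/mxmoduleP=> g Gg.
  rewrite -(val_submodJ (specht_module K N la)) // val_submodS.
  exact: (mxmoduleP modV).
have [sSV|V0] := submod_dichotomy modV'.
  left; rewrite -val_submodS; apply: submx_trans (_ : S <= _)%MS.
    by rewrite val_submodP.
  by apply: submx_trans sSV _; rewrite genmxE.
right; apply/sub_kermxP; rewrite PhiSE.
have sVV' : (val_submod V <= V')%MS by rewrite genmxE.
by have := submxMr Phi sVV'; rewrite V0; apply: submx0null.
Qed.

Lemma kerPhiS_proper : ~~ (1%:M <= kermx PhiS)%MS.
Proof.
apply/negP=> /sub_kermxP; rewrite mul1mx => e.
have := PhiS_full; rewrite e /row_full mxrank0 card_rset eq_sym -leqn0 leqNgt.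
by rewrite bin_gt0 rk.
Qed.

(** By the dichotomy the kernel is the only maximal submodule. *)
Lemma radical_specht : (radical_mx sp :=: kermx PhiS)%MS.
Proof.
have maxK : max_submod sp (kermx PhiS) 1%:M.
  split=> [|W [modW ltKW ltW1]].
    by rewrite ltmxE submx1 kerPhiS_proper.
  case: (specht_dichotomy modW) => [s1W|sWK].
    by move: ltW1; rewrite ltmxE s1W andbF.
  by move: ltKW; rewrite ltmxE sWK andbF.
apply/eqmxP/andP; split; apply/rV_subP=> v.
  by move/(radical_mxP sp v); apply=> //; apply: kerPhiS_module.
move=> vK; apply/(radical_mxP sp v) => V modV [ltV1 maxV].
case: (specht_dichotomy modV) => [s1V|sVK].
  by move: ltV1; rewrite ltmxE s1V andbF.
apply: contraT => nvV; case: (maxV (kermx PhiS)); split.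
- exact: kerPhiS_module.
- rewrite ltmxE sVK; apply: contra nvV; exact: submx_trans.
- by rewrite ltmxE submx1 kerPhiS_proper.
Qed.

Lemma specht_head_rsim : mx_rsim (specht_head K N la) rho.
Proof.
set R := radical_mx sp.
pose B := val_factmod (1%:M : 'M_(\rank (cokermx R))) *m PhiS.
have BE m (W : 'M_(m, \rank (cokermx R))) : W *m B = val_factmod W *m PhiS.
  by rewrite /B mulmxA -val_factmodE.
have PB m (W : 'M_(m, \rank S)) : in_factmod R W *m B = W *m PhiS.
  rewrite BE -{2}(add_sub_fact_mod R W) mulmxDl -[LHS]add0r; congr (_ + _).
  by apply/esym/sub_kermxP; rewrite -radical_specht val_submodP.
have freeB : row_free B.
  rewrite -kermx_eq0; apply/eqP.
  have /sub_kermxP : (kermx B <= kermx B)%MS by [].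
  move: (kermx B) => W; rewrite BE => /sub_kermxP; rewrite -radical_specht => WR.
  by apply/eqP; rewrite -[W](val_factmodK (U := R)) in_factmod_eq0.
have fullB : row_full B.
  rewrite -sub1mx; apply: submx_trans (_ : PhiS <= _)%MS.
    by rewrite sub1mx PhiS_full.
  by rewrite -[PhiS]mul1mx -PB submxMl.
exists B => // [|g Gg].
  by apply/eqP; rewrite -(eqP freeB) (eqP fullB).
have -> : specht_head K N la g *m B = val_factmod 1%:M *m sp g *m PhiS by apply: PB.
by rewrite -mulmxA PhiS_hom mulmxA.
Qed.

End SpechtHead.

(** * Endomorphisms commuting with a p-element *)

(** A product of endomorphisms that commute with s has trace 0 if s is traceless in
this sense; this is how words fixed by a subgroup containing s are disposed of. *)
Definition traceless (K : fieldType) d (A : 'M[K]_d) : Prop :=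
  forall Y : 'M[K]_d, Y *m A = A *m Y -> \tr Y = 0.

Lemma traceless_conj (K : fieldType) d (A B C : 'M[K]_d) :
  B *m C = 1%:M -> C *m B = 1%:M -> traceless (B *m A *m C) -> traceless A.
Proof.
move=> BC CB tlA Y YA.
rewrite -[Y]mul1mx -CB -mulmxA mxtrace_mulC; apply: tlA.
have -> : B *m Y *m C *m (B *m A *m C) = B *m (Y *m A) *m C.
  by rewrite -!mulmxA (mulmxA C B) CB mul1mx.
by rewrite YA -!mulmxA (mulmxA C B) CB mul1mx.
Qed.

(** A minor with a zero row or a zero column vanishes. *)
Lemma ext_block_support (R : comNzRingType) k r (M : {set 'I_k}) (s : 'S_k)
    (A : 'M[R]_k) (a b : 'I_#|{: rset k r}|) :
    (forall i, (s i \in M) = (i \in M)) ->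
    (forall i j, i \in M -> A i j = (s i == j)%:R) ->
    (forall i j, i \notin M -> j \in M -> A i j = 0) ->
    ext r A a b != 0 ->
  s @: (val (enum_val a) :&: M) = val (enum_val b) :&: M.
Proof.
move=> sM A1 A0; rewrite mxE => nz.
set Ia := enum_val a in nz *; set Jb := enum_val b in nz *.
apply/eqP; rewrite eqEsubset; apply/andP; split; apply/subsetP=> y.
  case/imsetP=> x /setIP[/rs_surj[i <-] Mx] ->; rewrite inE sM Mx andbT.
  apply: contraR nz => nB; rewrite (expand_det_row _ i) big1 // => j _.
  rewrite !mxE A1 //; case: eqP => [e|_]; last by rewrite mul0r.
  by rewrite e mem_rs in nB.
case/setIP=> /rs_surj[j <-] My; apply: contraR nz => nA.
rewrite (expand_det_col _ j) big1 // => i _; rewrite !mxE.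
have [Mi|nMi] := boolP (rs Ia i \in M); last by rewrite A0 ?mul0r.
rewrite A1 //; case: eqP => [e|_]; last by rewrite mul0r.
by case/imsetP: nA; exists (rs Ia i); rewrite // inE mem_rs.
Qed.

(** Group the basis subsets by their intersection C with M; A maps the part that
belongs to C to the part that belongs to s C.  The traces of the compressions of Y
to these parts are constant along the orbits of s, so only the C fixed by s count.
Such a C is a union of orbits of s in M and has at most r < p elements, so it is
empty; but r points do not fit into the complement of M. *)
Lemma traceless_ext_block (K : fieldType) p k r (M : {set 'I_k}) (s : 'S_k) (A : 'M[K]_k) :
    p \in [pchar K] -> p.-elt s ->
    (forall i, (s i \in M) = (i \in M)) -> {in M, forall i, s i != i} ->
    (forall i j, i \in M -> A i j = (s i == j)%:R) ->
    (forall i j, i \notin M -> j \in M -> A i j = 0) ->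
    A \in unitmx -> (#|~: M| < r < p)%N ->
  traceless (ext r A).
Proof.
move=> charKp ps sM sMnfix A1 A0 uA /andP[ltMr ltrp] Y YA.
have p_pr := pcharf_prime charKp.
set Z := ext r A in YA.
pose tr (a : 'I_#|{: rset k r}|) := val (enum_val a) :&: M.
pose Pi (C : {set 'I_k}) : 'M[K]_#|{: rset k r}| := diag_mx (\row_a (tr a == C)%:R).
have [Z' ZZ'] : exists Z', Z *m Z' = 1%:M.
  by exists (ext r (invmx A)); rewrite -ext_mul mulmxV // ext1.
have Z'Z := mulmx1C ZZ'.
have suppZ a b : Z a b != 0 -> s @: tr a = tr b by apply: ext_block_support.
clearbody Z.
have PiZ (C : {set 'I_k}) : Pi C *m Z = Z *m Pi (s @: C).
  apply/matrixP=> a b; rewrite mul_diag_mx mul_mx_diag !mxE.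
  have [z|nz] := eqVneq (Z a b) 0; first by rewrite z mulr0 mul0r.
  by rewrite -(suppZ _ _ nz) mulrC (inj_eq (imset_inj (@perm_inj _ s))).
pose f (C : {set 'I_k}) : K := \tr (Y *m Pi C).
have fs (C : {set 'I_k}) : f (s @: C) = f C.
  rewrite /f; have -> : Pi (s @: C) = Z' *m Pi C *m Z.
    by rewrite -mulmxA PiZ mulmxA Z'Z mul1mx.
  by rewrite !mulmxA mxtrace_mulC !mulmxA -YA -(mulmxA Y) ZZ' mulmx1.
have trY : \tr Y = \sum_(C in [set: {set 'I_k}]) f C.
  rewrite /f -raddf_sum -mulmx_sumr (_ : \sum_(i in _) _ = 1%:M) ?mulmx1 //.
  rewrite -raddf_sum -diag_const_mx; congr diag_mx; apply/rowP=> a.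
  rewrite summxE !mxE (bigD1 (tr a)) ?inE //= mxE eqxx big1 ?addr0 // => C.
  by case/andP=> _ /negPf nC; rewrite mxE eq_sym nC.
have pS : p.-group <[s]>%g by [].
have fsX g : g \in <[s]>%g -> forall C : {set 'I_k}, f (g @: C) = f C.
  case/cycleP=> i ->; elim: i => [|i IHi] C.
    by congr f; rewrite -[RHS]imset_id; apply: eq_imset => x; rewrite perm1.
  rewrite -[RHS]fs -[RHS]IHi -imset_comp; congr f; apply: eq_imset => x.
  by rewrite /= expgS permM.
rewrite trY (@sum_pgroup_fix _ _ ('P^*)%act _ _ _ pS _ _ f).
- rewrite big1 // => C /setIP[_ /afixP fixC].
  have sC : s @: C = C by apply: fixC (cycle_id s).
  rewrite /f (_ : Pi C = 0) ?mulmx0 ?mxtrace0 //.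
  rewrite /Pi (_ : \row_a _ = 0) ?linear0 //; apply/rowP=> a; rewrite !mxE.
  case: eqP => // eC; exfalso.
  have sCM : C \subset M by rewrite -eC subsetIr.
  have leCr : (#|C| <= r)%N.
    by rewrite -(eqP (valP (enum_val a))) -eC subset_leq_card // subsetIl.
  have actC : [acts <[s]>, on C | 'P].
    rewrite cycle_subG inE in_setT inE /=; apply/subsetP=> x Cx.
    by rewrite inE /= /aperm -sC imset_f.
  have := pgroup_fix_mod pS actC.
  rewrite [X in _ = X %[mod p]](_ : _ = 0%N); last first.
    apply/eqP; rewrite cards_eq0 -subset0; apply/subsetP=> x /setIP[Cx /afixP fx].
    have := sMnfix x (subsetP sCM x Cx).
    by have := fx s (cycle_id s); rewrite /= /aperm => ->; rewrite eqxx.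
  rewrite mod0n modn_small ?(leq_ltn_trans leCr) // => /eqP; rewrite cards_eq0 => /eqP C0.
  move: ltMr; rewrite ltnNge -(eqP (valP (enum_val a))); case/negP.
  apply/subset_leq_card/subsetP=> x Ax; rewrite inE; apply/negP=> Mx.
  by have := in_set0 x; rewrite -C0 -eC inE Ax Mx.
- by move=> v; rewrite -mulr_natr (pcharf0 charKp) mulr0.
- by apply/actsP=> g _ C; rewrite !inE.
- by move=> C g _ gS; apply: fsX.
Qed.

(** Here M consists of the points of 'I_k that g moves. *)
Lemma traceless_few_fixed (K : fieldType) p n k r (kn : (k < n)%N) (l : 'I_n)
    (ok : heart_ok K kn l) (g : 'S_n) :
    p \in [pchar K] -> p.-elt g -> (forall x : 'I_n, (k <= x)%N -> g x = x) ->
    (#|[set x : 'I_n | (x < k)%N && (g x == x)]| < r < p)%N ->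
  traceless (ext r (heart_mx K kn l g)).
Proof.
move=> charKp pg fixg ltr.
have [s sE] := restrict_perm kn fixg.
have dE : heart_mx K kn l g = perm_mx s.
  by apply: heart_mx_perm => //; apply: fixg; rewrite /= leqnn.
rewrite dE; apply: (@traceless_ext_block _ p _ _ [set j | s j != j] s) => //.
- have gX i : forall j, (g ^+ i)%g (jn kn j) = jn kn ((s ^+ i)%g j).
    by elim: i => [|i IHi] j; rewrite ?perm1 // !expgS !permM sE IHi.
  have /p_natP[e eg] := pg.
  apply: pnat_dvd pg; rewrite order_dvdn; apply/eqP/permP=> j.
  by apply: (jn_inj (kn := kn)); rewrite -gX expg_order !perm1.
- by move=> i; rewrite !inE (inj_eq perm_inj).
- by move=> i; rewrite inE.
- by move=> i j _; rewrite !mxE.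
- move=> i j; rewrite !inE negbK !mxE => /eqP si nj; rewrite si.
  by case: eqP => // eij; case/eqP: nj; rewrite -eij.
- by rewrite unitmx_perm.
case/andP: ltr => ltr ->; rewrite andbT; apply: leq_ltn_trans ltr.
rewrite -(card_imset _ (jn_inj (kn := kn))); apply/subset_leq_card/subsetP=> x.
case/imsetP=> j; rewrite !inE negbK => /eqP sj ->.
by rewrite /= ltn_ord sE sj eqxx.
Qed.

(** The permutation z has m cycles of length p, and maps the j-th point of the i-th
cycle to the next one.  The pivot and l both lie on the cycle i0. *)
Section SemiRegular.

Variables (K : fieldType) (q k m : nat).
Local Notation p := q.+2.
Local Notation n := k.+2.
Variables (kn : (k < n)%N) (ok : heart_ok K kn ord_max).
Variables (lab : 'I_m -> 'I_p -> 'I_n) (ix : 'I_n -> 'I_m) (jx : 'I_n -> 'I_p).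
Variables (z : 'S_n) (i0 : 'I_m) (j1 j2 : 'I_p).
Hypotheses (charKp : p \in [pchar K]) (nzm : m%:R != 0 :> K).
Hypotheses (ixK : forall i j, ix (lab i j) = i) (jxK : forall i j, jx (lab i j) = j).
Hypothesis labK : forall x, lab (ix x) (jx x) = x.
Hypothesis zlab : forall i j, z (lab i j) = lab i (j + 1).
Hypotheses (labk : lab i0 j1 = pivot kn) (labl : lab i0 j2 = ord_max).
Local Notation jn := (jn kn).
Local Notation coords := (coords K kn).
Local Notation dz := (heart_mx K kn ord_max z).

Lemma sum_lab (f : 'I_n -> K) : \sum_x f x = \sum_i \sum_j f (lab i j).
Proof.
rewrite pair_bigA /= (reindex (fun ij : 'I_m * 'I_p => lab ij.1 ij.2)) //=.
exists (fun x => (ix x, jx x)) => [[i j] _|x _] /=; first by rewrite ixK jxK.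
exact: labK.
Qed.

Lemma lab_eq i j i' j' : (lab i j == lab i' j') = (i == i') && (j == j').
Proof.
apply/eqP/andP=> [e|[/eqP-> /eqP->] //].
by rewrite -(ixK i j) -{2}(jxK i j) e ixK jxK.
Qed.

(** A basis of the heart adapted to z.  A point x on another cycle gives the
difference of x and the point at the same position on the cycle i0; these vectors
are permuted freely by z.  A point at position j on the cycle i0 gives the
difference between the sums over all cycles of the points at positions j and j2;
these span an invariant subspace of dimension p-2. *)
Definition orbit_row (x y : 'I_n) : K :=
  if ix x != i0 then (y == x)%:R - (y == lab i0 (jx x))%:R
  else (jx y == jx x)%:R - (jx y == j2)%:R.
Definition orbit_rows : 'M[K]_(k, n) := \matrix_(x, y) orbit_row (jn x) y.

Lemma sum_eq (I : finType) (i : I) (f : I -> K) : \sum_x f x * (i == x)%:R = f i.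
Proof.
rewrite (bigD1 i) //= eqxx mulr1 big1 ?addr0 // => x /negPf ni.
by rewrite eq_sym ni mulr0.
Qed.

Lemma sum_eq1 (I : finType) (i : I) : \sum_x ((x == i)%:R : K) = 1.
Proof. by rewrite (bigD1 i) //= eqxx big1 ?addr0 // => x /negPf->. Qed.

Lemma orbit_rows_ones : orbit_rows *m ones K n = 0.
Proof.
apply/matrixP=> x j; rewrite mul_onesE [RHS]mxE; under eq_bigr do rewrite mxE.
rewrite /orbit_row; case: (ix (jn x) != i0); first by rewrite sumrB !sum_eq1 subrr.
rewrite sum_lab big1 // => i _; under eq_bigr do rewrite jxK.
by rewrite sumrB !sum_eq1 subrr.
Qed.

Section Coordinates.

Variables (c : 'rV[K]_k) (b : 'I_p -> K).
Hypothesis cW : forall i j, (c *m orbit_rows) 0 (lab i j) = b j.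

Definition cext (y : 'I_n) : K := \sum_x c 0 x * (jn x == y)%:R.

Lemma cext_jn x : cext (jn x) = c 0 x.
Proof.
rewrite /cext (bigD1 x) //= eqxx mulr1 big1 ?addr0 // => x' /negPf nx.
by rewrite (inj_eq (@jn_inj _ _ kn)) nx mulr0.
Qed.

Lemma cext_k : cext (pivot kn) = 0.
Proof. by rewrite /cext big1 // => x _; rewrite jn_pivot mulr0. Qed.

Lemma mul_orbit_rows y : (c *m orbit_rows) 0 y = \sum_x cext x * orbit_row x y.
Proof.
rewrite mxE /cext; under [RHS]eq_bigr do rewrite mulr_suml.
rewrite exchange_big /=; apply: eq_bigr => x _; rewrite mxE.
rewrite (bigD1 (jn x)) //= eqxx mulr1 big1 ?addr0 // => y' /negPf ny.
by rewrite eq_sym ny mulr0 mul0r.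
Qed.

Definition block_sum j : K := \sum_j' cext (lab i0 j') * ((j == j')%:R - (j == j2)%:R).

Lemma cW_split i j : (c *m orbit_rows) 0 (lab i j) =
  \sum_(i' | i' != i0) (cext (lab i' j) * ((i == i')%:R - (i == i0)%:R)) + block_sum j.
Proof.
rewrite mul_orbit_rows sum_lab (bigID (pred1 i0)) /= addrC; congr (_ + _); last first.
  rewrite big_pred1_eq; apply: eq_bigr => j' _.
  by rewrite /orbit_row !ixK !jxK eqxx.
apply: eq_bigr => i' ni'; rewrite (bigD1 j) //= big1 ?addr0 => [|j' nj'].
  by rewrite /orbit_row ixK jxK ni' !lab_eq eqxx !andbT.
by rewrite /orbit_row ixK jxK ni' !lab_eq eq_sym (eq_sym j) (negPf nj') !andbF subrr mulr0.
Qed.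

Lemma coord_moved i j : i != i0 -> cext (lab i j) = b j - block_sum j.
Proof.
move=> ni; rewrite -(cW i j) cW_split addrK (bigD1 i) //= eqxx (negPf ni).
rewrite subr0 mulr1 big1 ?addr0 // => i' /andP[_ /negPf n'].
by rewrite eq_sym n' subrr mulr0.
Qed.

(** Summing over the cycles multiplies the difference by m, which is invertible. *)
Lemma coord_block_sum j : block_sum j = b j.
Proof.
have := cW i0 j; rewrite cW_split.
rewrite (eq_bigr (fun=> block_sum j - b j)) => [|i ni]; last first.
  by rewrite eq_sym (negPf ni) eqxx sub0r mulrN1 coord_moved // opprB.
rewrite sumr_const => e.
have cI : #|[pred i | i != i0]|.+1 = m.
  by have := cardC1 i0; rewrite card_ord => ->; rewrite prednK // (leq_ltn_trans _ (ltn_ord i0)).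
have : (block_sum j - b j) *+ m = 0.
  by rewrite -cI mulrSr addrA e subrr.
by rewrite -mulr_natr => /eqP; rewrite mulf_eq0 (negPf nzm) orbF subr_eq0 => /eqP.
Qed.

Lemma coord_moved0 i j : i != i0 -> cext (lab i j) = 0.
Proof. by move=> ni; rewrite coord_moved // coord_block_sum subrr. Qed.

End Coordinates.

Lemma orbit_rows_free (c : 'rV[K]_k) (a : K) : c *m orbit_rows = const_mx a -> c = 0.
Proof.
move=> e; have cW i j : (c *m orbit_rows) 0 (lab i j) = a by rewrite e mxE.
have S0E := @coord_block_sum c (fun=> a) cW.
have nj : j1 != j2.
  have : pivot kn != ord_max by rewrite -val_eqE /= ltn_eqF.
  by rewrite -labk -labl lab_eq eqxx.
have Ck : cext c (lab i0 j1) = 0 by rewrite labk cext_k.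
have Cl : cext c (lab i0 j2) = 0.
  by rewrite labl /cext big1 // => x _; rewrite jn_l ?mulr0.
have S1 j : block_sum c j = cext c (lab i0 j) - \sum_j' cext c (lab i0 j') * (j == j2)%:R.
  rewrite /block_sum; under eq_bigr do rewrite mulrBr.
  by rewrite sumrB sum_eq.
have a0 : a = 0.
  rewrite -(S0E j1) S1 Ck (negPf nj) big1 ?subrr // => j' _.
  by rewrite mulr0.
apply/rowP=> x; rewrite [RHS]mxE -(cext_jn c) -(labK (jn x)).
have [ei|ni] := eqVneq (ix (jn x)) i0; last exact: (coord_moved0 cW).
rewrite ei; have [->//|nj2] := eqVneq (jx (jn x)) j2.
have := S1 (jx (jn x)); rewrite S0E a0 (negPf nj2) big1 ?subr0 // => j' _.
by rewrite mulr0.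
Qed.

(** The change of basis from [orbit_row] to the standard basis of the heart. *)
Definition orbit_coords : 'M[K]_k := orbit_rows *m coords.

Lemma orbit_coords_unit : orbit_coords \in unitmx.
Proof.
rewrite -row_free_unit -kermx_eq0; apply/eqP/row_matrixP=> i; rewrite row0.
have : row i (kermx orbit_coords) *m orbit_coords = 0 by rewrite -row_mul mulmx_ker row0.
move: (row i _) => c; rewrite /orbit_coords mulmxA => e.
have [|a ea] := (proj2 ok) (c *m orbit_rows) _ e; first by rewrite -mulmxA orbit_rows_ones mulmx0.
exact: orbit_rows_free ea.
Qed.

(** In the adapted basis z is block triangular: it permutes without fixed points the
basis vectors of the first kind, and those of the second kind, which span an invariant
subspace, are fewer than the degree p-1 of the exterior power. *)
Lemma traceless_semiregular : traceless (ext q.+1 dz).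
Proof.
pose B := ext q.+1 orbit_coords; pose B' := ext q.+1 (invmx orbit_coords).
have BB' : B *m B' = 1%:M by rewrite -ext_mul mulmxV ?orbit_coords_unit // ext1.
apply: (traceless_conj BB' (mulmx1C BB')).
rewrite -!ext_mul; set A := orbit_coords *m dz *m invmx orbit_coords.
have AU : A *m orbit_coords = orbit_rows *m perm_mx z *m coords.
  by rewrite /A mulmxKV ?orbit_coords_unit // mul_heart_mx // orbit_rows_ones.
(* The permutation that z induces on the basis vectors of the first kind, extended by
the identity. *)
pose zf x := if ix x == i0 then x else z x.
have zE x : z x = lab (ix x) (jx x + 1) by rewrite -zlab labK.
have ixz x : ix (zf x) = ix x by rewrite /zf; case: ifP => // _; rewrite zE ixK.
have zf_inj : injective zf.
  move=> x y e; have := ixz x; rewrite e ixz => exy; move: e; rewrite /zf exy.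
  by case: ifP => // _ /perm_inj.
pose z' := perm zf_inj.
have z'k (x : 'I_n) : (k <= x)%N -> z' x = x.
  move=> le; rewrite permE /zf; suff -> : ix x == i0 by [].
  have [->|->] : x = lab i0 j1 \/ x = lab i0 j2; rewrite ?ixK //.
  move: le; rewrite leq_eqVlt => /predU1P[e|lt]; [left|right].
    by rewrite labk; apply: val_inj.
  by rewrite labl; apply: val_inj; apply/eqP; rewrite eqn_leq /= lt -ltnS ltn_ord.
have [s sE] := restrict_perm kn z'k.
pose M := [set x : 'I_k | ix (jn x) != i0].
have sM x : x \in M -> jn (s x) = z (jn x).
  by rewrite inE -sE permE /zf => /negPf->.
have AW x (c := row x A *m orbit_rows - row x orbit_rows *m perm_mx z) : exists a, c = const_mx a.
  apply: (proj2 ok).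
    rewrite mulmxBl -!mulmxA perm_ones orbit_rows_ones mulmx0 -row_mul orbit_rows_ones sub0r.
    by apply/matrixP=> a b; rewrite !mxE oppr0.
  rewrite mulmxBl -(mulmxA (row x A)) -/orbit_coords -row_mul AU -2!row_mul; apply: subrr.
have sN x : x \notin M -> s x = x.
  rewrite inE negbK => ei; apply: (jn_inj (kn := kn)).
  by rewrite -sE permE /zf ei.
have ixs x : ix (jn (s x)) = ix (jn x) by rewrite -sE permE ixz.
have zVlab i j : (z^-1)%g (lab i j) = lab i (j - 1).
  by apply: (@perm_inj _ z); rewrite permKV zlab subrK.
have mulP x y : (orbit_rows *m perm_mx z) x y = orbit_row (jn x) ((z^-1)%g y).
  rewrite mxE (bigD1 ((z^-1)%g y)) //= big1 ?addr0 => [|y' ny].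
    by rewrite !mxE permKV eqxx mulr1.
  by rewrite !mxE (can2_eq (permK z) (permKV z)) (negPf ny) mulr0.
apply: (@traceless_ext_block _ p _ _ M s) => //.
- have zX e i j : (z ^+ e)%g (lab i j) = lab i (j + e%:R).
    elim: e => [|e IHe]; first by rewrite perm1 addr0.
    by rewrite expgSr permM IHe zlab -addrA natr1.
  have sX e x : x \in M -> jn ((s ^+ e)%g x) = (z ^+ e)%g (jn x) /\ (s ^+ e)%g x \in M.
    move=> Mx; elim: e => [|e [IH1 IH2]]; first by rewrite !perm1.
    by rewrite !expgSr !permM sM // IH1 inE ixs -[_ != _]inE; move: IH2; rewrite !inE.
  apply: (@pnat_dvd _ p); last by rewrite pnat_id // (pcharf_prime charKp).
  rewrite order_dvdn; apply/eqP/permP=> x; rewrite perm1.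
  have [Mx|nMx] := boolP (x \in M).
    apply: (jn_inj (kn := kn)); rewrite (proj1 (sX p x Mx)) -(labK (jn x)) zX.
    by congr lab; rewrite -[RHS]addr0; congr (_ + _); rewrite Zp_nat; apply: val_inj; rewrite /= modnn.
  by elim: {1}p => [|e IHe]; rewrite ?perm1 // expgS permM sN.
- by move=> x; rewrite !inE ixs.
- move=> x Mx; apply/eqP=> /(congr1 (jx \o jn)); rewrite /= sM // zE jxK => /eqP.
  by rewrite -subr_eq0 addrAC subrr add0r.
- move=> x y Mx.
  suff /rowP/(_ y) : row x A = row (s x) 1%:M by rewrite !mxE.
  apply: (can_inj (mulmxK orbit_coords_unit)); rewrite -!row_mul AU mul1mx /orbit_coords !row_mul.
  congr (_ *m _); apply/rowP=> y'; rewrite -row_mul [LHS]mxE mulP !mxE.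
  have := Mx; rewrite inE /orbit_row ixs => ni; rewrite ni sM //.
  rewrite !(can2_eq (permKV z) (permK z)) zlab.
  by have -> : jx (z (jn x)) = jx (jn x) + 1 by rewrite zE jxK.
- move=> x y; rewrite inE negbK => ei; rewrite inE => ny.
  have [a ea] := AW x.
  have cW i j : (row x A *m orbit_rows) 0 (lab i j) =
      ((j - 1 == jx (jn x))%:R - (j - 1 == j2)%:R) + a.
    have -> : row x A *m orbit_rows = row x orbit_rows *m perm_mx z + const_mx a.
      by rewrite -ea addrC subrK.
    rewrite [LHS]mxE -row_mul [row _ _ _ _]mxE mulP [const_mx _ _ _]mxE zVlab.
    by rewrite /orbit_row ei jxK.
  have := @coord_moved0 _ (fun j => ((j - 1 == jx (jn x))%:R - (j - 1 == j2)%:R) + a) cW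
    (ix (jn y)) (jx (jn y)) ny.
  by rewrite labK cext_jn mxE.
- rewrite !unitmx_mul unitmx_inv orbit_coords_unit andbT /=.
  have : dz *m heart_mx K kn ord_max (z^-1)%g = 1%:M by rewrite -heart_mxM // mulgV heart_mx1.
  by case/mulmx1_unit.
rewrite ltnSn andbT ltnS.
have injx : {in ~: M &, injective (fun x => jx (jn x))}.
  move=> x y; rewrite !inE !negbK => /eqP ex /eqP ey e; apply: (jn_inj (kn := kn)).
  by rewrite -(labK (jn x)) -(labK (jn y)) ex ey e.
rewrite -(card_in_imset injx).
have cq : #|~: [set j1; j2]| = q.
  have nj : j1 != j2.
    have : pivot kn != ord_max by rewrite -val_eqE /= ltn_eqF.
    by rewrite -labk -labl lab_eq eqxx.
  by have := cardsC [set j1; j2]; rewrite cards2 nj card_ord => -[].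
apply: leq_trans (_ : _ <= #|~: [set j1; j2]|)%N _; last by rewrite cq.
apply/subset_leq_card/subsetP=> j /imsetP[x]; rewrite !inE negbK => /eqP ex ->.
rewrite negb_or; apply/andP; split; apply: contraTneq isT => e; exfalso.
  have := jn_pivot kn x; rewrite -labk -e -ex labK eqxx; discriminate.
have : jn x == ord_max by rewrite -labl -e -ex labK.
by rewrite jn_l.
Qed.

End SemiRegular.

Lemma traceless_reprJ (K : fieldType) (gT : finGroupType) d
    (rG : mx_representation K [set: gT] d) (g s : gT) :
  traceless (rG (g ^ s)%g) -> traceless (rG g).
Proof.
rewrite conjgE !repr_mxM ?inE // mulmxA.
by apply: traceless_conj; rewrite -repr_mxM ?inE // ?mulVg ?mulgV repr_mx1.
Qed.

Section Elements.

Variables (K : fieldType) (q k : nat).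
Local Notation p := q.+2.
Local Notation n := k.+2.
Variables (kn : (k < n)%N) (ok : heart_ok K kn ord_max).
Hypothesis charKp : p \in [pchar K].
Local Notation rho := (hook_repr ok q.+1).

(** After conjugation, t fixes the last two points.  Then at most p-2 other fixed
points remain, fewer than the degree p-1 of the exterior power. *)
Lemma traceless_fixed_bound (t : 'S_n) :
  p.-elt t -> (1 < #|[set x | t x == x]| <= p)%N -> traceless (rho t).
Proof.
move=> pt /andP[gt1 lep].
have [a [b [ta tb nab]]] : exists a b, [/\ t a = a, t b = b & a != b].
  case/card_gt1P: gt1 => a [b []]; rewrite !inE => /eqP ta /eqP tb nab.
  by exists a, b.
have kl : pivot kn != ord_max by rewrite -val_eqE /= ltn_eqF.
have [|||s] := @exists_perm_map _ [:: a; b] [:: pivot kn; ord_max]; rewrite //= ?inE ?andbT //.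
move=> -[sa sb]; apply: (@traceless_reprJ _ _ _ rho t s).
have fixE x : ((t ^ s)%g (s x) == s x) = (t x == x).
  by rewrite conjgE !permM permK (inj_eq perm_inj).
have big (x : 'I_n) : (k <= x)%N -> x = pivot kn \/ x = ord_max.
  rewrite leq_eqVlt => /predU1P[e|lt]; [left|right]; apply: val_inj => //=.
  by apply/eqP; rewrite eqn_leq lt -ltnS ltn_ord.
apply: (traceless_few_fixed ok charKp) => [|x le|].
- by rewrite /p_elt orderJ.
- by case: (big x le) => ->; apply/eqP; rewrite -?sa -?sb fixE ?ta ?tb.
rewrite ltnSn andbT ltnS.
have sub2 : [set a; b] \subset [set x | t x == x].
  by apply/subsetP=> x; rewrite !inE => /orP[] /eqP->; rewrite ?ta ?tb.
have cD : (#|[set x | t x == x] :\: [set a; b]| <= q)%N.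
  by rewrite cardsD (setIidPr sub2) cards2 nab leq_subLR.
apply: leq_trans cD; rewrite -(card_imset _ (@perm_inj _ s)).
apply/subset_leq_card/subsetP=> x; rewrite inE => /andP[ltx fx].
apply/imsetP; exists ((s^-1)%g x); last by rewrite permKV.
rewrite !inE -fixE permKV fx andbT negb_or.
apply/andP; split; apply: contraTneq ltx => e.
  by rewrite -[x](permKV s) e sa /= ltnn.
by rewrite -[x](permKV s) e sb /= ltnNge leqnSn.
Qed.

Lemma traceless_fpf m (z : 'S_n) : n = (m * p)%N -> m%:R != 0 :> K ->
  (z ^+ p = 1)%g -> (forall x, z x != x) -> traceless (rho z).
Proof.
move=> nmp nzm zp zfix; have p_pr := pcharf_prime charKp.
have cardp x : #|porbit z x| = p.
  have : (#|porbit z x| %| p)%N.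
    apply: (@dvdn_trans #[z]%g); last by rewrite order_dvdn zp.
    by rewrite porbit.unlock; apply: (dvdn_orbit 'P <[z]> x).
  case/primeP: p_pr => _ dvp /dvp/pred2P[c1|//].
  by have := iter_porbit z x; rewrite c1 /= => e; have := zfix x; rewrite e eqxx.
have zX_inj x (i j : 'I_p) : (z ^+ i)%g x = (z ^+ j)%g x -> i = j.
  have := uniq_traject_porbit z x; rewrite cardp => u e; apply: val_inj.
  apply/eqP; rewrite -(nth_uniq x _ _ u) ?size_traject ?ltn_ord //.
  by rewrite !nth_traject ?ltn_ord //; rewrite !permX in e; apply/eqP.
have partP : partition (porbits z) [set: 'I_n].
  have -> : porbits z = orbit 'P <[z]>%g @: [set: 'I_n].
    by apply/setP=> A; apply/imsetP/imsetP=> -[y _ ->]; exists y; rewrite ?inE ?porbit.unlock.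
  by apply: orbit_partition; apply/actsP=> g _ y; rewrite !inE.
have cP : #|porbits z| = m.
  apply/eqP; rewrite -(eqn_pmul2r (ltn0Sn q.+1)) -nmp -(@card_uniform_partition _ p _ _ _ partP).
    by rewrite cardsT card_ord.
  by move=> A /imsetP[y _ ->].
pose blk (i : 'I_m) : {set 'I_n} := enum_val (cast_ord (esym cP) i).
have /fin_all_exists[rep repE] i : exists y, blk i = porbit z y.
  by have /imsetP[x _ ex] := enum_valP (cast_ord (esym cP) i); exists x.
have /fin_all_exists[ix ixE] x : exists i, blk i = porbit z x.
  have Px : porbit z x \in porbits z by apply: imset_f.
  exists (cast_ord cP (enum_rank_in Px (porbit z x))).
  by rewrite /blk cast_ordK enum_rankK_in.
have blk_inj : injective blk by move=> i j /enum_val_inj/cast_ord_inj.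
pose lab i (j : 'I_p) := (z ^+ j)%g (rep i).
have /fin_all_exists[jx labK] x : exists j, lab (ix x) j = x.
  have : x \in porbit z (rep (ix x)).
    by rewrite -repE ixE porbit_id.
  case/porbitP=> i ex; exists (inord (i %% p)).
  by rewrite /lab inordK ?ltn_pmod // expg_mod // -ex.
have ixK i j : ix (lab i j) = i.
  by apply: blk_inj; rewrite ixE repE porbit_perm.
have jxK i j : jx (lab i j) = j.
  by apply: (@zX_inj (rep i)); have := labK (lab i j); rewrite ixK.
have zlab i j : z (lab i j) = lab i (j + 1).
  by rewrite /lab -[z _]permM -expgSr /= -[(1 %% _)%N]/1%N addn1 expg_mod.
have m_gt0 : (0 < m)%N by case: (m) nmp.
pose i0 := Ordinal m_gt0.
have kl : pivot kn != ord_max by rewrite -val_eqE /= ltn_eqF.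
have n01 : lab i0 0 != lab i0 1.
  by apply/eqP=> e; have := congr1 jx e; rewrite !jxK => /eqP.
have [|||s] := @exists_perm_map _ [:: lab i0 0; lab i0 1] [:: pivot kn; ord_max];
  rewrite //= ?inE ?andbT // => -[sk sl].
apply: (@traceless_reprJ _ _ _ rho z s).
apply: (@traceless_semiregular _ _ _ m kn ok (fun i j => s (lab i j))
  (fun x => ix ((s^-1)%g x)) (fun x => jx ((s^-1)%g x)) _ i0 0 1) => //.
- by move=> i j; rewrite permK ixK.
- by move=> i j; rewrite permK jxK.
- by move=> x; rewrite labK permKV.
- by move=> i j; rewrite conjgE !permM permK zlab.
Qed.

End Elements.

(** * Subgroups of index p in wreath products *)

Lemma pgroup_of_elts (gT : finGroupType) (p : nat) (G : {group gT}) :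
  (forall x, x \in G -> p.-elt x) -> p.-group G.
Proof.
move=> pG; apply/pgroupP=> r r_pr /(Cauchy r_pr)[x Gx ox].
by have := pG x Gx; rewrite /p_elt ox pnatE.
Qed.

Section IndexP.

Variables (gT : finGroupType) (p : nat) (P H : {group gT}).
Hypotheses (p_pr : prime p) (pP : p.-group P) (sHP : H \subset P) (iH : #|P : H| = p).

Lemma index_p_normal : H <| P.
Proof. by apply: (p_maximal_normal pP); apply: p_index_maximal; rewrite ?iH. Qed.

Lemma index_p_quotient_card : #|P / H|%g = p.
Proof. by rewrite card_quotient ?normal_norm ?index_p_normal. Qed.

Lemma index_p_comm x y : x \in P -> y \in P -> [~ x, y]%g \in H.
Proof.
move=> Px Py; suff /subsetP sDH : P^`(1)%g \subset H by rewrite sDH ?mem_commg.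
apply: der1_min; first exact: normal_norm index_p_normal.
by apply/cyclic_abelian/prime_cyclic; rewrite index_p_quotient_card.
Qed.

(** H is normal with quotient of order p, generated by the image of u. *)
Lemma index_p_pow u x : u \in P -> x \in P -> u \notin H ->
  exists2 j, (j < p)%N & (x * u ^+ j)%g \in H.
Proof.
move=> Pu Px nHu; have nHP := normal_norm index_p_normal.
have [Nu Nx] := (subsetP nHP u Pu, subsetP nHP x Px).
have ou : #[coset H u]%g = p.
  have : (#[coset H u]%g %| p)%N.
    by rewrite -index_p_quotient_card order_dvdG ?mem_quotient.
  case/primeP: p_pr => _ dvp /dvp/pred2P[/eqP|//].
  by rewrite order_eq1 => /eqP/(coset_idr Nu); rewrite (negPf nHu).
have cu : (P / H)%g = <[coset H u]>%g.
  by apply/eqP; rewrite eq_sym eqEcard cycle_subG mem_quotient //= index_p_quotient_card -ou.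
have : coset H x^-1%g \in <[coset H u]>%g by rewrite -cu mem_quotient ?groupV.
case/cyclePmin=> j; rewrite ou => ltj ej; exists j => //.
apply: coset_idr; first by rewrite groupM ?groupX.
by rewrite morphM ?groupX // morphX // -ej morphV // mulgV.
Qed.

End IndexP.

Section Shift.

Variables (I T : finType) (q : nat).
Local Notation p := q.+2.
Variable lab : I -> 'I_p -> T.
Hypothesis lab_inj : forall i j i' j', lab i j = lab i' j' -> i = i' /\ j = j'.
Implicit Types (e : {ffun I -> 'I_p}) (s : {perm I}).

(** The points lab i j, for j in 'I_p, form the i-th block.  A map of labels induces a
map of T that fixes the points without label. *)
Definition onlab (f : I -> 'I_p -> T) (x : T) : T :=
  if [pick ij : I * 'I_p | lab ij.1 ij.2 == x] is Some ij then f ij.1 ij.2 else x.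

Lemma onlabE f i j : onlab f (lab i j) = f i j.
Proof.
rewrite /onlab; case: pickP => [[i' j'] /eqP/= /lab_inj[-> ->] //|/(_ (i, j))].
by rewrite eqxx.
Qed.

Lemma onlab_out f x : (forall i j, lab i j != x) -> onlab f x = x.
Proof.
by move=> nx; rewrite /onlab; case: pickP => // -[i j] /=; rewrite (negPf (nx i j)).
Qed.

Lemma labP (Q : T -> Prop) : (forall i j, Q (lab i j)) ->
  (forall x, (forall i j, lab i j != x) -> Q x) -> forall x, Q x.
Proof.
move=> Ql Qo x; case: (pickP [pred ij : I * 'I_p | lab ij.1 ij.2 == x]).
  by move=> [i j] /= /eqP<-.
by move=> nx; apply: Qo => i j; have /negbT := nx (i, j).
Qed.

Lemma onlab_can (f g : I -> 'I_p -> I * 'I_p) :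
    (forall i j, g (f i j).1 (f i j).2 = (i, j)) ->
  cancel (onlab (fun i j => lab (f i j).1 (f i j).2))
         (onlab (fun i j => lab (g i j).1 (g i j).2)).
Proof.
move=> gK; elim/labP=> [i j|x nx]; first by rewrite !onlabE gK.
by rewrite !onlab_out // onlab_out.
Qed.

Lemma sh_inj e : injective (onlab (fun i j => lab i (j + e i))).
Proof.
apply: (can_inj (onlab_can (f := fun i j => (i, j + e i)) (g := fun i j => (i, j - e i)) _)).
by move=> i j /=; rewrite addrK.
Qed.

Lemma bp_inj s : injective (onlab (fun i j => lab (s i) j)).
Proof.
apply: (can_inj (onlab_can (f := fun i j => (s i, j)) (g := fun i j => (s^-1%g i, j)) _)).
by move=> i j /=; rewrite permK.
Qed.

Definition sh e : {perm T} := perm (@sh_inj e).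
Definition bp s : {perm T} := perm (@bp_inj s).

Lemma shE e i j : sh e (lab i j) = lab i (j + e i).
Proof. by rewrite permE onlabE. Qed.

Lemma bpE s i j : bp s (lab i j) = lab (s i) j.
Proof. by rewrite permE onlabE. Qed.

Lemma sh_out e x : (forall i j, lab i j != x) -> sh e x = x.
Proof. by move=> nx; rewrite permE onlab_out. Qed.

Lemma bp_out s x : (forall i j, lab i j != x) -> bp s x = x.
Proof. by move=> nx; rewrite permE onlab_out. Qed.

Lemma shD e e' : sh (e + e') = (sh e * sh e')%g.
Proof.
apply/permP; elim/labP=> [i j|x nx]; rewrite permM; last by rewrite !sh_out.
by rewrite !shE ffunE addrA.
Qed.

Lemma sh0 : sh 0 = 1%g.
Proof.
apply/permP; elim/labP=> [i j|x nx]; rewrite perm1; last by rewrite sh_out.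
by rewrite shE ffunE addr0.
Qed.

Lemma shN e : sh (- e) = ((sh e)^-1)%g.
Proof. by apply: (mulIg (sh e)); rewrite -shD addNr sh0 mulVg. Qed.

Lemma shX e k : (sh e ^+ k)%g = sh (e *+ k).
Proof.
elim: k => [|k IHk]; first by rewrite mulr0n sh0.
by rewrite expgS IHk mulrS shD.
Qed.

Lemma sh_exp e : (sh e ^+ p)%g = 1%g.
Proof.
rewrite shX (_ : e *+ p = 0) ?sh0 //; apply/ffunP=> i; rewrite ffunMnE ffunE.
by apply: val_inj; rewrite Zp_mulrn /= modnMl.
Qed.

Lemma bpM s s' : bp (s * s') = (bp s * bp s')%g.
Proof.
apply/permP; elim/labP=> [i j|x nx]; rewrite permM; last by rewrite !bp_out.
by rewrite !bpE permM.
Qed.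

Lemma bp1 : bp 1 = 1%g.
Proof.
apply/permP; elim/labP=> [i j|x nx]; rewrite perm1; last by rewrite bp_out.
by rewrite bpE perm1.
Qed.

Lemma bpX s k : (bp s ^+ k)%g = bp (s ^+ k).
Proof. by elim: k => [|k IHk]; rewrite ?bp1 // !expgS IHk bpM. Qed.

Lemma shJ e s : (sh e ^ bp s)%g = sh [ffun i => e (s^-1%g i)].
Proof.
apply: (mulgI (bp s)); rewrite -conjgC; apply/permP; elim/labP=> [i j|x nx].
  by rewrite !permM shE !bpE shE ffunE permK.
by rewrite !permM !(sh_out, bp_out).
Qed.

Lemma sh_comm e s : [~ sh e, bp s]%g = sh [ffun i => e (s^-1%g i) - e i].
Proof.
rewrite commgEl shJ -shN -shD; congr sh; apply/ffunP=> i.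
by rewrite !ffunE addrC.
Qed.

Lemma bp_shE s e i j : (bp s * sh e)%g (lab i j) = lab (s i) (j + e (s i)).
Proof. by rewrite permM bpE shE. Qed.

Hypothesis p_pr : prime p.

Definition shifts := [set sh e | e : {ffun I -> 'I_p}].

Lemma shifts_group_set : group_set shifts.
Proof.
apply/group_setP; split=> [|_ _ /imsetP[e _ ->] /imsetP[e' _ ->]].
  by apply/imsetP; exists 0; rewrite ?sh0.
by rewrite -shD imset_f.
Qed.
Canonical shifts_group := Group shifts_group_set.

Lemma shifts_pgroup : p.-group shifts.
Proof.
apply: pgroup_of_elts => _ /imsetP[e _ ->]; apply: (@pnat_dvd _ p).
  by rewrite order_dvdn sh_exp.
by rewrite pnat_id.
Qed.

Definition bperms (R : {set {perm I}}) := bp @: R.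

Lemma bperms_group_set (R : {group {perm I}}) : group_set (bperms R).
Proof.
apply/group_setP; split=> [|_ _ /imsetP[s Rs ->] /imsetP[s' Rs' ->]].
  by apply/imsetP; exists 1%g; rewrite ?bp1 ?group1.
by rewrite -bpM imset_f ?groupM.
Qed.
Canonical bperms_group (R : {group {perm I}}) := Group (bperms_group_set R).

Lemma bperms_pgroup (R : {group {perm I}}) : p.-group R -> p.-group (bperms R).
Proof.
move=> pR; apply: pgroup_of_elts => _ /imsetP[s Rs ->].
have := mem_p_elt pR Rs; apply: pnat_dvd.
by rewrite order_dvdn bpX expg_order bp1.
Qed.

Definition wreath (R : {group {perm I}}) := (shifts <*> bperms R)%G.

Lemma wreath_pgroup (R : {group {perm I}}) : p.-group R -> p.-group (wreath R).
Proof.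
move=> pR; rewrite /wreath /= norm_joinEr.
  by rewrite pgroupM shifts_pgroup bperms_pgroup.
apply/subsetP=> _ /imsetP[s Rs ->]; rewrite inE; apply/subsetP=> _ /imsetP[_ /imsetP[e _ ->] ->].
by rewrite shJ imset_f.
Qed.

Lemma mem_wreath_sh (R : {group {perm I}}) e : sh e \in wreath R.
Proof. by apply/(subsetP (joing_subl _ _))/imset_f. Qed.

Lemma mem_wreath_bp (R : {group {perm I}}) s : s \in R -> bp s \in wreath R.
Proof. by move=> Rs; apply/(subsetP (joing_subr _ _))/imset_f. Qed.

End Shift.

Lemma card_fixed_block (I T : finType) q (lab : I -> 'I_q.+2 -> T)
    (lab_inj : forall i j i' j', lab i j = lab i' j' -> i = i' /\ j = j')
    (t : {perm T}) (i0 : I) :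
    (forall x, exists i j, x = lab i j) ->
    (forall i j, (t (lab i j) == lab i j) = (i == i0)) ->
  #|[set x | t x == x]| = q.+2.
Proof.
move=> surj fixE; rewrite -[RHS]card_ord -(card_imset _ (f := lab i0)).
  apply: eq_card => x; rewrite inE; have [i [j ->]] := surj x; rewrite fixE.
  apply/eqP/imsetP=> [->|[j' _ /lab_inj[]//]]; by exists j.
by move=> j j' /lab_inj[].
Qed.

Section LabelValue.

Variables (I T : finType) (q : nat) (lab : I -> 'I_q.+2 -> T) (V : Type) (v0 : V).
Hypothesis lab_inj : forall i j i' j', lab i j = lab i' j' -> i = i' /\ j = j'.

Definition labval (g : I -> 'I_q.+2 -> V) (x : T) : V :=
  if [pick ij : I * 'I_q.+2 | lab ij.1 ij.2 == x] is Some ij then g ij.1 ij.2 else v0.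

Lemma labvalE g i j : labval g (lab i j) = g i j.
Proof.
rewrite /labval; case: pickP => [[i' j'] /eqP/= /lab_inj[-> ->] //|/(_ (i, j))].
by rewrite eqxx.
Qed.

Lemma labval_out g x : (forall i j, lab i j != x) -> labval g x = v0.
Proof.
by move=> nx; rewrite /labval; case: pickP => // -[i j] /=; rewrite (negPf (nx i j)).
Qed.

End LabelValue.

Lemma exists_labels m p n : (m * p <= n)%N -> exists lab : 'I_m -> 'I_p -> 'I_n,
  forall i j i' j', lab i j = lab i' j' -> i = i' /\ j = j'.
Proof.
move=> le; have le' : (#|{: 'I_m * 'I_p}| <= n)%N by rewrite card_prod !card_ord.
exists (fun i j => widen_ord le' (enum_rank (i, j))) => i j i' j'.
by move=> /(congr1 val) /= /val_inj/enum_rank_inj[-> ->].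
Qed.

Lemma labels_surj m p n (lab : 'I_m -> 'I_p -> 'I_n) :
    (forall i j i' j', lab i j = lab i' j' -> i = i' /\ j = j') ->
  n = (m * p)%N -> forall x, exists i j, x = lab i j.
Proof.
move=> lab_inj nmp x.
have inj : injective (fun ij : 'I_m * 'I_p => lab ij.1 ij.2).
  by move=> [i j] [i' j'] /= /lab_inj[-> ->].
have /codomP[[i j] ->] : x \in codom (fun ij : 'I_m * 'I_p => lab ij.1 ij.2).
  by apply: inj_card_onto => //; rewrite card_prod !card_ord nmp.
by exists i, j.
Qed.

(** The n points form m blocks of p points; lab2 groups the blocks into m' superblocks
of p blocks each, and a extra blocks are left over.  All constructions take place in
the group W generated by the shifts of single blocks and the rotations of
superblocks.
Membership in H is forced for commutators and for p-th powers only, so the elements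
have to be composed of these and of corrections that are known to lie in H. *)
Section SylowElements.

Variables (q m' a : nat).
Local Notation p := q.+2.
Local Notation m := (m' * p + a)%N.
Local Notation n := (m * p)%N.
Hypothesis p_pr : prime p.
Variables (lab : 'I_m -> 'I_p -> 'I_n) (lab2 : 'I_m' -> 'I_p -> 'I_m).
Hypothesis lab_inj : forall i j i' j', lab i j = lab i' j' -> i = i' /\ j = j'.
Hypothesis lab2_inj : forall i j i' j', lab2 i j = lab2 i' j' -> i = i' /\ j = j'.

Local Notation sh2 := (sh lab2_inj).
Local Notation sh := (sh lab_inj).
Local Notation bp := (bp lab_inj).
Local Notation W := (wreath lab_inj (shifts_group lab2_inj)).

Let surj := labels_surj lab_inj (erefl n).

Lemma W_pgroup : p.-group W.
Proof. exact/wreath_pgroup/shifts_pgroup. Qed.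

Lemma sh_fixE (s : {perm 'I_m}) (d : {ffun 'I_m -> 'I_p}) b j : ((bp s * sh d)%g (lab b j) == lab b j) = (s b == b) && (d b == 0).
Proof.
rewrite bp_shE; apply/eqP/andP=> [/lab_inj[sb]|[/eqP sb /eqP db]].
  by rewrite sb => e; rewrite eqxx -(inj_eq (addrI j)) e addr0.
by rewrite sb db addr0.
Qed.

Lemma card_fix (s : {perm 'I_m}) (d : {ffun 'I_m -> 'I_p}) b0 : (forall b, (s b == b) && (d b == 0) = (b == b0)) ->
  (1 < #|[set x | (bp s * sh d)%g x == x]| <= p)%N.
Proof.
move=> h; rewrite (card_fixed_block lab_inj (i0 := b0) surj) ?leqnn // => b j.
by rewrite sh_fixE.
Qed.

Variables (P H : {group 'S_n}).
Hypotheses (pP : p.-group P) (sWP : W \subset P) (sHP : H \subset P) (iH : #|P : H| = p).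

Let Psh e : sh e \in P. Proof. by rewrite (subsetP sWP) ?mem_wreath_sh. Qed.
Let Pbp e : bp (sh2 e) \in P.
Proof. by rewrite (subsetP sWP) ?mem_wreath_bp ?imset_f. Qed.

(** The exponents of the commutator of a block shift with the simultaneous rotation of
all superblocks. *)
Definition diffs (g : 'I_m' -> 'I_p -> 'I_p) : {ffun 'I_m -> 'I_p} :=
  [ffun b => labval lab2 0 (fun i j => g i (j + 1) - g i j) b].

Lemma diffsE g i j : diffs g (lab2 i j) = g i (j + 1) - g i j.
Proof. by rewrite ffunE (labvalE _ lab2_inj). Qed.

Lemma diffs_out g b : (forall i j, lab2 i j != b) -> diffs g b = 0.
Proof. by move=> nb; rewrite ffunE labval_out. Qed.

Lemma diffs_mem g : sh (diffs g) \in H.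
Proof.
pose e : {ffun 'I_m -> 'I_p} := [ffun b => labval lab2 0 g b].
have := index_p_comm p_pr pP sHP iH (Psh e) (Pbp (- [ffun=> 1])).
rewrite sh_comm shN invgK; set d := finfun _; suff -> : d = diffs g by [].
apply/ffunP; apply: (labP (lab := lab2)) => [i j|b nb].
  by rewrite diffsE [LHS]ffunE shE !ffunE !(labvalE _ lab2_inj).
by rewrite diffs_out // [LHS]ffunE sh_out ?subrr.
Qed.

Lemma shD_mem d e : sh d \in H -> sh e \in H -> sh (d + e) \in H.
Proof. by move=> Hd He; rewrite shD groupM. Qed.

Definition base : {ffun 'I_m -> 'I_p} := diffs (fun _ j => j).

Lemma baseE i j : base (lab2 i j) = 1.
Proof. by rewrite diffsE addrAC subrr add0r. Qed.

Lemma base_out b : (forall i j, lab2 i j != b) -> base b = 0.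
Proof. exact: diffs_out. Qed.

(** The exponents are the cyclic differences of a sequence on each superblock.  On a
superblock other than i0 take the sequence 0, 1, ..., p-1, with all differences
equal to 1; on i0 take 0, 0, 1, 0, 1, ..., 0, 1, which has exactly one zero
difference as p is odd. *)
Lemma odd_case_element (i0 : 'I_m') : odd p -> a = 0%N ->
  exists2 t, t \in H & (1 < #|[set x | t x == x]| <= p)%N.
Proof.
move=> oddp a0.
pose g i (j : 'I_p) : 'I_p := if i == i0 then (~~ odd j && (0 < j))%N%:R else j.
exists (sh (diffs g)); first exact: diffs_mem.
have := @card_fix 1%g (diffs g) (lab2 i0 0); rewrite bp1 mul1g; apply=> b.
rewrite perm1 eqxx /=.
have [i [j ->]] := labels_surj lab2_inj (etrans (congr1 (addn _) a0) (addn0 _)) b.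
rewrite diffsE /g; have [->|ni] := eqVneq i i0; last first.
  rewrite addrAC subrr add0r oner_eq0; apply/esym/eqP=> /lab2_inj[e _].
  by rewrite e eqxx in ni.
have -> : (lab2 i0 j == lab2 i0 0) = (j == 0).
  by apply/eqP/eqP=> [/lab2_inj[]|->].
have bool_eq (b1 b2 : bool) : (b1%:R == b2%:R :> 'I_p) = (b1 == b2).
  by case: b1 b2 => [] [] //=; rewrite ?eqxx // ?oner_eq0 // eq_sym oner_eq0.
rewrite subr_eq0 bool_eq -val_eqE /= -[(1 %% _)%N]/1%N addn1.
have := ltn_ord j; rewrite ltnS leq_eqVlt => /predU1P[ej|ltj].
  rewrite ej modnn /= negbK andbT.
  by move: oddp; rewrite /= negbK => ->.
rewrite modn_small ?ltnS //= andbT negbK.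
by case: (nat_of_ord j) => [|k] //=; rewrite andbT negbK; case: (odd k).
Qed.

Lemma lab2P (b : 'I_m) : (exists i j, b = lab2 i j) \/ (forall i j, lab2 i j != b).
Proof. by move: b; apply: (labP (lab := lab2)) => [i j|b nb]; [left; exists i, j | right]. Qed.

Definition delta (b0 : 'I_m) : {ffun 'I_m -> 'I_p} := [ffun b => (b == b0)%:R].
Definition indic (A : {set 'I_m}) : {ffun 'I_m -> 'I_p} := [ffun b => (b \in A)%:R].

Lemma indic_mem (A : {set 'I_m}) : {in A, forall b, sh (delta b) \in H} -> sh (indic A) \in H.
Proof.
move=> HA; have -> : indic A = \sum_(b in A) delta b.
  apply/ffunP=> b; rewrite sum_ffunE ffunE; have [Ab|nAb] := boolP (b \in A).
    rewrite (bigD1 b) //= ffunE eqxx big1 ?addr0 // => c /andP[_ nc].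
    by rewrite ffunE eq_sym (negPf nc).
  rewrite big1 // => c Ac; rewrite ffunE; case: eqP => // e.
  by rewrite e Ac in nAb.
apply: (big_ind (fun d => sh d \in H)); first by rewrite sh0 group1.
  exact: shD_mem.
exact: HA.
Qed.

Lemma fpf_of (d : {ffun 'I_m -> 'I_p}) : sh d \in H -> (forall b, d b != 0) ->
  exists z, [/\ z \in H, (z ^+ p = 1)%g & forall x, z x != x].
Proof.
move=> Hd nd; exists (sh d); split=> //; first exact: sh_exp.
move=> x; have [b [j ->]] := surj x.
by have := sh_fixE 1%g d b j; rewrite bp1 mul1g => ->; rewrite perm1 eqxx nd.
Qed.

Lemma fixed_of (d : {ffun 'I_m -> 'I_p}) b0 : sh d \in H ->
    (forall b, (d b == 0) = (b == b0)) ->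
  exists2 t, t \in H & (1 < #|[set x | t x == x]| <= p)%N.
Proof.
move=> Hd hd; exists (sh d) => //.
have := @card_fix 1%g d b0; rewrite bp1 mul1g; apply=> b.
by rewrite perm1 eqxx hd.
Qed.

(** For p = 2 the exponents of commutators have even sum on each superblock, so a
single zero cannot be reached by them alone.  If the shift of a block of i1 lies in
H, it corrects the parity.  Otherwise the superblock i1 is rotated as well, and then H
can be entered by shifting a block of i1, where there are no fixed points anyway. *)
Lemma two_case_element (i0 i1 : 'I_m') : q = 0%N -> a = 0%N -> i0 != i1 ->
  exists2 t, t \in H & (1 < #|[set x | t x == x]| <= p)%N.
Proof.
move=> q0 a0 n01.
have surj2 := labels_surj lab2_inj (etrans (congr1 (addn _) a0) (addn0 _)).
have two (j : 'I_p) : j = 0 \/ j = 1.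
  move: (ltn_ord j); rewrite [X in (_ < X)%N](_ : _ = 2%N) ?q0 // => lt.
  by case: j lt => [[|[|j]] ltj] // _; [left|right]; apply: val_inj.
have n10 : (1 == 0 :> 'I_p) = false by apply/negbTE/oner_neq0.
have lab2E i j i' j' : (lab2 i j == lab2 i' j') = (i == i') && (j == j').
  by apply/eqP/andP=> [/lab2_inj[-> ->]|[/eqP-> /eqP->]].
have [Hy|nHy] := boolP (sh (delta (lab2 i1 1)) \in H).
  pose g i (j : 'I_p) : 'I_p := if i == i1 then 0 else j.
  apply: (@fixed_of (delta (lab2 i1 1) + diffs g) (lab2 i1 0)).
    by rewrite shD_mem ?diffs_mem.
  move=> b; have [i [j ->]] := surj2 b; rewrite ffunE diffsE ffunE /g !lab2E.
  have [_|ni] := eqVneq i i1; last by rewrite add0r addrAC subrr add0r n10.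
  by case: (two j) => ->; rewrite subrr addr0 /= ?eqxx ?n10 // eq_sym n10 eqxx.
pose s := sh2 (finfun (fun i => (i == i1)%:R)).
have sE i j : s (lab2 i j) = lab2 i (j + (i == i1)%:R) by rewrite shE ffunE.
pose g i (j : 'I_p) : 'I_p := if (i == i0) || (i == i1) then 0 else j.
pose e := delta (lab2 i0 1) + diffs g.
have Px : (bp s * sh e)%g \in P by rewrite groupM ?Pbp ?Psh.
have [k _] := index_p_pow p_pr pP sHP iH (Psh (delta (lab2 i1 1))) Px nHy.
pose w := e + delta (lab2 i1 1) *+ k.
rewrite -mulgA shX -shD -/w => Ht; exists (bp s * sh w)%g => //.
apply: (@card_fix s w (lab2 i0 0)) => b; have [i [j ->]] := surj2 b.
rewrite sE /w ffunE ffunMnE [(delta _ + _) _]ffunE diffsE !(ffunE (fun b => (b == _)%:R)) /g !lab2E.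
have [->|ni1] := eqVneq i i1.
  rewrite [i1 == i0]eq_sym (negPf n01) /= -subr_eq0 addrAC subrr add0r n10.
  by rewrite ?andbF.
rewrite addr0 eqxx /= mul0rn addr0.
have [_|ni0] := eqVneq i i0; last first.
  by rewrite /= eqxx add0r addrAC subrr add0r n10.
rewrite eqxx.
by case: (two j) => ->; rewrite subrr addr0 /= ?eqxx ?n10 // eq_sym n10 eqxx.
Qed.

Lemma one_extra_element (b0 : 'I_m) : (forall b, (forall i j, lab2 i j != b) -> b = b0) ->
    (forall i j, lab2 i j != b0) -> sh (delta b0) \in H ->
  exists z, [/\ z \in H, (z ^+ p = 1)%g & forall x, z x != x].
Proof.
move=> b0P nb0 Hb0; apply: (@fpf_of (base + delta b0)).
  by rewrite shD_mem ?diffs_mem.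
move=> b; rewrite ffunE [delta _ _]ffunE; case: (lab2P b) => [[i [j ->]]|nb].
  by rewrite baseE (negPf (nb0 i j)) addr0 oner_neq0.
by rewrite base_out // (b0P b nb) eqxx add0r oner_neq0.
Qed.

(** If H contains the shifts of all extra blocks but one, then it contains an element
that shifts all blocks but that one.  Otherwise the shifts of two extra blocks b1
and b2 are not in H.  Shift b1 by 1 or by 2 and all other blocks except b2 by 1; a
suitable shift of b2 leads into H.  If that shift of b2 is trivial in both cases, the
shift of b1 by 1 lies in H, a contradiction. *)
Lemma more_extras_element : (2 < p)%N ->
  (exists b : 'I_m, forall i j, lab2 i j != b) ->
  (exists2 t, t \in H & (1 < #|[set x | t x == x]| <= p)%N) \/
  (exists z, [/\ z \in H, (z ^+ p = 1)%g & forall x, z x != x]).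
Proof.
move=> gt2 [bD nbD]; pose D := [set b : 'I_m | [forall i, forall j, lab2 i j != b]].
have DP b : reflect (forall i j, lab2 i j != b) (b \in D).
  rewrite inE; apply: (iffP forallP) => h i; last exact/forallP/h.
  by apply/forallP/h.
have nat_neq0 j : (0 < j < p)%N -> j%:R != 0 :> 'I_p.
  case/andP=> j0 jp; rewrite Zp_nat -val_eqE /= modn_small //.
  by rewrite -lt0n.
have notD i j : lab2 i j \notin D.
  by apply/negP=> /DP/(_ i j); rewrite eqxx.
have [/existsP[b0 /andP[Db0 /forallP h]]|no] :=
    boolP [exists b0 in D, forall b, (b \in D :\ b0) ==> (sh (delta b) \in H)].
  left; apply: (@fixed_of (base + indic (D :\ b0)) b0).
    rewrite shD_mem ?diffs_mem // indic_mem // => b Db.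
    by have := h b; rewrite Db.
  move=> b; rewrite ffunE [indic _ _]ffunE; case: (lab2P b) => [[i [j ->]]|nb].
    rewrite baseE in_setD1 (negPf (notD i j)) andbF addr0 (negPf (oner_neq0 _)).
    by apply/esym/eqP=> e; have := notD i j; rewrite e Db0.
  rewrite base_out // add0r in_setD1 (introT (DP b) nb) andbT.
  by have [_|_] := eqVneq b b0; rewrite /= ?eqxx ?(negPf (oner_neq0 _)).
right.
have pick b0 : b0 \in D -> exists b, [/\ b \in D, b != b0 & sh (delta b) \notin H].
  move=> Db0; move: no; rewrite negb_exists => /forallP/(_ b0); rewrite Db0 /=.
  rewrite negb_forall => /existsP[b]; rewrite negb_imply in_setD1 => /andP[/andP[nb Db] nH].
  by exists b.
have [b1 [Db1 _ nH1]] := pick bD (introT (DP bD) nbD).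
have [b2 [Db2 n21 nH2]] := pick b1 Db1.
(* Exponent k at b1, exponent 0 at b2, and 1 at all other blocks. *)
pose d k := base + indic (D :\ b1 :\ b2) + delta b1 *+ k.
have dE k j b : (d k + delta b2 *+ j) b =
    if b == b1 then k%:R else if b == b2 then j%:R else 1.
  rewrite /d [LHS]ffunE [X in X + _]ffunE [X in X + _ + _]ffunE !ffunMnE.
  rewrite [indic _ _]ffunE ![delta _ _]ffunE; case: (lab2P b) => [[i [l ->]]|nb].
    have [n1 n2] : (lab2 i l == b1) = false /\ (lab2 i l == b2) = false.
      by split; apply/negbTE/eqP=> e; have := notD i l; rewrite e ?Db1 ?Db2.
    by rewrite !in_setD1 (negPf (notD i l)) !andbF n1 n2 !mul0rn !addr0; apply: baseE.
  have -> : diffs (fun _ j => j) b = 0 by apply: diffs_out.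
  rewrite !in_setD1 (introT (DP b) nb) andbT add0r.
  have [->|n1] := eqVneq b b1; first by rewrite eq_sym (negPf n21) andbF mul0rn add0r addr0.
  by have [_|n2] := eqVneq b b2; rewrite ?mul0rn ?add0r ?addr0.
have key k : (0 < k < p)%N -> sh (d k) \in H \/
   exists z, [/\ z \in H, (z ^+ p = 1)%g & forall x, z x != x].
  move=> lk; have [j ltj] := index_p_pow p_pr pP sHP iH (Psh (delta b2)) (Psh (d k)) nH2.
  rewrite shX -shD; case: j ltj => [|j] ltj; first by rewrite mulr0n addr0; left.
  move=> Hz; right; apply: (fpf_of Hz) => b; rewrite dE.
  by case: ifP => _; [apply: nat_neq0 | case: ifP => _; rewrite ?nat_neq0 ?oner_neq0].
have [H1|//] := key 1%N isT; have [H2|//] := key 2%N gt2.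
case/negP: nH1; have -> : delta b1 = d 2%N + - d 1%N.
  by rewrite /d mulr1n mulr2n addrA [X in X - _]addrC addrK.
by rewrite shD_mem // shN groupV.
Qed.

End SylowElements.

Lemma sylow_traceless_elements q m' a n : prime q.+2 ->
    n = ((m' * q.+2 + a) * q.+2)%N -> (a < q.+2)%N -> a != 1%N -> (0 < n)%N ->
    (q, n) <> (0, 4)%N ->
  exists2 P : {group 'S_n}, q.+2.-Sylow([set: 'S_n]) P &
  forall H : {group 'S_n}, H \subset P -> #|P : H| = q.+2 ->
    (exists2 t, t \in H & (1 < #|[set x | t x == x]| <= q.+2)%N) \/
    (~~ (q.+2 %| m' * q.+2 + a)%N /\
     exists z, [/\ z \in H, (z ^+ q.+2 = 1)%g & forall x, z x != x]).
Proof.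
move=> p_pr -> {n} lta na1 n_gt0 n4.
have [lab lab_inj] := exists_labels (leqnn ((m' * q.+2 + a) * q.+2)).
have [lab2 lab2_inj] := exists_labels (leq_addr a (m' * q.+2)).
have [P sylP sWP] := Sylow_superset (subsetT _) (W_pgroup p_pr lab_inj lab2_inj).
exists P => // H sHP iH; have pP := pHall_pgroup sylP.
have [a0|a0] := eqVneq a 0%N.
  left; have lt0 : (0 < m')%N by case: (m') n_gt0; rewrite a0.
  have [oddp|] := boolP (odd q.+2).
    exact: (odd_case_element p_pr pP sWP sHP iH (Ordinal lt0)).
  case: (even_prime p_pr) => [[q0]|-> //] _.
  have lt1 : (1 < m')%N.
    by case: (m') lt0 n4 => [|[|k]] //; rewrite a0 q0.
  by apply: (two_case_element p_pr pP sWP sHP iH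
    (i0 := Ordinal lt0) (i1 := Ordinal lt1)).
have gt2 : (2 < q.+2)%N by case: (q) lta => //; case: (a) a0 na1 => [|[|]].
have [b nb] : exists b, forall i j, lab2 i j != b.
  have lt0 : (0 < a)%N by rewrite lt0n.
  have [b nb] : exists b, b \notin [set lab2 ij.1 ij.2 | ij : 'I_m' * 'I_q.+2].
    apply/existsP; rewrite -negb_forall; apply/negP=> /forallP all.
    have: (#|[set lab2 ij.1 ij.2 | ij : 'I_m' * 'I_q.+2]| <= m' * q.+2)%N.
      by rewrite (leq_trans (leq_imset_card _ _)) // card_prod !card_ord.
    have -> : [set lab2 ij.1 ij.2 | ij : 'I_m' * 'I_q.+2] = setT.
      by apply/setP=> b; rewrite in_setT all.
    by rewrite cardsT card_ord leqNgt -{1}[(m' * _)%N]addn0 ltn_add2l lt0.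
  exists b => i j; apply: contraNneq nb => <-.
  by apply/imsetP; exists (i, j).
have [|t|z] := more_extras_element p_pr pP sWP sHP iH gt2; first by exists b.
  by left.
right; split=> //; rewrite dvdn_addr ?dvdn_mull //.
by apply/negP=> /dvdn_leq; rewrite lt0n a0 leqNgt lta => /(_ isT).
Qed.

(** The cycle al rotates the block that no superblock contains.  Its centraliser
contains the direct product of <[al]> and the symmetric group on the other points,
which has index prime to p since p^2 does not divide n. *)
Lemma sylow_central_cycle q m' n : prime q.+2 -> (0 < m')%N ->
    n = ((m' * q.+2 + 1) * q.+2)%N ->
  exists (P : {group 'S_n}) (al : 'S_n),
  [/\ q.+2.-Sylow([set: 'S_n]) P, al \in P /\ {in P, forall g, commute g al},
      forall x : 'I_n, (q.+2 <= x)%N -> al x = x,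
      forall x : 'I_n, (x < q.+2)%N -> al x = (x.+1 %% q.+2)%N :> nat
    & forall H : {group 'S_n}, H \subset P -> #|P : H| = q.+2 -> al \in H ->
      exists z, [/\ z \in H, (z ^+ q.+2 = 1)%g & forall x, z x != x]].
Proof.
move=> p_pr m'_gt0 -> {n}; set p := q.+2 in p_pr *; set m := (m' * p + 1)%N; set n := (m * p)%N.
have [lab0 lab0_inj] := exists_labels (leqnn (m' * p)).
pose lab2 i j : 'I_m := lshift 1 (lab0 i j).
have lab2_inj i j i' j' : lab2 i j = lab2 i' j' -> i = i' /\ j = j'.
  by move/lshift_inj/lab0_inj.
have lab_lt (b : 'I_m) (j : 'I_p) : (rev_ord b * p + j < n)%N.
  rewrite (@leq_trans (rev_ord b * p + p)%N) ?ltn_add2l // -mulSnr leq_mul2r.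
  by rewrite (ltn_ord (rev_ord b)) orbT.
(* Blocks are counted from the end, so that the extra block b0 consists of the first p
points. *)
pose lab b j : 'I_n := Ordinal (lab_lt b j).
have lab_inj i j i' j' : lab i j = lab i' j' -> i = i' /\ j = j'.
  move/(congr1 val) => /= e.
  have ej : j = j' by apply: val_inj; have := congr1 (modn^~ p) e; rewrite !modnMDl !modn_small.
  split=> //; apply: rev_ord_inj; apply: val_inj => /=; move/eqP: e.
  by rewrite ej eqn_add2r eqn_mul2r /= => /eqP.
pose b0 : 'I_m := rshift (m' * p) ord0.
have b0E : rev_ord b0 = 0%N :> nat by rewrite /= addn0 -/m /m addn1 subnn.
have nb0 i j : lab2 i j != b0 by rewrite /lab2 /b0 eq_lrshift.
have b0P b : (forall i j, lab2 i j != b) -> b = b0.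
  rewrite -[b]splitK; case: (split b) => [x|x] nx /=; last first.
    by rewrite [x]ord1.
  have [i [j e]] := labels_surj lab0_inj (erefl _) x.
  by have := nx i j; rewrite /lab2 -e eqxx.
pose al := sh lab_inj (delta b0).
have surj := labels_surj lab_inj (erefl n).
have alE b j : al (lab b j) = lab b (j + (b == b0)%:R) by rewrite shE ffunE.
have labv b j : lab b j = (rev_ord b * p + j)%N :> nat by [].
have lab_p b j : (lab b j < p)%N = (b == b0).
  apply/idP/eqP=> [|->]; last by rewrite labv b0E add0n ltn_ord.
  move=> lt; apply: rev_ord_inj; apply: val_inj; apply: etrans (esym b0E); move: lt => /=.
  by case: (m - b.+1)%N => // k; rewrite mulSn -addnA ltnNge leq_addr.
have fix_al (x : 'I_n) : (p <= x)%N -> al x = x.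
  have [b [j ->]] := surj x; rewrite leqNgt lab_p alE => /negPf->.
  by rewrite addr0.
have move_al (x : 'I_n) : (x < p)%N -> al x = (x.+1 %% p)%N :> nat.
  have [b [j ->]] := surj x; rewrite lab_p alE => /eqP->.
  by rewrite eqxx !labv b0E !add0n /= -[(1 %% _)%N]/1%N addn1.
pose C := [set x : 'I_n | (p <= x)%N].
pose Y := (<[al]> <*> perm.Sym_group C)%G.
have comm : perm.Sym_group C \subset 'C[al].
  apply/subsetP=> s; rewrite inE => sC; apply/cent1P.
  apply: (@perm_onC _ _ (~: C)) sC _ _.
    apply/subsetP=> x; rewrite inE in_setC inE -ltnNge => nx.
    by rewrite ltnNge; apply: contraNN nx => /fix_al ->.
  by rewrite -setI_eq0 setICr.
have al_p : (al ^+ p)%g = 1%g by apply: sh_exp.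
have moves : al (lab b0 0) != lab b0 0.
  by rewrite alE eqxx add0r; apply/eqP=> /lab_inj[_] /eqP; rewrite oner_eq0.
have ord_al : #[al]%g = p.
  by apply: nt_prime_order => //; apply: contraNneq moves => ->; rewrite perm1.
have cardY : (#|Y| = p * (n - p)`!)%N.
  have lt1p : (1 < p)%N by [].
  have ltpn : (p < n)%N by rewrite /n /m -{1}[p]mul1n ltn_pmul2r // addn1 ltnS muln_gt0 m'_gt0.
  rewrite /Y /= cent_joinEr; last by rewrite (subset_trans comm) // cent_cycle.
  rewrite TI_cardMg.
    rewrite perm.card_Sym -orderE ord_al; congr (_ * _`!)%N.
    have -> : C = ~: [set lab b0 j | j : 'I_p].
      apply/setP=> x; rewrite !inE; have [b [j ->]] := surj x.
      rewrite leqNgt lab_p; congr (~~ _); apply/eqP/imsetP=> [->|[j' _ /lab_inj[]//]].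
      by exists j.
    rewrite cardsCs setCK card_imset ?card_ord // => j j'.
    by case/lab_inj.
  apply: prime_TIg; first by rewrite -orderE ord_al.
  rewrite cycle_subG inE; apply: contraNN moves => /out_perm->//.
  by rewrite inE -ltnNge lab_p.
have iY : ~~ (p %| #|[set: 'S_n] : Y|)%N.
  have : (#|Y| * #|[set: 'S_n] : Y| = n`!)%N.
    rewrite Lagrange ?subsetT // -[n in RHS]card_ord -card_Sym.
    by apply: eq_card => s; rewrite !inE.
  have lepn : (p <= n)%N by rewrite leq_pmull // /m addn1.
  rewrite cardY -(ffact_fact lepn) mulnAC => /eqP.
  rewrite eqn_mul2r (negPf (lt0n_neq0 (fact_gt0 _))) /=.
  have en : n = n.-1.+1 by rewrite prednK // (leq_trans _ lepn).
  rewrite {2}en ffactnS -en /n mulnAC mulnC eqn_pmul2r // -/n => /eqP ->.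
  have -> : n.-1 ^_ q.+1 = (\prod_(i < q.+1) (n.-1 - i))%N by rewrite ffact_prod.
  rewrite Euclid_dvdM // negb_or; apply/andP; split.
    by rewrite /m addn1 -addn1 dvdn_addr ?dvdn_mull // dvdn1.
  rewrite Euclid_dvd_prod //; elim/big_ind: _ => // [b c nb nc|i _]; first by rewrite negb_or nb.
  rewrite -subn1 -subnDA add1n dvdn_subr ?dvdn_mull //; last first.
    by rewrite (leq_trans _ lepn) // ltnW // ltnS.
  by rewrite gtnNdvd // ltnS.
have sWY : wreath lab_inj (shifts_group lab2_inj) \subset Y.
  rewrite join_subG; apply/andP; split; apply/subsetP=> g /imsetP[e].
    move=> _ ->.
    pose e' : {ffun 'I_m -> 'I_p} := [ffun b => if b == b0 then 0 else e b].
    have -> : e = delta b0 *+ e b0 + e'.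
      apply/ffunP=> b; rewrite ffunE ffunMnE !ffunE.
      have [->|_] := eqVneq b b0; first by rewrite addr0 natr_Zp.
      by rewrite mul0rn add0r.
    rewrite shD -shX; apply: groupM; apply/mem_gen/setUP; first by left; apply: mem_cycle.
    right; rewrite inE; apply/subsetP=> x; rewrite !inE; have [b [j ->]] := surj x.
    by rewrite leqNgt lab_p shE ffunE; apply: contraNN => ->; rewrite addr0.
  case/imsetP=> e' _ -> ->; apply: (subsetP (joing_subr _ _)); rewrite inE.
  apply/subsetP=> x; rewrite !inE; have [b [j ->]] := surj x.
  rewrite leqNgt lab_p bpE; apply: contraNN => /eqP->.
  by rewrite sh_out.
have [P sylP sWP] := Sylow_superset sWY (W_pgroup p_pr lab_inj lab2_inj).
have pP := pHall_pgroup sylP; have sPY := pHall_sub sylP.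
exists P, al; split=> //.
- rewrite pHallE subsetT /= (card_Hall sylP) -(Lagrange (subsetT Y)).
  rewrite partnM // [X in (_ == _ * X)%N]part_p'nat ?muln1 //.
  by rewrite p'natE.
- split; first by rewrite (subsetP sWP) ?mem_wreath_sh.
  move=> g Pg; apply/cent1P; move: g Pg; apply/subsetP/(subset_trans sPY).
  by rewrite join_subG comm cycle_subG cent1id.
move=> H sHP iH Ha.
exact: (one_extra_element p_pr pP sWP sHP iH b0P nb0 Ha).
Qed.

(** * The trace obstruction *)

(** E is a projection that absorbs the central element a, and its complement is a
relative trace from the trivial subgroup to <[a]>.  The plain argument is the case
a = 1, E = 1, D = 0. *)
Section TraceObstruction.

Variables (q d : nat).
Local Notation p := q.+2.
Hypothesis p_pr : prime p.
Local Notation red := (map_mx (intr : int -> 'F_p) : 'M[int]_d -> 'M['F_p]_d).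

Variables (gT : finGroupType) (G P : {group gT}) (rG : mx_representation 'F_p G d).
Hypotheses (pP : p.-group P) (sPG : P \subset G).
Variable a : gT.
Hypotheses (Pa : a \in P) (ca : {in P, forall g, commute g a}).
Variables (E : 'M[int]_d) (D : 'M['F_p]_d).
Hypotheses (EE : E *m E = E) (aE : rG a *m red E = red E) (Ea : red E *m rG a = red E).
Hypothesis sumD : \sum_(i < p) rconj rG (a ^+ i)%g D = 1%:M - red E.

Let Ga : a \in G. Proof. exact: subsetP sPG a Pa. Qed.
Let GX i : (a ^+ i)%g \in G. Proof. exact: groupX. Qed.
Let rEE : red E *m red E = red E. Proof. by rewrite -map_mxM EE. Qed.

Let aXE i : rG (a ^+ i)%g *m red E = red E.
Proof.
elim: i => [|i IHi]; first by rewrite repr_mx1 mul1mx.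
by rewrite expgS repr_mxM ?groupX // -mulmxA IHi aE.
Qed.

Let EaX i : red E *m rG (a ^+ i)%g = red E.
Proof.
elim: i => [|i IHi]; first by rewrite repr_mx1 mulmx1.
by rewrite expgS repr_mxM ?groupX // mulmxA Ea IHi.
Qed.

Let EaV i : red E *m rG (a ^+ i)^-1%g = red E.
Proof. by rewrite -{1}(EaX i) -mulmxA -repr_mxM ?groupV // mulgV repr_mx1 mulmx1. Qed.

Let compress i Y : red E *m rconj rG (a ^+ i)%g Y *m red E = red E *m Y *m red E.
Proof. by rewrite /rconj !mulmxA EaV -!mulmxA aXE. Qed.

Let commX Y i : Y *m rG a = rG a *m Y -> rconj rG (a ^+ i)%g Y = Y.
Proof.
move=> cY; apply: rconj_id => //; elim: i => [|i IHi].
  by rewrite repr_mx1 mulmx1 mul1mx.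
by rewrite expgS repr_mxM ?groupX // mulmxA cY -[rG a *m Y *m _]mulmxA IHi mulmxA.
Qed.

Let char_mx (A : 'M['F_p]_d) : A *+ p = 0.
Proof. by rewrite -scaler_nat pchar_Fp_0 // scale0r. Qed.

(** The error term passes through 1 - E; it is a relative trace, of which E sees p
equal summands. *)
Lemma compress_mul Y Z : Y *m rG a = rG a *m Y -> Z *m rG a = rG a *m Z ->
  (red E *m Y *m red E) *m (red E *m Z *m red E) = red E *m (Y *m Z) *m red E.
Proof.
move=> cY cZ; have -> : (red E *m Y *m red E) *m (red E *m Z *m red E) =
    red E *m Y *m red E *m Z *m red E.
  by rewrite !mulmxA -[red E *m Y *m red E *m red E]mulmxA rEE.
apply/eqP; rewrite eq_sym -subr_eq0.
have -> : red E *m (Y *m Z) *m red E - red E *m Y *m red E *m Z *m red E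
   = red E *m (Y *m (1%:M - red E) *m Z) *m red E.
  by rewrite mulmxBr mulmx1 mulmxBl mulmxBr mulmxBl !mulmxA.
rewrite -sumD mulmx_sumr mulmx_suml mulmx_sumr mulmx_suml.
rewrite (eq_bigr (fun=> red E *m (Y *m D *m Z) *m red E)) => [|i _].
  by rewrite sumr_const card_ord char_mx.
by rewrite -[in LHS](commX i cY) -[in LHS](commX i cZ) -!rconj_mul // compress.
Qed.

(** The difference of the two sides is a sum of p equal traces. *)
Lemma mxtrace_compress Y : Y *m rG a = rG a *m Y -> \tr (red E *m Y *m red E) = \tr Y.
Proof.
move=> cY; rewrite mxtrace_mulC mulmxA rEE mxtrace_mulC; apply/esym/eqP.
rewrite -subr_eq0 -{1}[Y]mulmx1 -raddfB /= -mulmxBr -sumD mulmx_sumr raddf_sum.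
rewrite (eq_bigr (fun=> \tr (Y *m D))) => [|i _].
  by rewrite sumr_const card_ord -mulr_natr pchar_Fp_0 ?mulr0.
by rewrite -{1}(commX i cY) -rconj_mul //= mxtrace_rconj.
Qed.

Hypothesis traceless_index : forall H : {group gT}, H \subset P -> #|P : H| = p ->
  a \in H -> exists2 s, s \in H & traceless (rG s).
Hypothesis trE : ~~ ((p ^ 2)%N %| \tr E)%Z.

(** Compressing to E, only the X l with l fixed by a survive, since the others come in
orbits of equal compressions.  If P fixed no coset of Q, then [mxtrace_sq_dvd] would
apply.  Its condition on words holds because a word fixed by H and a, with a outside
of H, is fixed by P, while for a in H the trace of the compressed word is that of a
word commuting with a traceless element. *)
Lemma higman_traceless (Q : {group gT}) : Q \subset G -> higman rG Q G ->
  exists2 g, g \in G & P \subset (Q :^ g)%g.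
Proof.
move=> sQG [X [homX sumX]]; pose L := 'Fix_(rcosets Q G | 'Rs)(<[a]>).
have actR : [acts P, on rcosets Q G | 'Rs].
  by apply: subset_trans sPG (actsRs_rcosets _ _).
have sAP : <[a]> \subset P by rewrite cycle_subG.
have LP l : l \in L -> l \in rcosets Q G /\ X l *m rG a = rG a *m X l.
  case/setIP=> Rl /afixP/(_ a (cycle_id a)); rewrite /= rcosetE => la; split=> //.
  by apply: (@rconj_comm _ _ _ _ rG) => //; rewrite /rconj -homX // la.
have actL : [acts P, on L | 'Rs].
  rewrite actsI // (acts_fix_norm _) //; apply: cents_norm.
  rewrite centsC cycle_subG; apply/centP=> g Pg; exact/commute_sym/ca.
have [noFix|[l Fl]] := set_0Vmem 'Fix_(L | 'Rs)(P); last first.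
  have [/setIP[/rcosetsP[g Gg ->] _]] := setIP Fl.
  by rewrite sub_afixRs_norms; exists g.
case/negP: trE; apply: (@mxtrace_sq_dvd q d p_pr _ P _ 'Rs L
    (fun l => red E *m X l *m red E)) => //.
- move=> g Pg; have Gg := subsetP sPG g Pg.
  have cg h : h \in P -> rG h *m rG a = rG a *m rG h.
    by move=> Ph; rewrite -!repr_mxM ?(subsetP sPG h) // ca.
  exists (red E *m rG g^-1%g *m red E), (red E *m rG g *m red E) => l Ll.
  have [Rl cl] := LP l Ll.
  have cgl : rG g^-1%g *m X l *m rG a = rG a *m (rG g^-1%g *m X l).
    by rewrite -mulmxA cl !mulmxA cg ?groupV.
  have cV : rG g^-1%g *m rG a = rG a *m rG g^-1%g by rewrite cg ?groupV.
  split; rewrite /=.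
    by rewrite rcosetE homX // compress_mul // compress_mul ?cg.
  by rewrite compress_mul ?cV ?cg // -repr_mxM ?groupV // mulgV repr_mx1 compress_mul ?mul1mx ?mulmx1.
- move=> H w sHP iH wL.
  have wLP i : w i \in rcosets Q G /\ X (w i) *m rG a = rG a *m X (w i).
    by apply: LP; have /setIP[] := wL i.
  have wH i h : h \in H -> X (w i) *m rG h = rG h *m X (w i).
    move=> Hh; have Gh := subsetP sPG h (subsetP sHP h Hh).
    apply: (@rconj_comm _ _ _ _ rG) => //; rewrite /rconj -homX //; last by case: (wLP i).
    by have /setIP[_ /afixP/(_ h Hh)] := wL i; rewrite /= rcosetE => ->.
  have [Ha|nHa] := boolP (a \in H); last first.
    have /setP/(_ (w 0)) := noFix; rewrite in_set0 => /negP[].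
    have /setIP[/setIP[Rw Aw] Hw] := wL 0; rewrite !in_setI Rw Aw.
    have HaP : (H * <[a]>)%g = P.
      apply: mulg_normal_maximal => //; rewrite ?cycle_subG //.
        exact: index_p_normal pP sHP iH.
      by apply: p_index_maximal; rewrite ?iH.
    apply/afixP=> g; rewrite -HaP => /mulsgP[h b Hh Ab ->]; rewrite actM.
    by rewrite (afixP Hw h Hh) (afixP Aw b Ab).
  have [s Hs tls] := traceless_index sHP iH Ha.
  have comm_prod (x : gT) : x \in H -> (\prod_i X (w i)) *m rG x = rG x *m (\prod_i X (w i)).
    move=> Hx; elim/big_rec: _ => [|i Y _ IH]; first by rewrite mulmx1 mul1mx.
    by rewrite -[X (w i) * Y]/(X (w i) *m Y) -mulmxA IH mulmxA wH // mulmxA.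
  have -> : \prod_i (red E *m X (w i) *m red E) = red E *m (\prod_i X (w i)) *m red E.
    have prodE (I : Type) (u : seq I) (Y : I -> 'M['F_p]_d) :
        (forall i, Y i *m rG a = rG a *m Y i) ->
        red E *m (\prod_(i <- u) (red E *m Y i *m red E)) =
        red E *m (\prod_(i <- u) Y i) *m red E.
      move=> cY; elim: u => [|i u IH]; first by rewrite !big_nil mulmx1 rEE.
      have cYu : (\prod_(j <- u) Y j) *m rG a = rG a *m (\prod_(j <- u) Y j).
        elim/big_rec: _ => [|j Z _ IHZ]; first by rewrite mulmx1 mul1mx.
        by rewrite -!mulmxE -mulmxA IHZ mulmxA cY -mulmxA.
      rewrite !big_cons -!mulmxE -compress_mul // -IH !mulmxA rEE.
      by rewrite -[_ *m red E *m red E]mulmxA rEE.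
    have wc i : X (w i) *m rG a = rG a *m X (w i) by case: (wLP i).
    rewrite -prodE // big_ord_recl -mulmxE !mulmxA; congr (_ *m _).
    by rewrite rEE.
  by rewrite mxtrace_compress ?comm_prod //; apply: tls; rewrite comm_prod.
rewrite -{1}rEE -{1}[red E]mulmx1 -sumX.
rewrite mulmx_sumr mulmx_suml /L; apply: (sum_pgroup_fix (pgroupS sAP pP)).
- exact: char_mx.
- exact: subset_trans sAP actR.
move=> l _ Rl /cycleP[i ->]; rewrite /= rcosetE homX // ?groupX //.
by rewrite -/(rconj rG _ _) compress.
Qed.

End TraceObstruction.

Section BlockAvoiding.

Variables (k r : nat).

Definition sdiag (R : nzRingType) (w : {set 'I_k} -> R) : 'M[R]_#|{: rset k r}| :=
  diag_mx (\row_a w (val (enum_val a))).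

(** The exterior power of a permutation matrix is monomial: A is mapped to plus or
minus its image under s. *)
Lemma ext_perm_sdiag (R : comNzRingType) (s : 'S_k) (w w' : {set 'I_k} -> R) :
    (forall A : {set 'I_k}, w' (s @: A) = w A) ->
  ext r (perm_mx s) *m sdiag w' = sdiag w *m ext r (perm_mx s).
Proof.
move=> ww'; apply/matrixP=> a b; rewrite mul_diag_mx mul_mx_diag !mxE.
set e := \det _; have [->|nz] := eqVneq e 0; first by rewrite mul0r mulr0.
have := @ext_block_support R k r setT s (perm_mx s) a b.
rewrite !setIT => <- //; first by rewrite ww' mulrC.
- by move=> i; rewrite !in_setT.
- by move=> i j _; rewrite !mxE.
- by move=> i j; rewrite in_setT.
- by rewrite mxE.
Qed.

(** The projection to the r-subsets that avoid the first p points.  For r < p these are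
the r-subsets invariant under a p-cycle on the first p points. *)
Definition avoid_mx (R : nzRingType) p : 'M[R]_#|{: rset k r}| :=
  sdiag (fun A : {set 'I_k} => (A \subset [set x : 'I_k | (p <= x)%N])%:R).

Lemma map_avoid_mx (R S : nzRingType) (f : {rmorphism R -> S}) p :
  map_mx f (avoid_mx R p) = avoid_mx S p.
Proof. by rewrite map_diag_mx; congr diag_mx; apply/rowP=> a; rewrite !mxE rmorph_nat. Qed.

Lemma avoid_mx_idem (R : nzRingType) p : avoid_mx R p *m avoid_mx R p = avoid_mx R p.
Proof.
rewrite /avoid_mx /sdiag mulmx_diag; congr diag_mx; apply/rowP=> a; rewrite !mxE.
by case: (_ \subset _); rewrite ?mulr1 ?mulr0.
Qed.

Lemma mxtrace_avoid (R : nzRingType) p : (p <= k)%N ->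
  \tr (avoid_mx R p) = 'C(k - p, r)%:R.
Proof.
move=> lepk; rewrite mxtrace_diag.
under eq_bigr do rewrite mxE.
rewrite -natr_sum; congr _%:R.
rewrite -(reindex enum_val (P := predT)
  (F := fun A : rset k r => (val A \subset [set x : 'I_k | (p <= x)%N]) : nat)) /=; last first.
  by apply: onW_bij; apply: enum_val_bij.
have -> : (k - p)%N = #|[set x : 'I_k | (p <= x)%N]|.
  have -> : [set x : 'I_k | (p <= x)%N] = ~: [set widen_ord lepk i | i : 'I_p].
    apply/setP=> x; rewrite !inE leqNgt; congr (~~ _).
    apply/idP/imsetP=> [lt|[i _ ->] /=]; last exact: ltn_ord.
    by exists (Ordinal lt) => //; apply: val_inj.
  rewrite cardsCs setCK card_imset ?card_ord // => i j /(congr1 val)/= e.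
  exact: val_inj.
set C := [set x : 'I_k | (p <= x)%N].
transitivity #|[set A : rset k r | val A \subset C]|.
  by rewrite -sum1dep_card [RHS]big_mkcond; apply: eq_bigr => A _; case: (_ \subset _).
rewrite -cards_draws -(card_imset _ val_inj); apply: eq_card => A; rewrite inE.
apply/imsetP/andP=> [[A' sA ->]|[sA cA]]; last by exists (exist _ A cA); rewrite ?inE.
by rewrite (valP A'); rewrite inE in sA.
Qed.

Variables (K : fieldType) (n p : nat) (kn : (k < n)%N) (l : 'I_n) (ok : heart_ok K kn l).
Variable al : 'S_n.
Hypotheses (charKp : p \in [pchar K]) (lepk : (p <= k)%N) (ltrp : (r < p)%N).
Hypothesis al_out : forall x : 'I_n, (p <= x)%N -> al x = x.
Hypothesis al_in : forall x : 'I_n, (x < p)%N -> al x = (x.+1 %% p)%N :> nat.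
Local Notation rho := (hook_repr ok r).

Lemma block_cycle_perm : exists s : 'S_k, [/\ rho al = ext r (perm_mx s),
  forall j : 'I_k, (p <= j)%N -> s j = j
  & forall j : 'I_k, (j < p)%N -> s j = (j.+1 %% p)%N :> nat].
Proof.
have [s sE] : exists s : 'S_k, forall j, al (jn kn j) = jn kn (s j).
  by apply: restrict_perm => x lekx; rewrite al_out // (leq_trans lepk).
exists s; split.
- by rewrite /= (heart_mx_perm ok sE) // al_out.
- by move=> j lej; apply: (jn_inj (kn := kn)); rewrite -sE al_out.
- by move=> j ltj; rewrite -(al_in (x := jn kn j)) // sE.
Qed.

Lemma cycle_avoid : rho al *m avoid_mx K p = avoid_mx K p /\
  avoid_mx K p *m rho al = avoid_mx K p.
Proof.
have [s [-> s_out s_in]] := block_cycle_perm.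
have e : avoid_mx K p *m ext r (perm_mx s) = avoid_mx K p.
  apply/matrixP=> a b; rewrite mul_diag_mx -[RHS]mulr1 !mxE.
  case: subsetP => [sA|_]; last by rewrite !mul0rn ?mul0r.
  rewrite mul1r; have := congr1 (fun M : 'M[K]_#|{: rset k r}| => M a b) (ext1 K r k).
  rewrite !mxE mulr1 => <-; congr (\det _); apply/matrixP=> i j; rewrite !mxE.
  by rewrite s_out //; have := sA _ (mem_rs _ i); rewrite inE.
split=> //; rewrite -[RHS]e; apply: ext_perm_sdiag => A; congr (_%:R : K); congr nat_of_bool.
apply/subsetP/subsetP=> sA x.
  move=> Ax; have : s x \in [set x : 'I_k | (p <= x)%N] by apply: sA; apply: imset_f.
  rewrite !in_set; have [ltx|//] := ltnP x p.
  by rewrite s_in // leqNgt ltn_mod (leq_ltn_trans _ ltx).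
by case/imsetP=> y /sA; rewrite inE => ley ->; rewrite s_out // inE.
Qed.

Lemma cycle_trace_avoid : exists D : 'M[K]_#|{: rset k r}|,
  \sum_(i < p) rconj rho (al ^+ i)%g D = 1%:M - avoid_mx K p.
Proof.
have [s [rs s_out s_in]] := block_cycle_perm.
have k_gt0 : (0 < k)%N by apply: leq_trans lepk; apply: prime_gt0 (pcharf_prime charKp).
pose z := Ordinal k_gt0; pose B := [set x : 'I_k | (x < p)%N].
(* Of the p rotations of a set A that meets B in c points, exactly c contain the point 0,
so the weights of these rotations add up to 1 if c > 0; and 0 < c < p is invertible. *)
pose w (A : {set 'I_k}) : K := (z \in A)%:R / #|A :&: B|%:R.
exists (sdiag w).
have rX i : rho (al ^+ i)%g = ext r (perm_mx (s ^+ i)%g).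
  elim: i => [|i IHi]; first by rewrite !expg0 repr_mx1 perm_mx1 ext1.
  by rewrite !expgS repr_mxM ?inE // IHi rs -ext_mul perm_mxM.
have sXz (i : nat) : (i < p)%N -> (s ^+ i)%g z = i :> nat.
  elim: i => [|i IHi] lti; first by rewrite perm1.
  by rewrite expgSr permM s_in IHi ?modn_small // ltnW.
have sXB i (A : {set 'I_k}) : #|((s ^+ i)%g @: A) :&: B| = #|A :&: B|.
  elim: i => [|i IHi].
    by rewrite (eq_imset (g := id)) ?imset_id // => x; rewrite perm1.
  have -> : (s ^+ i.+1)%g @: A = s @: ((s ^+ i)%g @: A).
    by rewrite -imset_comp; apply: eq_imset => x; rewrite /= expgSr permM.
  have fixB : s @: B = B.
    apply/eqP; rewrite eqEcard card_imset ?leqnn ?andbT; last exact: perm_inj.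
    apply/subsetP=> y /imsetP[x]; rewrite inE => lex ->; rewrite inE s_in //.
    by rewrite ltn_mod (leq_ltn_trans _ lex).
  rewrite -[in LHS]fixB -imsetI; last by move=> x y _ _; apply: perm_inj.
  by rewrite card_imset //; apply: perm_inj.
have rconjE i : rconj rho (al ^+ i)%g (sdiag w) =
    sdiag (fun A : {set 'I_k} => w ((s ^+ i)^-1%g @: A)).
  rewrite /rconj rX -mulmxA -(@ext_perm_sdiag _ _ _ (fun A : {set 'I_k} => w ((s ^+ i)^-1%g @: A))).
    by rewrite -rX mulmxA -repr_mxM ?inE // mulVg repr_mx1 mul1mx.
  move=> A; congr w; rewrite -imset_comp (eq_imset (g := id)) ?imset_id // => x.
  by rewrite /= permK.
under eq_bigr do rewrite rconjE.
rewrite /avoid_mx /sdiag -raddf_sum.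
rewrite -diag_const_mx -raddfB; congr diag_mx; apply/rowP=> a.
rewrite summxE [RHS]mxE [in RHS]mxE [X in _ + X]mxE [X in _ - X]mxE; set A := val _.
have cA : #|A| = r by apply/eqP/(valP (enum_val a)).
have wE (i : 'I_p) : w ((s ^+ i)^-1%g @: A) = (widen_ord lepk i \in A)%:R / #|A :&: B|%:R.
  rewrite /w; have eA : (s ^+ i)%g @: ((s ^+ i)^-1%g @: A) = A.
    by rewrite -imset_comp (eq_imset (g := id)) ?imset_id // => x; rewrite /= permKV.
  rewrite -[in #|A :&: B|]eA sXB; congr (_%:R / _); congr nat_of_bool.
  rewrite -[in RHS]eA -[widen_ord _ _](_ : (s ^+ i)%g z = _).
    by rewrite mem_imset //; apply: perm_inj.
  by apply: val_inj; rewrite /= sXz.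
under eq_bigr => i _ do rewrite mxE wE.
rewrite -mulr_suml -natr_sum.
have -> : (\sum_(i < p) (widen_ord lepk i \in A) = #|A :&: B|)%N.
  transitivity #|[set i : 'I_p | widen_ord lepk i \in A]|.
    by rewrite -sum1dep_card [RHS]big_mkcond; apply: eq_bigr => i _; case: (_ \in _).
  have winj : injective (widen_ord lepk) by move=> i j /(congr1 val)/= e; apply: val_inj.
  rewrite -(card_imset _ winj); apply: eq_card => x; rewrite !inE.
  apply/imsetP/andP=> [[i iA ->]|[Ax lt]]; first by rewrite inE in iA; rewrite iA /= ltn_ord.
  have e : x = widen_ord lepk (Ordinal lt) by apply: val_inj.
  by exists (Ordinal lt); rewrite // inE -e.
have lt : (#|A :&: B| < p)%N by rewrite (leq_ltn_trans _ ltrp) // -cA subset_leq_card // subsetIl.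
have AB : (A \subset [set x : 'I_k | (p <= x)%N]) = (A :&: B == set0).
  have -> : [set x : 'I_k | (p <= x)%N] = ~: B.
    by apply/setP=> x; rewrite !inE leqNgt.
  by rewrite setI_eq0 disjoints_subset.
rewrite AB -cards_eq0; have [->|nz] := eqVneq #|A :&: B| 0%N; first by rewrite mul0r subrr.
rewrite subr0 divff // -(dvdn_pcharf charKp) gtnNdvd // lt0n; exact: nz.
Qed.

End BlockAvoiding.

(** The prime field of F as the structure map of F as an algebra over it. *)
Lemma Fp_rmorphism (F : fieldType) p (charFp : p \in [pchar F]) : {rmorphism 'F_p -> F}.
Proof.
pose R := pPrimeCharType charFp.
pose f : {rmorphism 'F_p -> R} := GRing.in_alg R.
exact: (f : {rmorphism 'F_p -> F}).
Qed.

(** In the falling factorial (mu p - 2) ... (mu p - p) only the last factor, p (mu - 1),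
is divisible by p. *)
Lemma sq_ndvd_bin q mu : prime q.+2 -> (1 < mu)%N -> ~~ (q.+2 %| mu - 1)%N ->
  ~~ (q.+2 ^ 2 %| 'C(mu * q.+2 - 2, q.+1))%N.
Proof.
move=> p_pr mu1 nd; set N := (mu * q.+2 - 2)%N.
have leN : (q.+2 <= mu * q.+2)%N by rewrite leq_pmull // ltnW.
have e : ('C(N, q.+1) * q.+1`! = N ^_ q * ((mu - 1) * q.+2))%N.
  by rewrite bin_ffact ffactnSr /N -subnDA add2n mulnBl mul1n.
apply/negP=> d; have : (q.+2 ^ 2 %| N ^_ q * ((mu - 1) * q.+2))%N by rewrite -e dvdn_mulr.
rewrite mulnA expnS expn1 dvdn_pmul2r // Euclid_dvdM // (negPf nd) orbF ffact_prod.
apply/negP; rewrite Euclid_dvd_prod //; elim/big_ind: _ => // [b c nb nc|i _].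
  by rewrite negb_or nb.
have lti : (2 + i < q.+2)%N by rewrite add2n !ltnS.
by rewrite /N -subnDA dvdn_subr ?dvdn_mull ?(gtnNdvd _ lti) ?(leq_trans (ltnW lti) leN).
Qed.

Section TopExterior.

Variables (q k : nat).
Local Notation p := q.+2.
Local Notation n := k.+2.
Hypothesis p_pr : prime p.
Variables (kn : (k < n)%N) (ok : heart_ok 'F_p kn ord_max).
Hypotheses (dvd_pn : (p %| n)%N) (neq_np : n <> p) (neq_n4 : (q, n) <> (0, 4)%N).
Local Notation rho := (hook_repr ok q.+1).

Let charFp : p \in [pchar 'F_p]. Proof. exact: pchar_Fp. Qed.

(** With n = mu p, the dimension 'C(mu p - 2, p - 1) is divisible by p^2 exactly when
mu is 1 modulo p; only then a nontrivial central element a is taken. *)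
Lemma sylow_in_vertex_Fp : exists2 P : {group 'S_n}, p.-Sylow([set: 'S_n]) P &
  forall Q : {group 'S_n}, higman rho Q [set: 'S_n]%G ->
    exists2 g, g \in [set: 'S_n] & P \subset (Q :^ g)%g.
Proof.
case/dvdnP: (dvd_pn) => mu nE.
have mu1 : (1 < mu)%N.
  by case: (mu) nE => [//|[/esym|//]] e; rewrite mul1n in e; case: neq_np.
have kE : (k = mu * p - 2)%N by rewrite -nE subn2.
have divE := divn_eq mu p; set m' := (mu %/ p)%N in divE; set a := (mu %% p)%N in divE.
have lta : (a < p)%N by rewrite ltn_mod.
have nE' : n = ((m' * p + a) * p)%N by rewrite -divE.
have traceless_t (t : 'S_n) (P : {group 'S_n}) : p.-group P -> t \in P ->
    (1 < #|[set x | t x == x]| <= p)%N -> traceless (rho t).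
  by move=> pP Pt; apply: (traceless_fixed_bound charFp (mem_p_elt pP Pt)).
have traceless_z (z : 'S_n) : ~~ (p %| mu)%N -> (z ^+ p)%g = 1%g ->
    (forall x, z x != x) -> traceless (rho z).
  move=> nd; apply: (traceless_fpf charFp nE).
  by rewrite -(dvdn_pcharf charFp).
have [a1|na1] := eqVneq a 1%N; last first.
  have [P sylP Pel] := sylow_traceless_elements p_pr nE' lta na1 (ltn0Sn _) neq_n4.
  have pP := pHall_pgroup sylP.
  exists P => // Q hQ.
  apply: (@higman_traceless q _ p_pr _ [set: 'S_n]%G P rho pP (subsetT _) 1%g (group1 _)
    _ 1%:M 0 _ _ _ _ _ _ Q (subsetT _) hQ).
  - by move=> g _; apply: commute1.
  - by rewrite mul1mx.
  - by rewrite map_mx1 repr_mx1 mul1mx.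
  - by rewrite map_mx1 repr_mx1 mul1mx.
  - rewrite map_mx1 subrr big1 // => i _; rewrite /rconj mulmx0 mul0mx //.
  - move=> H sHP iH _; case: (Pel H sHP iH) => [[t Ht ft]|[nd [z [Hz zp fz]]]].
      by exists t => //; apply: traceless_t pP _ ft; apply: (subsetP sHP).
    by exists z => //; apply: traceless_z; rewrite // divE.
  rewrite mxtrace1 card_rset natz dvdzE /= kE sq_ndvd_bin //.
  apply: contra na1 => d; rewrite /a -(subnK (ltnW mu1)).
  by case/dvdnP: d => c ->; rewrite modnMDl modn_small.
have m'0 : (0 < m')%N.
  by rewrite lt0n; apply: contraTneq mu1 => m0; rewrite divE m0 a1.
rewrite a1 in nE'.
have [P [al [sylP [Pal cal] al_out al_in Pel]]] := sylow_central_cycle p_pr m'0 nE'.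
have pP := pHall_pgroup sylP.
have mu2 : (2 < mu)%N by rewrite divE a1 addn1 ltnS (@leq_trans (1 * p)) // leq_mul2r m'0 orbT.
have lepk : (p <= k)%N.
  rewrite -2!ltnS nE -[q.+4]addn2 (@leq_trans (2 * p)%N) //.
    by rewrite mul2n -addnn leq_add2l.
  by rewrite leq_mul2r (ltnW mu2) orbT.
have [D sumD] := cycle_trace_avoid ok charFp lepk (leqnn _ : (q.+1 < p)%N) al_out al_in.
have [alE Eal] := cycle_avoid q.+1 ok lepk al_out al_in.
exists P => // Q hQ.
apply: (@higman_traceless q _ p_pr _ [set: 'S_n]%G P rho pP (subsetT _) al Pal
    cal (avoid_mx k q.+1 _ p) D _ _ _ _ _ _ Q (subsetT _) hQ).
- exact: avoid_mx_idem.
- by rewrite map_avoid_mx.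
- by rewrite map_avoid_mx.
- by rewrite map_avoid_mx.
- move=> H sHP iH Ha; have [z [Hz zp fz]] := Pel H sHP iH Ha.
  exists z => //; apply: traceless_z => //.
  by rewrite divE a1 dvdn_addr ?dvdn_mull // dvdn1.
rewrite mxtrace_avoid // natz dvdzE /=.
have -> : (k - p = (mu - 1) * p - 2)%N by rewrite kE mulnBl mul1n subnAC.
apply: sq_ndvd_bin => //; first by rewrite ltn_subRL.
by rewrite divE a1 addnK dvdn_subr ?dvdn_mull ?dvdn1 // muln_gt0 m'0.
Qed.

End TopExterior.

Lemma sylow_in_vertex_top (F : fieldType) q k (kn : (k < k.+2)%N)
    (ok : heart_ok F kn ord_max) :
    q.+2 \in [pchar F] -> (q.+2 %| k.+2)%N -> k.+2 <> q.+2 -> (q, k.+2) <> (0, 4)%N ->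
  exists2 P : {group 'S_k.+2}, q.+2.-Sylow([set: 'S_k.+2]) P &
  forall Q : {group 'S_k.+2}, higman (hook_repr ok q.+1) Q [set: 'S_k.+2]%G ->
    exists2 g, g \in [set: 'S_k.+2] & P \subset (Q :^ g)%g.
Proof.
move=> charFp dvd_pn neq_np neq_n4; have p_pr := pcharf_prime charFp.
have okp : heart_ok 'F_q.+2 kn ord_max.
  by apply: heart_ok_dvd; apply/eqP; rewrite -(dvdn_pcharf (pchar_Fp p_pr)).
have [P sylP lowP] := sylow_in_vertex_Fp p_pr okp dvd_pn neq_np neq_n4.
exists P => // Q hQ; apply: lowP; pose f := Fp_rmorphism charFp.
apply: (higman_descent (f := f)); first exact: subsetT.
apply: higman_rsim hQ; first exact: subsetT.
apply: (@MxReprSim _ _ _ _ _ _ _ 1%:M) => //; first by rewrite row_free_unit unitmx1.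
move=> g _; rewrite mul1mx mulmx1.
rewrite -[map_repr _ _ _]/(map_mx f (ext q.+1 (heart_mx 'F_q.+2 kn ord_max g))).
by rewrite map_ext map_heart_mx.
Qed.

(** * The Young subgroup and the stabiliser of a point *)

Section PointStabiliser.

Variables (F : fieldType) (k r : nat).
Local Notation n := k.+1.
Hypothesis lerk : (r <= k)%N.
Variables (kn : (k < n)%N) (ok : heart_ok F kn (Ordinal kn)).
Local Notation rho := (hook_repr ok r).
Local Notation z := (Ordinal kn : 'I_n).
Local Notation K := 'C_([set: 'S_n])[z | 'P]%G.
Local Notation jA A := (jn kn @: A).

(** The r largest points below the last one; the second factor of the Young subgroup
permutes them. *)
Definition top_set : {set 'I_n} := [set j : 'I_n | (k - r <= j < k)%N].

Let KP (x : 'S_n) : reflect (x z = z) (x \in K).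
Proof. by rewrite in_setI in_setT; apply: (iffP astab1P). Qed.

Let hookY : hook_young n r = (perm.Sym_group [set i : 'I_n | (i < k - r)%N] <*>
  perm.Sym_group top_set)%G.
Proof. by rewrite /hook_young /top_set subSn // subn1 /= subn1. Qed.

Lemma sub_point_stab : hook_young n r \subset K.
Proof.
rewrite hookY join_subG; apply/andP; split; apply/subsetP=> s; rewrite inE => sC; apply/KP.
  by apply: out_perm sC _; rewrite inE /= -leqNgt leq_subr.
by apply: out_perm sC _; rewrite inE /= ltnn andbF.
Qed.

Lemma mem_hook_young (x : 'S_n) : x \in K -> (x \in hook_young n r) = (x @: top_set == top_set).
Proof.
move=> /KP xz; rewrite hookY; apply/idP/eqP=> [Yx|xT].
  have : hook_young n r \subset 'N(top_set | 'P).
    rewrite hookY join_subG; apply/andP; split; apply/subsetP=> s; rewrite inE => sC.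
      rewrite !inE /=; apply/subsetP=> i Ti; rewrite inE /= /aperm (out_perm sC) //.
      by move: Ti; rewrite !inE -leqNgt => /andP[].
    by rewrite !inE /=; apply/subsetP=> i Ti; rewrite inE /= /aperm perm_closed.
  rewrite hookY => /subsetP/(_ x Yx)/astabs_setact.
  by rewrite /setact => {2}<-.
have Nx : x \in 'N(top_set | 'P).
  by rewrite !inE /=; apply/subsetP=> i Ti; rewrite inE /= /aperm -xT imset_f.
rewrite -(mulgKV (restr_perm top_set x) x); apply: groupM.
  apply/mem_gen/setUP; left; rewrite inE; apply/subsetP=> i; rewrite inE.
  apply: contraR; rewrite -?leqNgt => lei; rewrite permM.
  have [Ti|nTi] := boolP (i \in top_set); first by rewrite -(restr_permE Nx Ti) permK.
  have -> : i = z.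
    apply: val_inj; apply/eqP; rewrite eqn_leq -ltnS ltn_ord leqNgt.
    by move: nTi; rewrite inE lei.
  have rz : restr_perm top_set x z = z.
    by apply: out_perm (restr_perm_on top_set x) _; rewrite inE /= ltnn andbF.
  by apply/eqP; rewrite xz -[in LHS]rz permK.
by apply/mem_gen/setUP; right; rewrite inE restr_perm_on.
Qed.

(** The stabiliser of the last point acts on the exterior power by monomial matrices,
so conjugation permutes the entries of diagonal matrices. *)
Lemma rconj_sdiag (w : {set 'I_n} -> F) (x : 'S_n) : x \in K ->
  rconj rho x (sdiag r (fun A : {set 'I_k} => w (jA A))) =
  sdiag r (fun A : {set 'I_k} => w (x^-1%g @: jA A)).
Proof.
move=> /KP xz; have [s sE] : exists s : 'S_k, forall j, x (jn kn j) = jn kn (s j).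
  apply: restrict_perm => y ley; have -> // : y = z.
  by apply: val_inj; apply/eqP; rewrite eqn_leq ley -ltnS ltn_ord.
have rs : rho x = ext r (perm_mx s) by rewrite /= (heart_mx_perm ok sE).
have e : rho x *m sdiag r (fun A : {set 'I_k} => w (x^-1%g @: jA A)) =
    sdiag r (fun A : {set 'I_k} => w (jA A)) *m rho x.
  rewrite rs; apply: ext_perm_sdiag => A; congr w; rewrite -!imset_comp.
  by apply: eq_imset => j; rewrite /= -sE permK.
by rewrite /rconj -mulmxA -e mulmxA -repr_mxM ?inE // mulVg repr_mx1 mul1mx.
Qed.

Let card_top : #|top_set| = r.
Proof.
have lt (i : 'I_r) : (k - r + i < n)%N.
  by rewrite ltnS -[X in (_ <= X)%N](subnK lerk) leq_add2l ltnW.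
rewrite -[RHS]card_ord -(card_imset _ (f := fun i => Ordinal (lt i))); last first.
  by move=> i j /(congr1 val)/= /addnI/val_inj.
apply: eq_card => y; rewrite inE; apply/andP/imsetP=> [[ley lty]|[i _ ->] /=].
  have lti : (y - (k - r) < r)%N by rewrite ltn_subLR // subnK.
  by exists (Ordinal lti) => //; apply: val_inj; rewrite /= subnKC.
by split; [apply: leq_addr|rewrite -[X in (_ < X)%N](subnK lerk) ltn_add2l].
Qed.

Definition top_unit : 'M[F]_#|{: rset k r}| :=
  sdiag r (fun A : {set 'I_k} => (jA A == top_set)%:R).

Lemma rconj_top_unit (x : 'S_n) : x \in K -> rconj rho x top_unit =
  sdiag r (fun A : {set 'I_k} => (jA A == x @: top_set)%:R).
Proof.
move=> Kx; rewrite (rconj_sdiag (fun B => (B == top_set)%:R) Kx).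
congr diag_mx; apply/rowP=> a; rewrite !mxE; congr (_%:R); congr nat_of_bool.
rewrite -(inj_eq (imset_inj (@perm_inj _ x))) -imset_comp.
by rewrite (eq_imset (g := id)) ?imset_id // => i; rewrite /= permKV.
Qed.

Lemma mxtrace_top_unit : \tr top_unit = 1.
Proof.
rewrite mxtrace_diag; under eq_bigr do rewrite mxE.
(* The basis subset that corresponds to [top_set]. *)
pose A0 : {set 'I_k} := [set j : 'I_k | (k - r <= j)%N].
have jA0 : jA A0 = top_set.
  apply/setP=> y; rewrite inE; apply/imsetP/andP=> [[j]|[ley lty]].
    by rewrite inE => lej ->; rewrite /= lej ltn_ord.
  by exists (Ordinal lty); [rewrite inE | apply: val_inj].
have cA0 : #|A0| == r by rewrite -(card_imset _ (@jn_inj _ _ kn)) jA0 card_top.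
rewrite (bigD1 (enum_rank (exist _ A0 cA0 : rset k r))) //= enum_rankK /= jA0 eqxx.
rewrite big1 ?addr0 // => a na; rewrite -jA0 (inj_eq (imset_inj (@jn_inj _ _ kn))).
case: eqP => // e; case/eqP: na; apply: enum_val_inj; rewrite enum_rankK.
exact: val_inj.
Qed.

Lemma top_transitive (B : {set 'I_n}) : #|B| = r -> z \notin B ->
  exists2 x : 'S_n, x \in K & x @: top_set = B.
Proof.
move=> cB nzB; have [|||s] := @exists_perm_map _ (z :: enum top_set) (z :: enum B).
- by rewrite /= enum_uniq andbT mem_enum inE /= ltnn andbF.
- by rewrite /= enum_uniq andbT mem_enum.
- by rewrite /= -!cardE cB card_top.
case=> sz sE; exists s; first exact/KP.
apply/setP=> y; rewrite -[y \in B]mem_enum -sE.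
apply/imsetP/mapP=> [[x Tx ->]|[x]]; first by exists x; rewrite ?mem_enum.
by rewrite mem_enum => Tx ->; exists x.
Qed.

Hypothesis nzn : n%:R != 0 :> F.

(** The conjugates of [top_unit] under the stabiliser of the last point are the
projections to the basis vectors, one for each coset of the Young subgroup; and the
index n of that stabiliser is invertible. *)
Lemma higman_hook_young : higman rho (hook_young n r) [set: 'S_n]%G.
Proof.
apply: (higman_trans sub_point_stab (subsetT _)); last first.
  apply: higman_index; rewrite ?subsetIl //.
  rewrite -card_orbit (_ : orbit _ _ _ = setT) ?cardsT ?card_ord //.
  apply/setP=> y; rewrite in_setT; apply/orbitP; exists (tperm z y); first by rewrite inE.
  by rewrite /= /aperm tpermL.
apply: (@rconj_family _ _ _ _ rho _ _ top_unit sub_point_stab (subsetT _)).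
  move=> x Yx; have Kx := subsetP sub_point_stab x Yx.
  by rewrite rconj_top_unit // (eqP (_ : x @: top_set == top_set)) // -mem_hook_young.
have KG := subsetT K.
have reprK (l : {set 'S_n}) : l \in rcosets (hook_young n r) K -> repr l \in K /\ l = hook_young n r :* repr l.
  case/rcosetsP=> x Kx ->; have /rcosetP[y Yy ->] := mem_repr_rcoset (hook_young n r) x.
  split; first by rewrite groupM // (subsetP sub_point_stab).
  by rewrite rcosetM (rcoset_id Yy).
rewrite (eq_bigr (fun l : {set 'S_n} => sdiag r (fun A : {set 'I_k} =>
  (jA A == repr l @: top_set)%:R))) => [|l /reprK[Kl _]]; last exact: rconj_top_unit.
rewrite -raddf_sum -diag_const_mx; congr diag_mx; apply/rowP=> a.
rewrite summxE mxE; set A := jA (val (enum_val a)).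
under eq_bigr do rewrite mxE -/A.
have cA : #|A| = r.
  rewrite /A card_imset; last exact: jn_inj.
  exact/eqP/(valP (enum_val a)).
have nzA : z \notin A.
  by apply/negP=> /imsetP[j _ /eqP]; rewrite eq_sym (jn_pivot kn).
have [x Kx xA] := top_transitive cA nzA.
have lx : hook_young n r :* x \in rcosets (hook_young n r) K by apply/rcosetsP; exists x.
have same (l : {set 'S_n}) : l \in rcosets (hook_young n r) K ->
    (A == repr l @: top_set) = (l == hook_young n r :* x).
  case/reprK=> Ku el; set u := repr l in Ku el *; rewrite el -xA.
  have -> : (hook_young n r :* u == hook_young n r :* x) = (u \in hook_young n r :* x).
    by apply/eqP/idP=> [<-|/rcoset_eqP //]; apply: rcoset_refl.
  rewrite mem_rcoset mem_hook_young ?groupM ?groupV // eq_sym.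
  rewrite -[in RHS](inj_eq (imset_inj (@perm_inj _ x))) -imset_comp.
  by congr (_ == _); apply: eq_imset => i; rewrite /= permM permKV.
rewrite (bigD1 _ lx) /= same // eqxx big1 ?addr0 // => l /andP[Rl nl].
by rewrite same // (negPf nl).
Qed.

(** The basis vector of [top_set] spans a line that the Young subgroup preserves. *)
Lemma hook_young_in_vertex p (P Q : {group 'S_n}) : p \in [pchar F] ->
    p.-group P -> P \subset hook_young n r -> higman rho Q [set: 'S_n]%G ->
  exists2 g, g \in [set: 'S_n] & P \subset (Q :^ g)%g.
Proof.
move=> charFp pP sPY hQ.
apply: (higman_fixed charFp pP (subsetT _) (subsetT _) hQ (D := top_unit)).
  move=> x Px; have Yx := subsetP sPY x Px; have Kx := subsetP sub_point_stab x Yx.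
  by rewrite rconj_top_unit // (eqP (_ : x @: top_set == top_set)) // -mem_hook_young.
by rewrite mxtrace_top_unit oner_neq0.
Qed.

End PointStabiliser.

(** * The Klein four-group *)

(** The factors of the falling factorial of n - 2 lie strictly between n - p and n. *)
Lemma ndvd_bin p n r : prime p -> (p %| n)%N -> (0 < n)%N -> (r.+1 < p)%N ->
  ~~ (p %| 'C(n - 2, r))%N.
Proof.
move=> p_pr dvd_pn n_gt0 ltr; have lepn := dvdn_leq n_gt0 dvd_pn.
have nd : ~~ (p %| (n - 2) ^_ r)%N.
  rewrite ffact_prod Euclid_dvd_prod //; elim/big_ind: _ => // [b c nb nc|i _].
    by rewrite negb_or nb.
  have lti : (2 + i < p)%N by rewrite (leq_trans _ ltr) // add2n !ltnS.
  by rewrite -subnDA dvdn_subr // ?(gtnNdvd _ lti) ?(leq_trans (ltnW lti) lepn).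
by apply: contra nd => d; rewrite -bin_ffact dvdn_mulr.
Qed.

Section KleinFour.

Local Notation o i := (@inord 3 i).
Local Notation a := (tperm (o 0) (o 1) * tperm (o 2) (o 3))%g.

Definition double_transpositions : {set 'S_4} :=
  [set s : 'S_4 | [forall x, s (s x) == x] && ((s == 1%g) || [forall x, s x != x])].
Local Notation B := double_transpositions.

Let BP (s : 'S_4) : s \in B -> (forall x, s (s x) = x) /\ (s = 1%g \/ forall x, s x != x).
Proof.
rewrite inE => /andP[/forallP ss s1]; split=> [x|]; first exact/eqP.
by case/orP: s1 => [/eqP|/forallP]; [left | right].
Qed.

Let fourth (x y z u v : 'I_4) : uniq [:: x; y; z; u] -> v \notin [:: x; y; z] -> v = u.
Proof.
move=> U nv; apply/eqP; apply: contraTT nv => nvu; rewrite negbK.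
have /subset_leqif_card : [set i in [:: x; y; z; u]] \subset [set: 'I_4] by apply: subsetT.
rewrite cardsE (card_uniqP U) cardsT card_ord => -[_ /esym/subsetP/(_ v)].
by rewrite !inE (negPf nvu) orbF => /(_ isT).
Qed.

(** On four points, an involution without fixed points is determined by the image of
one point: the other two points have to be exchanged. *)
Lemma double_transposition_inj (s t : 'S_4) x : s \in B -> t \in B -> s x = t x -> s = t.
Proof.
move=> /BP[ss s1] /BP[tt t1] e; have [sx|nsx] := eqVneq (s x) x.
  case: s1 => [->|/(_ x)]; last by rewrite sx eqxx.
  by case: t1 => [->|/(_ x)]; last by rewrite -e sx eqxx.
case: s1 => [e1|s1]; first by rewrite e1 perm1 eqxx in nsx.
case: t1 => [e1|t1]; first by rewrite e e1 perm1 eqxx in nsx.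
apply/permP=> z; have [->//|nzx] := eqVneq z x.
have [->|nzy] := eqVneq z (s x); first by rewrite ss e tt.
have nt : t z \notin [:: x; s x; z].
  rewrite !inE !negb_or t1 andbT; apply/andP; split.
    by apply: contraNneq nzy => tz; rewrite e -tz tt.
  by rewrite e (inj_eq perm_inj).
apply/esym/(fourth _ nt); rewrite /= !inE !negb_or.
rewrite [x == s x]eq_sym nsx [x == z]eq_sym nzx [s x == z]eq_sym nzy.
rewrite [s x == s z]eq_sym (inj_eq perm_inj) nzx [z == _]eq_sym s1 !andbT /=.
by rewrite eq_sym; apply: contraNneq nzy => sz; rewrite -sz ss.
Qed.

Lemma double_transpositions_group_set : group_set B.
Proof.
apply/group_setP; split=> [|s t Bs Bt].
  by rewrite inE eqxx andbT; apply/forallP=> x; rewrite !perm1.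
have [[ss s1] [tt t1]] := (BP Bs, BP Bt).
case: s1 => [->|s1]; first by rewrite mul1g.
case: t1 => [->|t1]; first by rewrite mulg1.
have [->|nst] := eqVneq s t.
  have -> : (t * t)%g = 1%g by apply/permP=> x; rewrite permM tt perm1.
  by rewrite inE eqxx andbT; apply/forallP=> x; rewrite !perm1.
have nstx x : s x != t x by apply: contraNneq nst => /(double_transposition_inj Bs Bt)->.
have comm x : t (s x) = s (t x).
  have n1 : x != s x by rewrite eq_sym.
  have n2 : x != t x by rewrite eq_sym.
  have n3 : x != s (t x) by apply: contraNneq (nstx x) => e; rewrite {1}e ss.
  have n5 : s x != s (t x) by rewrite (inj_eq perm_inj).
  have n6 : t x != s (t x) by rewrite eq_sym.
  apply: (@fourth x (s x) (t x)).
    by rewrite /= !inE !negb_or n1 n2 n3 nstx n5 n6.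
  rewrite !inE !negb_or t1 (inj_eq perm_inj) s1 !andbT.
  by apply: contraNneq (nstx x) => e; rewrite -{2}e tt.
rewrite inE; apply/andP; split.
  by apply/forallP=> x; rewrite !permM -comm ss tt.
apply/orP; right; apply/forallP=> x; rewrite permM.
by apply: contraNneq (nstx x) => e; rewrite -[s x]tt e.
Qed.
Canonical klein_four := Group double_transpositions_group_set.

Lemma klein_four_normal : klein_four <| [set: 'S_4].
Proof.
rewrite /normal subsetT /=; apply/subsetP=> g _; rewrite inE; apply/subsetP=> _ /imsetP[s Bs ->].
have [ss s1] := BP Bs; rewrite inE; apply/andP; split.
  by apply/forallP=> x; rewrite conjgE !permM permK ss permKV.
case: s1 => [->|s1]; first by rewrite conj1g eqxx.
apply/orP; right; apply/forallP=> x; rewrite conjgE !permM.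
by rewrite -{2}[x](permKV g) (inj_eq perm_inj).
Qed.

Let o_val (x : 'I_4) : [\/ x = o 0, x = o 1, x = o 2 | x = o 3].
Proof.
by case: x => [[|[|[|[|x]]]] lt] //; [constructor 1|constructor 2|constructor 3|constructor 4];
  apply: val_inj; rewrite /= inordK.
Qed.

Let o_inj i j : (i < 4)%N -> (j < 4)%N -> (o i == o j) = (i == j).
Proof. by move=> li lj; rewrite -val_eqE /= !inordK. Qed.

Lemma double_transpositionE : [/\ a (o 0) = o 1, a (o 1) = o 0, a (o 2) = o 3 & a (o 3) = o 2].
Proof.
have D i j k : (i < 4)%N -> (j < 4)%N -> (k < 4)%N -> k != i -> k != j -> tperm (o i) (o j) (o k) = o k.
  by move=> li lj lk nki nkj; rewrite tpermD // o_inj // eq_sym.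
split; rewrite permM; [by rewrite tpermL D | by rewrite tpermR D | |].
  by rewrite (D 0 1 2)%N ?tpermL.
by rewrite (D 0 1 3)%N ?tpermR.
Qed.

Lemma klein_four_gen : a \in B.
Proof.
case: double_transpositionE => a0 a1 a2 a3; rewrite inE; apply/andP; split.
  by apply/forallP=> x; case: (o_val x) => ->; rewrite ?a0 ?a1 ?a2 ?a3 ?a0 ?a1 ?a2 ?a3.
apply/orP; right; apply/forallP=> x.
by case: (o_val x) => ->; rewrite ?a0 ?a1 ?a2 ?a3 o_inj.
Qed.

Lemma klein_four_conj (y : 'I_4) : y != o 0 -> exists g : 'S_4, (a ^ g)%g (o 0) = y.
Proof.
move=> ny; have [|||g /= [g0 g1]] := @exists_perm_map _ [:: o 0; o 1] [:: o 0; y] => //.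
- by rewrite /= !inE o_inj.
- by rewrite /= !inE eq_sym ny.
have gV : (g^-1)%g (o 0) = o 0 by rewrite -{1}g0 permK.
by exists g; rewrite conjgE permM [(a * g)%g _]permM gV; case: double_transpositionE => -> _ _ _.
Qed.

Lemma klein_four_elt (s : 'S_4) : s \in B -> s = 1%g \/ exists g, s = (a ^ g)%g.
Proof.
move=> Bs; have [s0|ns0] := eqVneq (s (o 0)) (o 0).
  by left; apply: (double_transposition_inj (x := o 0) Bs (group1 klein_four)); rewrite perm1 s0.
right; have [g gE] := klein_four_conj ns0; exists g.
apply: (double_transposition_inj Bs _ (esym gE)).
by rewrite memJ_norm ?klein_four_gen // (subsetP (normal_norm klein_four_normal)) ?inE.
Qed.

Lemma card_klein_four : #|klein_four| = 4.
Proof.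
have inj : {in B &, injective (fun s : 'S_4 => s (o 0))}.
  by move=> s t Bs Bt; apply: double_transposition_inj.
rewrite -(card_in_imset inj) -[RHS]card_ord; apply: eq_card => y; rewrite [RHS]inE.
apply/imsetP; have [->|ny] := eqVneq y (o 0).
  by exists 1%g; rewrite ?perm1 //; apply: (group1 klein_four).
have [g gE] := klein_four_conj ny; exists (a ^ g)%g => //.
by rewrite memJ_norm ?klein_four_gen // (subsetP (normal_norm klein_four_normal)) ?inE.
Qed.

Let o_neq i j : (i < 4)%N -> (j < 4)%N -> i != j -> o i != o j.
Proof. by move=> li lj; rewrite o_inj. Qed.

Lemma klein_four_even : klein_four \subset 'Alt_('I_4).
Proof.
apply/subsetP=> s /klein_four_elt[->|[g ->]]; first exact: group1.
by rewrite Alt_even odd_permJ odd_permM !odd_tperm !o_neq.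
Qed.

Lemma sylow_klein_four : 2.-Sylow('Alt_('I_4)) klein_four.
Proof.
rewrite pHallE klein_four_even card_klein_four /=.
have := @card_Alt 'I_4; rewrite card_ord => /(_ isT) e.
have -> : #|'Alt_('I_4)| = 12 by apply: double_inj; rewrite -mul2n e.
by rewrite p_part.
Qed.

End KleinFour.

Section DegreeFour.

Variables (F : fieldType) (kn : (2 < 4)%N) (ok : heart_ok F kn ord_max).
Hypothesis char2 : 2 \in [pchar F].
Local Notation rho := (hook_repr ok 1).
Local Notation o i := (@inord 3 i).
Local Notation a := (tperm (o 0) (o 1) * tperm (o 2) (o 3))%g.
Local Notation t := (tperm (o 0) (o 1) : 'S_4).

(** In characteristic 2 the images of e_0 - e_3 and e_1 - e_3 under a double
transposition differ from these vectors by constant vectors. *)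
Lemma klein_four_acts_trivially (s : 'S_4) : s \in klein_four -> rho s = 1%:M.
Proof.
have ra : rho a = 1%:M.
  have [a0 a1 a2 a3] := double_transpositionE.
  rewrite /= -[RHS]ext1; congr ext; apply/matrixP=> i j.
  have jnE (j' : 'I_2) : jn kn j' = o j' by apply: val_inj; rewrite /= inordK // (leq_trans (ltn_ord j')).
  have kE : pivot kn = o 2 by apply: val_inj; rewrite /= inordK.
  have oE i' j' : (i' < 4)%N -> (j' < 4)%N -> (o i' == o j') = (i' == j').
    by move=> li lj; rewrite -val_eqE /= !inordK.
  have oM i' : (i' < 4)%N -> (o i' == ord_max) = (i' == 3).
    by move=> li; rewrite -val_eqE /= inordK.
  rewrite /heart_mx gramE // [ord_max == _]eq_sym kE oM // scale0r addr0 invmx1 mul1mx mul_coordsE.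
  rewrite -[a]invgK -col_permE !mxE !jnE kE.
  have aV : (a^-1)%g = a.
    apply/permP=> x; apply: (@perm_inj _ a); rewrite permKV.
    by have := klein_four_gen; rewrite inE => /andP[/forallP/(_ x)/eqP].
  rewrite aV.
  have two : 1 + 1 = 0 :> F by rewrite -(pcharf0 char2).
  have N1 : - 1 = 1 :> F by apply/eqP; rewrite eq_sym -subr_eq0 opprK two.
  case: i => [[|[|i]] lti] //; case: j => [[|[|j]] ltj] //=;
    rewrite ?a0 ?a1 ?a2 ?a3 ?oE ?oM //= ?subr0 ?sub0r ?opprK ?N1 ?two //.
case/klein_four_elt=> [->|[g ->]]; first by rewrite repr_mx1.
rewrite conjgE repr_mxM ?inE // (repr_mxM rho (in_setT a) (in_setT g)) ra mul1mx.
by rewrite -repr_mxM ?inE // mulVg repr_mx1.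
Qed.

Lemma klein_four_in_vertex (Q : {group 'S_4}) : higman rho Q [set: 'S_4]%G ->
  exists2 g, g \in [set: 'S_4] & klein_four \subset (Q :^ g)%g.
Proof.
move=> hQ; have pos : (0 < #|{: rset 2 1}|)%N by rewrite card_rset.
pose i := Ordinal pos; apply: (higman_fixed char2 _ (subsetT _) (subsetT _) hQ (D := delta_mx i i)).
- by rewrite /pgroup card_klein_four.
- move=> x Vx; rewrite /rconj !klein_four_acts_trivially ?groupV //.
  by rewrite mul1mx mulmx1.
rewrite /mxtrace (bigD1 i) //= mxE !eqxx big1 ?addr0 ?oner_neq0 // => j /negPf nj.
by rewrite mxE nj.
Qed.

(** The Klein four-group and a transposition t generate a subgroup of odd index 3, in
which the Klein four-group has index 2.  As t swaps the two basis vectors, the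
projection th to the first one has relative trace 1. *)
Lemma higman_klein_four : higman rho klein_four [set: 'S_4]%G.
Proof.
have tV : t \notin klein_four.
  apply/negP=> /(subsetP klein_four_even).
  by rewrite Alt_even odd_tperm -val_eqE /= !inordK.
pose D := (klein_four <*> <[t]>)%G.
have VnD : klein_four \subset D by apply: joing_subl.
have tt : (t * t)%g = 1%g by apply: tperm2.
have DE : D :=: (klein_four * <[t]>)%g.
  apply: norm_joinEr; apply: subset_trans (normal_norm klein_four_normal).
  exact: subsetT.
have cosets : rcosets klein_four D = [set (klein_four : {set _}); klein_four :* t].
  apply/setP=> l; rewrite !inE; apply/rcosetsP/orP=> [[x]|].
    rewrite DE => /mulsgP[v y Vv /cycleP[i ->] ->] ->.
    rewrite rcosetM (rcoset_id Vv) -(odd_double_half i) expgD -mul2n expgM expgS expg1 tt expg1n mulg1.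
    by case: (odd i); rewrite ?expg1 ?expg0 ?rcoset1 eqxx; [right | left].
  case=> /eqP->; first by exists 1%g; rewrite ?rcoset1 ?group1.
  by exists t => //; apply/(subsetP (joing_subr _ _))/cycle_id.
have neq : (klein_four : {set 'S_4}) != klein_four :* t.
  by apply: contra tV => /eqP e; rewrite e rcoset_refl.
apply: (higman_trans VnD (subsetT _)); last first.
  apply: higman_index; rewrite ?subsetT //.
  have cD : #|D| = 8.
    rewrite -(Lagrange VnD) card_klein_four -[#|_ : _|]/#|rcosets _ _| cosets cards2 neq //.
  have := Lagrange (subsetT D); rewrite cD cardsT card_Sn /= => e.
  have -> : #|[set: 'S_4] : D| = 3 by apply/eqP; rewrite -(eqn_pmul2l (isT : 0 < 8)%N) e.
  by rewrite -(dvdn_pcharf char2).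
have jn0 : jn kn ord0 = o 0 by apply: val_inj; rewrite /= inordK.
have jn1 : jn kn ord_max = o 1 by apply: val_inj; rewrite /= inordK.
have [s [sE s01 s10]] : exists s : 'S_2, [/\ rho t = ext 1 (perm_mx s), s ord0 = ord_max & s ord_max = ord0].
  exists (tperm ord0 ord_max); split; rewrite ?tpermL ?tpermR //.
  rewrite /=; congr ext; apply: heart_mx_perm => //.
    move=> j; have [->|->] : j = ord0 \/ j = ord_max.
    - by case: j => [[|[|j]] ltj] //; [left|right]; apply: val_inj.
    - by rewrite tpermL jn0 tpermL jn1.
    - by rewrite tpermR jn1 tpermR jn0.
  by apply: tpermD; rewrite -val_eqE /= inordK.
pose th : 'M[F]_#|{: rset 2 1}| := sdiag 1 (fun A : {set 'I_2} => (A == [set ord0])%:R).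
apply: (@rconj_family _ _ _ _ rho _ _ th VnD (subsetT _)).
  by move=> v Vv; rewrite /rconj !klein_four_acts_trivially ?groupV // mul1mx mulmx1.
have cV : {in klein_four, forall v, rconj rho v th = th}.
  by move=> v Vv; rewrite /rconj !klein_four_acts_trivially ?groupV // mul1mx mulmx1.
rewrite cosets big_setU1 ?inE //= big_set1.
rewrite -{1}(rcoset1 klein_four) !rconj_repr ?subsetT ?inE // rconj1.
have -> : rconj rho t th = sdiag 1 (fun A : {set 'I_2} => (A == [set ord_max])%:R).
  rewrite /rconj sE -mulmxA -(@ext_perm_sdiag _ _ _ _ _ (fun A : {set 'I_2} => (A == [set ord_max])%:R)).
    by rewrite -sE mulmxA -repr_mxM ?inE // mulVg repr_mx1 mul1mx.
  move=> A; rewrite -s01 -imset_set1 (inj_eq (imset_inj (@perm_inj _ s))) //.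
rewrite /th /sdiag -raddfD -diag_const_mx; congr diag_mx; apply/rowP=> i; rewrite !mxE.
case: (enum_val i) => A /= /cards1P[x ->]; rewrite !(inj_eq set1_inj).
by case: x => [[|[|x]] ltx]; rewrite // -!val_eqE /= ?addr0 ?add0r.
Qed.

End DegreeFour.

(** * Vertices *)

Lemma vertex_conj_rsim (F : fieldType) (gT : finGroupType) (G : {group gT}) m1 m2
    (rG : mx_representation F G m1) (rho : mx_representation F G m2) (Q P : {group gT}) :
    mx_rsim rG rho -> P \subset G -> is_vertex rG Q -> higman rho P G ->
    (forall K : {group gT}, K \subset G -> higman rho K G ->
       exists2 g, g \in G & P \subset (K :^ g)%g) ->
  exists2 g, g \in G & Q :=: (P :^ g)%g.
Proof.
move=> sim sPG vQ hP lowP; apply: (vertex_conj sPG vQ).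
  by apply: higman_rsim (mx_rsim_sym sim) hP.
by move=> K sKG hK; apply: lowP sKG (higman_rsim (subxx G) sim hK).
Qed.

Lemma hook_head_rsim (F : fieldType) n r k (kn : (k < n)%N) (l : 'I_n) (ok : heart_ok F kn l) :
    (k <= l)%N -> (r <= k)%N -> r`!%:R != 0 :> F ->
  mx_rsim (specht_head F n (hook n r)) (hook_repr ok r).
Proof.
move=> kl rk rfact; have e : n = ((n - r).-1.+1 + r)%N.
  by rewrite prednK ?subnK // ?subn_gt0 ?(leq_ltn_trans rk) // ltnW // (leq_ltn_trans rk).
move: kn l ok kl; rewrite e => kn l ok kl; rewrite hookE.
exact: specht_head_rsim.
Qed.

Section HookVertices.

Variables (F : fieldType) (p : nat).
Hypothesis charFp : p \in [pchar F].
Let p_pr : prime p := pcharf_prime charFp.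

Lemma fact_pchar_neq0 r : (r < p)%N -> r`!%:R != 0 :> F.
Proof.
move=> ltrp; rewrite -(dvdn_pcharf charFp) fact_prod big_nat.
rewrite Euclid_dvd_prod //; elim/big_ind: _ => // [b c nb nc|i].
  by rewrite negb_or nb.
by case/andP=> i_gt0; rewrite ltnS => lei; rewrite gtnNdvd // (leq_ltn_trans lei).
Qed.

Lemma vertex_hook_coprime k r (Q : {group 'S_k.+1}) : (r < p)%N -> (r <= k)%N ->
    ~~ (p %| k.+1)%N -> is_vertex (specht_head F k.+1 (hook k.+1 r)) Q ->
  exists (P : {group 'S_k.+1}) (x : 'S_k.+1),
    p.-Sylow(hook_young k.+1 r) P /\ Q :=: (P :^ x)%g.
Proof.
move=> ltrp lerk ndvd vQ.
have nzn : k.+1%:R != 0 :> F by rewrite -(dvdn_pcharf charFp).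
have kn : (k < k.+1)%N by [].
have ok : heart_ok F kn (Ordinal kn) by apply: heart_ok_coprime.
have sim : mx_rsim (specht_head F k.+1 (hook k.+1 r)) (hook_repr ok r).
  by apply: hook_head_rsim => //; apply: fact_pchar_neq0.
have [P sylP] := Sylow_exists p (hook_young k.+1 r).
have [x _ QP] : exists2 x, x \in [set: 'S_k.+1]%G & Q :=: (P :^ x)%g; last by exists P, x.
apply: (vertex_conj_rsim sim (subsetT _) vQ).
  apply: (higman_trans (pHall_sub sylP) (subsetT _)); last exact: higman_hook_young.
  apply: higman_index; rewrite ?subsetT ?(pHall_sub sylP) // -(dvdn_pcharf charFp).
  by have /and3P[_ _] := sylP; rewrite p'natE.
move=> K _ hK; apply: (hook_young_in_vertex lerk charFp (pHall_pgroup sylP)) hK.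
exact: pHall_sub sylP.
Qed.

Lemma vertex_hook_dvd k r (Q : {group 'S_k.+2}) : (r < p)%N -> (r <= k)%N ->
    (p %| k.+2)%N -> ~ [/\ p = 2, k.+2 = 4 & r = 1%N] ->
    is_vertex (specht_head F k.+2 (hook k.+2 r)) Q ->
  p.-Sylow([set: 'S_k.+2]) Q.
Proof.
move=> ltrp lerk dvd_pn excl vQ.
have kn : (k < k.+2)%N by [].
have ok : heart_ok F kn ord_max.
  by apply: heart_ok_dvd; apply/eqP; rewrite -(dvdn_pcharf charFp).
have sim : mx_rsim (specht_head F k.+2 (hook k.+2 r)) (hook_repr ok r).
  by apply: hook_head_rsim => //; rewrite ?fact_pchar_neq0 //= ltnW.
have [P sylP lowP] : exists2 P : {group 'S_k.+2}, p.-Sylow([set: 'S_k.+2]) P &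
    forall K : {group 'S_k.+2}, higman (hook_repr ok r) K [set: 'S_k.+2]%G ->
    exists2 g, g \in [set: 'S_k.+2] & P \subset (K :^ g)%g.
  (* If r < p - 1 the dimension of the module is prime to p. *)
  have [ltrp1|] := ltnP r.+1 p.
    have [P sylP] := Sylow_exists p [set: 'S_k.+2]%G; exists P => // K hK.
    apply: (higman_fixed charFp (pHall_pgroup sylP) (subsetT _) (subsetT _) hK (D := 1%:M)).
      by move=> x _; apply: rconj_scalar; rewrite inE.
    rewrite mxtrace1 card_rset -(dvdn_pcharf charFp).
    by have := ndvd_bin p_pr dvd_pn (ltn0Sn _) ltrp1; rewrite subn2.
  clear vQ; move=> lepr; have pE : p = r.+1 by apply/eqP; rewrite eqn_leq lepr ltrp.
  case: r pE => [|q] pE in lerk ok excl ltrp lepr sim *; first by have := prime_gt1 p_pr; rewrite pE.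
  have charFq : q.+2 \in [pchar F] by rewrite -pE.
  rewrite pE; apply: sylow_in_vertex_top => //; first by rewrite -pE.
    by case=> e; rewrite e ltnn in lerk.
  by case=> q0 k2; apply: excl; rewrite pE q0 k2.
have [g _ QP] : exists2 g, g \in [set: 'S_k.+2]%G & Q :=: (P :^ g)%g.
  apply: (vertex_conj_rsim sim (subsetT _) vQ) => [|K _ hK]; last exact: lowP.
  apply: higman_index; rewrite ?subsetT // -(dvdn_pcharf charFp).
  by have /and3P[_ _] := sylP; rewrite p'natE.
by rewrite QP pHallJ ?inE.
Qed.

End HookVertices.

Lemma vertex_hook_four (F : fieldType) (Q : {group 'S_4}) : 2 \in [pchar F] ->
  is_vertex (specht_head F 4 (hook 4 1)) Q -> Q :=: klein_four.
Proof.
move=> char2 vQ; have kn : (2 < 4)%N by [].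
have ok : heart_ok F kn ord_max.
  by apply: heart_ok_dvd; apply/eqP; rewrite -(dvdn_pcharf char2).
have sim : mx_rsim (specht_head F 4 (hook 4 1)) (hook_repr ok 1).
  by apply: hook_head_rsim => //; rewrite oner_neq0.
have [g _ ->] : exists2 g, g \in [set: 'S_4]%G & Q :=: (klein_four :^ g)%g.
  apply: (vertex_conj_rsim sim (subsetT _) vQ); first exact: higman_klein_four.
  by move=> K _; apply: klein_four_in_vertex.
by apply: normP; rewrite (subsetP (normal_norm klein_four_normal)) ?inE.
Qed.

Theorem theorem1p2 (F : fieldType) (p : nat) (charFp : p \in [pchar F])
    (n : nat) (n_gt0 : (0 < n)%N) (r : nat) (lt_rp : (r < p)%N)
    (part_hook : is_partition_of n (hook n r)) (reg_hook : p_regular p (hook n r))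
    (Q : {group 'S_n}) (vtxQ : is_vertex (specht_head F n (hook n r)) Q) :
  [/\ (* (a) *)
      ~~ (p %| n)%N ->
        exists (P : {group 'S_n}) (x : 'S_n),
          p.-Sylow(hook_young n r) P /\ Q :=: (P :^ x)%g,
      (* (b) *)
      p = 2%N -> (p %| n)%N -> (n, r) <> (4, 1)%N -> 2.-Sylow([set: 'S_n]) Q,
      (* (c) *)
      p = 2%N -> n = 4%N -> r = 1%N ->
        2.-Sylow('Alt_('I_n)) Q /\
        (forall P : {group 'S_n}, 2.-Sylow('Alt_('I_n)) P -> P :=: Q)
    & (* (d) *)
      (2 < p)%N -> (p %| n)%N -> p.-Sylow([set: 'S_n]) Q].
Proof.
have p_pr := pcharf_prime charFp.
have ltrn : (r < n)%N.
  have /and3P[_ + _] := part_hook; rewrite inE negb_or => /andP[+ _].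
  by rewrite eq_sym subn_eq0 -ltnNge.
have dvd_case : (p %| n)%N -> ~ [/\ p = 2, n = 4 & r = 1%N] -> p.-Sylow([set: 'S_n]) Q.
  move=> dvd_pn excl; have lepn := dvdn_leq n_gt0 dvd_pn.
  (* If r = n - 1, then n = p because r < p <= n, and the hook is a column of length p. *)
  have ltr : (r.+1 < n)%N.
    rewrite ltn_neqAle ltrn andbT; apply/eqP=> en.
    have := reg_hook 1%N isT; rewrite /hook -en subSnn /= count_nseq /= !mul1n add1n.
    by rewrite ltnNge (leq_trans lepn) // -en.
  have [k nE] : exists k, n = k.+2 by exists n.-2; case: (n) ltr => [|[]].
  by subst n; apply: (vertex_hook_dvd charFp lt_rp ltr dvd_pn excl vtxQ).
split=> [ndvd|p2 dvd_pn excl|p2 n4 r1|p2 dvd_pn].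
- have [k nE] : exists k, n = k.+1 by exists n.-1; rewrite prednK.
  by subst n; apply: (vertex_hook_coprime charFp lt_rp ltrn ndvd vtxQ).
- by rewrite -p2; apply: dvd_case => // -[_ e1 e2]; apply: excl; rewrite e1 e2.
- subst n r; rewrite p2 in charFp.
  have QV := vertex_hook_four charFp vtxQ; rewrite QV; split; first exact: sylow_klein_four.
  move=> P sylP; have nV : klein_four <| 'Alt_('I_4).
    exact: normalS klein_four_even (subsetT _) klein_four_normal.
  by apply: (uniq_normal_Hall sylow_klein_four nV (Hall_max sylP)).
by apply: dvd_case => // -[e _ _]; rewrite e in p2.
Qed.
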